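(* The set $\mathcal C_n=\{m_{\mathfrak s\mathfrak t}:\lambda\in\mathrm{Par}^1_{l,n},\ \mathfrak s,\mathfrak t\in\mathrm{Std}(\lambda)\}$ is linearly independent over $F$, and hence it is an $F$-basis of the generalized blob algebra $B_n$.
   Context: **Combinatorics.** A one-column $l$-multipartition of $n$ is a tuple $\lambda=((1^{a_1}),\dots,(1^{a_l}))$ with integers $a_m\ge 0$, $\sum_m a_m=n$; its diagram is $[\lambda]=\{(r,1,m):1\le m\le l,\ 1\le r\le a_m\}$. $\mathrm{Par}^1_{l,n}$ is the set of all of them. Nodes are totally ordered by: $(r,1,m)\lhd(r',1,m')$ iff $r>r'$, or $r=r'$ and $m>m'$. A $\lambda$-tableau is a bijection $\mathfrak t:\{1,\dots,n\}\to[\lambda]$; it is standard if its entries increase from top to bottom in every component. $\mathrm{Tab}(\lambda)$, $\mathrm{Std}(\lambda)$: all, resp. standard, $\lambda$-tableaux. $\mathfrak t^\lambda$ is the $\lambda$-tableau with $\mathfrak t^\lambda(1)\rhd\cdots\rhd\mathfrak t^\lambda(n)$ (numbers filled in along rows). $S_n$ acts on the right on $\mathrm{Tab}(\lambda)$ by $\mathfrak t w=\mathfrak t\circ w$ (so $\mathfrak t s_k$, $s_k=(k,k+1)$, interchanges entries $k,k+1$), and $\mathfrak t^\lambda d(\mathfrak t)=\mathfrak t$ defines $d(\mathfrak t)\in S_n$. **Algebra.** Fix integers $e,l,n>1$, a field $F$ and a primitive $e$-th root of unity $q\in F\setminus\{1\}$; $I_e=\mathbb Z/e\mathbb Z$;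 $S_n$ acts on $I_e^n$ by permuting coordinates. Fix $\hat\kappa\in\mathbb Z^l$; $\kappa_m\in I_e$ is the image of $\hat\kappa_m$, also identified with its representative in $\{0,\dots,e-1\}$. $\hat\kappa$ is strongly adjacency-free: (i) $\hat\kappa_{m+1}-\hat\kappa_m\ge n$; (ii) $\kappa_i-\kappa_j\not\equiv 0,\pm1\bmod e$ for $i\ne j$; (iii) $\kappa_1\not\equiv\kappa_l+2\bmod e$; (iv) $\kappa_1<\dots<\kappa_l$. The generalized blob algebra $B_n$ is the unital associative $F$-algebra with generators $\psi_1,\dots,\psi_{n-1},y_1,\dots,y_n,e(\boldsymbol i)$ ($\boldsymbol i\in I_e^n$) and relations: $e(\boldsymbol i)e(\boldsymbol j)=\delta_{\boldsymbol i\boldsymbol j}e(\boldsymbol i)$; $\sum_{\boldsymbol i}e(\boldsymbol i)=1$; $e(\boldsymbol i)=0$ if $i_1\notin\{\kappa_1,\dots,\kappa_l\}$; $e(\boldsymbol i)=0$ if $i_1\in\{\kappa_1,\dots,\kappa_l\}$ and $i_2=i_1+1$; $y_1e(\boldsymbol i)=0$ if $i_1\in\{\kappa_1,\dots,\kappa_l\}$; $y_re(\boldsymbol i)=e(\boldsymbol i)y_r$; $\psi_re(\boldsymbol i)=e(s_r\cdot\boldsymbol i)\psi_r$; $y_ry_s=y_sy_r$; $\psi_ry_s=y_s\psi_r$ if $s\ne r,r+1$; $\psi_r\psi_s=\psi_s\psi_r$ if $|r-s|>1$; $\psi_ry_{r+1}e(\boldsymbol i)=(y_r\psi_r-\delta_{i_r,i_{r+1}})e(\boldsymbol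 i)$; $y_{r+1}\psi_re(\boldsymbol i)=(\psi_ry_r-\delta_{i_r,i_{r+1}})e(\boldsymbol i)$; $\psi_r^2e(\boldsymbol i)$ equals $0$ if $i_r=i_{r+1}$, $e(\boldsymbol i)$ if $i_r\ne i_{r+1},i_{r+1}\pm1$, $(y_{r+1}-y_r)e(\boldsymbol i)$ if $i_{r+1}=i_r+1$, $(y_r-y_{r+1})e(\boldsymbol i)$ if $i_{r+1}=i_r-1$; $\psi_r\psi_{r+1}\psi_re(\boldsymbol i)=(\psi_{r+1}\psi_r\psi_{r+1}+\alpha)e(\boldsymbol i)$ with $\alpha=-1$ if $i_{r+2}=i_r=i_{r+1}-1$, $\alpha=1$ if $i_{r+2}=i_r=i_{r+1}+1$, $\alpha=0$ otherwise. $*$ is the anti-involution of $B_n$ fixing all generators. **The elements $m_{\mathfrak s\mathfrak t}$.** The residue of $(r,1,m)$ is $\mathrm{res}=\kappa_m+1-r\in I_e$; $\boldsymbol i^\lambda=(\mathrm{res}(\mathfrak t^\lambda(1)),\dots,\mathrm{res}(\mathfrak t^\lambda(n)))$. For each $w\in S_n$ a reduced expression $w=s_{i_1}\cdots s_{i_N}$ is chosen once and for all and $\psi_w:=\psi_{i_1}\cdots\psi_{i_N}$. For $\mathfrak s,\mathfrak t\in\mathrm{Tab}(\lambda)$, $m_{\mathfrak s\mathfrak t}:=\psi_{d(\mathfrak s)}^*e(\boldsymbol i^\lambda)\psi_{d(\mathfrak t)}\in B_n$. *)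

(* Defs.v *)
From HB Require Import structures.
From mathcomp Require Import all_boot all_order all_algebra perm.
From mathcomp Require Import boolp.

Set Implicit Arguments.
Unset Strict Implicit.
Unset Printing Implicit Defensive.

Import Order.TTheory GRing.Theory Num.Theory.
Local Open Scope quotient_scope.
Local Open Scope ring_scope.

(* Unital associative algebras presented by generators and relations.  The     *)
(* algebra is the quotient of the formal algebra expressions by the least      *)
(* congruence containing the axioms of unital associative F-algebras and the   *)
(* relations.  It may be the zero ring, so it is a pzRingType and an lmodType; *)
(* MathComp's algType, which demands 1 != 0, is not available a priori.        *)

Section Presentation.
Variables (F : fieldType) (G : Type).

Inductive term : Type :=
| TGen of G
| TZero
| TOne
| TAdd of term & term
| TMul of term & term
| TScale of F & term.

HB.instance Definition _ := gen_eqMixin term.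
HB.instance Definition _ := gen_choiceMixin term.

Definition TSub (t u : term) : term := TAdd t (TScale (-1) u).

Variable R : term -> term -> Prop.

Inductive cong : term -> term -> Prop :=
| cong_rel t u : R t u -> cong t u
| cong_refl t : cong t t
| cong_sym t u : cong t u -> cong u t
| cong_trans t u v : cong t u -> cong u v -> cong t v
| cong_add t t' u u' : cong t t' -> cong u u' -> cong (TAdd t u) (TAdd t' u')
| cong_mul t t' u u' : cong t t' -> cong u u' -> cong (TMul t u) (TMul t' u')
| cong_scale a t t' : cong t t' -> cong (TScale a t) (TScale a t')
| cong_addA t u v : cong (TAdd t (TAdd u v)) (TAdd (TAdd t u) v)
| cong_addC t u : cong (TAdd t u) (TAdd u t)
| cong_add0 t : cong (TAdd TZero t) t
| cong_addN t : cong (TAdd (TScale (-1) t) t) TZero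
| cong_mulA t u v : cong (TMul t (TMul u v)) (TMul (TMul t u) v)
| cong_mul1l t : cong (TMul TOne t) t
| cong_mul1r t : cong (TMul t TOne) t
| cong_mulDl t u v : cong (TMul (TAdd t u) v) (TAdd (TMul t v) (TMul u v))
| cong_mulDr t u v : cong (TMul t (TAdd u v)) (TAdd (TMul t u) (TMul t v))
| cong_scaleA a b t : cong (TScale a (TScale b t)) (TScale (a * b) t)
| cong_scale1 t : cong (TScale 1 t) t
| cong_scaleDr a t u : cong (TScale a (TAdd t u)) (TAdd (TScale a t) (TScale a u))
| cong_scaleDl a b t : cong (TScale (a + b) t) (TAdd (TScale a t) (TScale b t))
| cong_scaleAl a t u : cong (TScale a (TMul t u)) (TMul (TScale a t) u)
| cong_scaleAr a t u : cong (TScale a (TMul t u)) (TMul t (TScale a u)).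

Definition congb (t u : term) : bool := `[< cong t u >].

Fact congb_refl : reflexive congb.
Proof. by move=> t; apply/asboolP; apply: cong_refl. Qed.

Fact congb_sym : symmetric congb.
Proof. by move=> t u; apply/asboolP/asboolP; apply: cong_sym. Qed.

Fact congb_trans : transitive congb.
Proof.
by move=> u t v /asboolP tu /asboolP uv; apply/asboolP; apply: cong_trans tu uv.
Qed.

Canonical cong_equiv := EquivRel congb congb_refl congb_sym congb_trans.

Definition palg : Type := {eq_quot cong_equiv}.

HB.instance Definition _ := Choice.on palg.
HB.instance Definition _ := EqQuotient.on palg.

Definition palg_class (t : term) : palg := \pi_palg t.

Lemma palg_eqP t u : palg_class t = palg_class u <-> cong t u.
Proof.
split=> [/eqmodP/asboolP //|tu].
by apply/eqmodP/asboolP.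
Qed.

Lemma palg_ind (P : palg -> Prop) :
  (forall t, P (palg_class t)) -> forall x, P x.
Proof. by move=> Pt x; rewrite -[x]reprK; apply: Pt. Qed.

Lemma cong_repr t : cong (repr (palg_class t)) t.
Proof. by apply/palg_eqP; rewrite /palg_class reprK. Qed.

Definition palg_gen (g : G) : palg := palg_class (TGen g).
Definition palg_zero : palg := palg_class TZero.
Definition palg_one : palg := palg_class TOne.
Definition palg_add (x y : palg) : palg := palg_class (TAdd (repr x) (repr y)).
Definition palg_mul (x y : palg) : palg := palg_class (TMul (repr x) (repr y)).
Definition palg_scale (a : F) (x : palg) : palg := palg_class (TScale a (repr x)).
Definition palg_opp (x : palg) : palg := palg_scale (-1) x.

Lemma palg_addE t u :
  palg_add (palg_class t) (palg_class u) = palg_class (TAdd t u).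
Proof. by apply/palg_eqP; apply: cong_add; apply: cong_repr. Qed.

Lemma palg_mulE t u :
  palg_mul (palg_class t) (palg_class u) = palg_class (TMul t u).
Proof. by apply/palg_eqP; apply: cong_mul; apply: cong_repr. Qed.

Lemma palg_scaleE a t : palg_scale a (palg_class t) = palg_class (TScale a t).
Proof. by apply/palg_eqP; apply: cong_scale; apply: cong_repr. Qed.

Let opE := (palg_addE, palg_mulE, palg_scaleE).

Fact palg_addA : associative palg_add.
Proof.
elim/palg_ind=> t; elim/palg_ind=> u; elim/palg_ind=> v; rewrite !opE.
by apply/palg_eqP; apply: cong_addA.
Qed.

Fact palg_addC : commutative palg_add.
Proof.
elim/palg_ind=> t; elim/palg_ind=> u; rewrite !opE.
by apply/palg_eqP; apply: cong_addC.
Qed.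

Fact palg_add0 : left_id palg_zero palg_add.
Proof.
by elim/palg_ind=> t; rewrite !opE; apply/palg_eqP; apply: cong_add0.
Qed.

Fact palg_addN : left_inverse palg_zero palg_opp palg_add.
Proof.
by elim/palg_ind=> t; rewrite /palg_opp !opE; apply/palg_eqP; apply: cong_addN.
Qed.

HB.instance Definition _ :=
  GRing.isZmodule.Build palg palg_addA palg_addC palg_add0 palg_addN.

Fact palg_mulA : associative palg_mul.
Proof.
elim/palg_ind=> t; elim/palg_ind=> u; elim/palg_ind=> v; rewrite !opE.
by apply/palg_eqP; apply: cong_mulA.
Qed.

Fact palg_mul1l : left_id palg_one palg_mul.
Proof.
by elim/palg_ind=> t; rewrite !opE; apply/palg_eqP; apply: cong_mul1l.
Qed.

Fact palg_mul1r : right_id palg_one palg_mul.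
Proof.
by elim/palg_ind=> t; rewrite !opE; apply/palg_eqP; apply: cong_mul1r.
Qed.

Fact palg_mulDl : left_distributive palg_mul palg_add.
Proof.
elim/palg_ind=> t; elim/palg_ind=> u; elim/palg_ind=> v; rewrite !opE.
by apply/palg_eqP; apply: cong_mulDl.
Qed.

Fact palg_mulDr : right_distributive palg_mul palg_add.
Proof.
elim/palg_ind=> t; elim/palg_ind=> u; elim/palg_ind=> v; rewrite !opE.
by apply/palg_eqP; apply: cong_mulDr.
Qed.

HB.instance Definition _ := GRing.Zmodule_isPzRing.Build palg
  palg_mulA palg_mul1l palg_mul1r palg_mulDl palg_mulDr.

Fact palg_scaleA a b (x : palg) :
  palg_scale a (palg_scale b x) = palg_scale (a * b) x.
Proof.
elim/palg_ind: x => t; rewrite !opE.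
by apply/palg_eqP; apply: cong_scaleA.
Qed.

Fact palg_scale1 : left_id 1 palg_scale.
Proof.
by elim/palg_ind=> t; rewrite !opE; apply/palg_eqP; apply: cong_scale1.
Qed.

Fact palg_scaleDr : right_distributive palg_scale +%R.
Proof.
move=> a; elim/palg_ind=> t; elim/palg_ind=> u.
rewrite -![_ + _]/(palg_add _ _) !opE.
by apply/palg_eqP; apply: cong_scaleDr.
Qed.

Fact palg_scaleDl (x : palg) : {morph palg_scale^~ x : a b / a + b}.
Proof.
move=> a b; elim/palg_ind: x => t.
rewrite -![palg_scale a _ + _]/(palg_add _ _) !opE.
by apply/palg_eqP; apply: cong_scaleDl.
Qed.

HB.instance Definition _ := GRing.Zmodule_isLmodule.Build F palg
  palg_scaleA palg_scale1 palg_scaleDr palg_scaleDl.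

Lemma palg_scalerAl (a : F) (x y : palg) : a *: (x * y) = (a *: x) * y.
Proof.
elim/palg_ind: x => t; elim/palg_ind: y => u.
rewrite /GRing.scale /GRing.mul /= !opE.
by apply/palg_eqP; apply: cong_scaleAl.
Qed.

Lemma palg_scalerAr (a : F) (x y : palg) : a *: (x * y) = x * (a *: y).
Proof.
elim/palg_ind: x => t; elim/palg_ind: y => u.
rewrite /GRing.scale /GRing.mul /= !opE.
by apply/palg_eqP; apply: cong_scaleAr.
Qed.

Lemma palg_classD t u : palg_class (TAdd t u) = palg_class t + palg_class u.
Proof. by rewrite -palg_addE. Qed.
Lemma palg_classM t u : palg_class (TMul t u) = palg_class t * palg_class u.
Proof. by rewrite -palg_mulE. Qed.
Lemma palg_classZ a t : palg_class (TScale a t) = a *: palg_class t.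
Proof. by rewrite -palg_scaleE. Qed.
Lemma palg_classB t u : palg_class (TSub t u) = palg_class t - palg_class u.
Proof. by rewrite palg_classD palg_classZ scaleN1r. Qed.
Lemma palg_class0 : palg_class TZero = 0. Proof. by []. Qed.
Lemma palg_class1 : palg_class TOne = 1. Proof. by []. Qed.

Definition palg_classE :=
  (palg_classD, palg_classM, palg_classZ, palg_classB, palg_class0, palg_class1).

End Presentation.

Arguments TZero {F G}.
Arguments TOne {F G}.
Arguments TGen {F G}.

Fixpoint trev (F : fieldType) (G : Type) (t : term F G) : term F G :=
  match t with
  | TAdd u v => TAdd (trev u) (trev v)
  | TMul u v => TMul (trev v) (trev u)
  | TScale a u => TScale a (trev u)
  | _ => t
  end.

(* Indices are shifted down by one: k : 'I_n stands for k + 1 in {1, .., n},   *)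
(* r : 'I_n.-1 for r + 1 in {1, .., n - 1}, m : 'I_l for the component m + 1.  *)
(* The simple transposition of index r exchanges the entries lo r and hi r.    *)

Definition lo (n : nat) (r : 'I_n.-1) : 'I_n := widen_ord (leq_pred n) r.

Fact hi_subproof (n : nat) (r : 'I_n.-1) : (r.+1 < n)%N.
Proof. by rewrite -ltn_predRL. Qed.

Definition hi (n : nat) (r : 'I_n.-1) : 'I_n := Ordinal (hi_subproof r).

Definition stransp (n : nat) (r : 'I_n.-1) : 'S_n := tperm (lo r) (hi r).

Definition resseq (e n : nat) := {ffun 'I_n -> 'Z_e}.

Definition sact (e n : nat) (r : 'I_n.-1) (i : resseq e n) : resseq e n :=
  [ffun k => i (stransp r k)].

Section Blob.
Variables (F : fieldType) (e l n : nat) (kappa : 'I_l -> 'Z_e).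

Inductive blob_gen : Type :=
| GPsi of 'I_n.-1
| GY of 'I_n
| GE of resseq e n.

Local Notation Psi r := (TGen (GPsi r)).
Local Notation Y r := (TGen (GY r)).
Local Notation E i := (TGen (GE i)).

Declare Scope blob_term_scope.
Delimit Scope blob_term_scope with BT.
Local Notation "t + u" := (TAdd t u) : blob_term_scope.
Local Notation "t - u" := (TSub t u) : blob_term_scope.
Local Notation "t * u" := (TMul t u) : blob_term_scope.
Local Notation "a *: t" := (TScale a t) : blob_term_scope.
Local Notation "0" := TZero : blob_term_scope.
Local Notation "1" := TOne : blob_term_scope.

Definition is_kappa (a : 'Z_e) : bool := [exists m, a == kappa m].

Definition kdelta (i : resseq e n) (r : 'I_n.-1) : F :=
  (i (lo r) == i (hi r))%:R.

Definition braid_coeff (a b c : 'Z_e) : F :=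
  if (c == a) && (a == b - 1) then -1
  else if (c == a) && (a == b + 1) then 1
  else 0.

Inductive blob_rel : term F blob_gen -> term F blob_gen -> Prop :=
| rel_idem i :
    blob_rel (E i * E i)%BT (E i)
| rel_orth i j : i != j ->
    blob_rel (E i * E j)%BT 0%BT
| rel_sum :
    blob_rel (\big[@TAdd F blob_gen / 0%BT]_(i : resseq e n) E i)%BT 1%BT
| rel_cyclo (i : resseq e n) (p1 : 'I_n) : p1 = 0%N :> nat ->
    ~~ is_kappa (i p1) ->
    blob_rel (E i) 0%BT
| rel_blob (i : resseq e n) (p1 p2 : 'I_n) : p1 = 0%N :> nat -> p2 = 1%N :> nat ->
    is_kappa (i p1) -> i p2 = i p1 + 1 ->
    blob_rel (E i) 0%BT
| rel_y1 (i : resseq e n) (p1 : 'I_n) : p1 = 0%N :> nat ->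
    is_kappa (i p1) ->
    blob_rel (Y p1 * E i)%BT 0%BT
| rel_ye r i :
    blob_rel (Y r * E i)%BT (E i * Y r)%BT
| rel_psie r i :
    blob_rel (Psi r * E i)%BT (E (sact r i) * Psi r)%BT
| rel_yy r s :
    blob_rel (Y r * Y s)%BT (Y s * Y r)%BT
| rel_psiy r s : s != lo r -> s != hi r ->
    blob_rel (Psi r * Y s)%BT (Y s * Psi r)%BT
| rel_psipsi (r s : 'I_n.-1) : (r.+1 < s)%N || (s.+1 < r)%N ->
    blob_rel (Psi r * Psi s)%BT (Psi s * Psi r)%BT
| rel_psiyS r i :
    blob_rel (Psi r * Y (hi r) * E i)%BT
             ((Y (lo r) * Psi r - kdelta i r *: 1) * E i)%BT
| rel_ySpsi r i :
    blob_rel (Y (hi r) * Psi r * E i)%BT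
             ((Psi r * Y (lo r) - kdelta i r *: 1) * E i)%BT
| rel_quad_eq r (i : resseq e n) : i (lo r) = i (hi r) ->
    blob_rel (Psi r * Psi r * E i)%BT 0%BT
| rel_quad_far r (i : resseq e n) :
    i (lo r) != i (hi r) ->
    i (lo r) != i (hi r) + 1 -> i (lo r) != i (hi r) - 1 ->
    blob_rel (Psi r * Psi r * E i)%BT (E i)
| rel_quad_up r (i : resseq e n) : i (hi r) = i (lo r) + 1 ->
    blob_rel (Psi r * Psi r * E i)%BT ((Y (hi r) - Y (lo r)) * E i)%BT
| rel_quad_down r (i : resseq e n) : i (hi r) = i (lo r) - 1 ->
    blob_rel (Psi r * Psi r * E i)%BT ((Y (lo r) - Y (hi r)) * E i)%BT
| rel_braid (r s : 'I_n.-1) (i : resseq e n) : s = r.+1 :> nat ->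
    blob_rel (Psi r * Psi s * Psi r * E i)%BT
      ((Psi s * Psi r * Psi s
        + braid_coeff (i (lo r)) (i (hi r)) (i (hi s)) *: 1) * E i)%BT.

Definition blob : Type := palg blob_rel.

HB.instance Definition _ := Choice.on blob.
HB.instance Definition _ := GRing.PzRing.on blob.
HB.instance Definition _ := GRing.Lmodule.on blob.

Definition blob_psi (r : 'I_n.-1) : blob := palg_gen blob_rel (GPsi r).
Definition blob_y (r : 'I_n) : blob := palg_gen blob_rel (GY r).
Definition blob_e (i : resseq e n) : blob := palg_gen blob_rel (GE i).


Lemma blob_relE t u : blob_rel t u ->
  palg_class blob_rel t = palg_class blob_rel u.
Proof. by move=> tu; apply/palg_eqP; apply: cong_rel. Qed.

Lemma sactK r : involutive (@sact e n r).
Proof. by move=> i; apply/ffunP=> k; rewrite !ffunE tpermK. Qed.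

Lemma blob_e_y i r : blob_e i * blob_y r = blob_y r * blob_e i.
Proof.
by have := blob_relE (rel_ye r i); rewrite !palg_classE => ->.
Qed.

Lemma blob_e_psi i r : blob_e i * blob_psi r = blob_psi r * blob_e (sact r i).
Proof.
by have := blob_relE (rel_psie r (sact r i)); rewrite !palg_classE sactK => ->.
Qed.

Lemma sact_lo r (i : resseq e n) : sact r i (lo r) = i (hi r).
Proof. by rewrite ffunE tpermL. Qed.

Lemma sact_hi r (i : resseq e n) : sact r i (hi r) = i (lo r).
Proof. by rewrite ffunE tpermR. Qed.

Lemma blob_psiyS r i :
  blob_psi r * blob_y (hi r) * blob_e i
  = (blob_y (lo r) * blob_psi r - kdelta i r *: (1 : blob)) * blob_e i.
Proof. by have := blob_relE (rel_psiyS r i); rewrite !palg_classE. Qed.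

Lemma blob_ySpsi r i :
  blob_y (hi r) * blob_psi r * blob_e i
  = (blob_psi r * blob_y (lo r) - kdelta i r *: (1 : blob)) * blob_e i.
Proof. by have := blob_relE (rel_ySpsi r i); rewrite !palg_classE. Qed.

Lemma blob_scalar_comm a (x : blob) : x * (a *: (1 : blob)) = a *: (1 : blob) * x.
Proof. by rewrite -palg_scalerAr -palg_scalerAl mulr1 mul1r. Qed.

Lemma blob_e_psi2 i r :
  blob_e i * (blob_psi r * blob_psi r) = blob_psi r * blob_psi r * blob_e i.
Proof. by rewrite mulrA blob_e_psi -!mulrA blob_e_psi sactK. Qed.

Lemma blob_e_psi3 i r s t :
  blob_e i * (blob_psi r * (blob_psi s * blob_psi t))
  = blob_psi r * blob_psi s * blob_psi t * blob_e (sact t (sact s (sact r i))).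
Proof.
by rewrite mulrA blob_e_psi -mulrA (mulrA (blob_e _)) blob_e_psi
  -(mulrA _ (blob_e _)) blob_e_psi !mulrA.
Qed.

Lemma kdelta_sact r i : kdelta (sact r i) r = kdelta i r.
Proof. by rewrite /kdelta sact_lo sact_hi eq_sym. Qed.

Lemma kdelta_e r i :
  kdelta i r *: blob_e (sact r i) = kdelta i r *: blob_e i.
Proof.
rewrite /kdelta; case: eqP => [ii|_]; last by rewrite !scale0r.
congr (_ *: blob_e _); apply/ffunP=> k; rewrite ffunE /stransp.
by case: tpermP => // ->.
Qed.

Lemma blob_scale1_e a i : a *: (1 : blob) * blob_e i = a *: blob_e i.
Proof. by rewrite -palg_scalerAl mul1r. Qed.

Lemma blob_e_scale1 a i : blob_e i * (a *: (1 : blob)) = a *: blob_e i.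
Proof. by rewrite -palg_scalerAr mulr1. Qed.

Lemma braid_coeff_sym a b c : braid_coeff a b c = braid_coeff c b a.
Proof. by rewrite /braid_coeff eq_sym; case: eqP => [->|]. Qed.

Lemma blob_quad r i t : blob_rel (Psi r * Psi r * E i)%BT t ->
  palg_class blob_rel (E i * (Psi r * Psi r))%BT = palg_class blob_rel t.
Proof. by move=> /blob_relE <-; rewrite !palg_classE; apply: blob_e_psi2. Qed.

Lemma tperm_braid (T : finType) (a b c k : T) : a != b -> a != c -> b != c ->
  tperm a b (tperm b c (tperm a b k)) = tperm a c k.
Proof.
move=> ab ac bc; case: (tpermP a c k) => [->|->|/eqP ka /eqP kc].
- by rewrite tpermL tpermL tpermD.
- by rewrite [tperm a b c]tpermD // tpermR tpermR.
- have [->|kb] := eqVneq k b.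
    by rewrite tpermR [tperm b c a]tpermD 1?eq_sym // tpermL.
  rewrite [tperm a b k]tpermD 1?eq_sym // [tperm b c k]tpermD 1?eq_sym //.
  by rewrite tpermD // eq_sym.
Qed.

Lemma stransp_braid (r s : 'I_n.-1) : s = r.+1 :> nat ->
  (forall k, stransp r (stransp s (stransp r k)) = tperm (lo r) (hi s) k) *
  (forall k, stransp s (stransp r (stransp s k)) = tperm (lo r) (hi s) k) *
  (tperm (lo r) (hi s) (hi r) = hi r).
Proof.
move=> rs; have hilo : hi r = lo s by apply: val_inj; rewrite /= rs.
have [ab ac bc] : [/\ lo r != lo s, lo r != hi s & lo s != hi s].
  by rewrite -!val_eqE /= rs; split; rewrite neq_ltn ?ltnSn ?(ltnW (ltnSn _)).
rewrite /stransp hilo; split; first split.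
- by move=> k; apply: tperm_braid.
- move=> k; rewrite [tperm (lo s) _]tpermC [tperm (lo r) (lo s)]tpermC.
  by rewrite (tpermC (lo r) (hi s)) tperm_braid // eq_sym.
- by rewrite tpermD // eq_sym.
Qed.

Lemma trev_rel t u : blob_rel t u ->
  palg_class blob_rel (trev t) = palg_class blob_rel (trev u).
Proof.
case=> /=.
- by move=> i; apply/blob_relE/rel_idem.
- by move=> i j ij; apply/blob_relE/rel_orth; rewrite eq_sym.
- rewrite (big_morph (@trev F blob_gen) (op1 := @TAdd F blob_gen) (id1 := TZero)) //.
  exact/blob_relE/rel_sum.
- by move=> i p p0 h; apply/blob_relE; apply: rel_cyclo p0 h.
- by move=> i p p' p0 p1 h h'; apply/blob_relE; apply: rel_blob p0 p1 h h'.
- move=> i p p0 h; have := blob_relE (rel_y1 p0 h).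
  rewrite !palg_classE => <-; exact: blob_e_y.
- by move=> r i; apply/esym/blob_relE/rel_ye.
- move=> r i; have := blob_relE (rel_psie r (sact r i)).
  by rewrite sactK => <-.
- by move=> r s; apply/blob_relE/rel_yy.
- by move=> r s h h'; apply/esym/blob_relE/rel_psiy.
- by move=> r s; rewrite orbC => h; apply/blob_relE/rel_psipsi.
- move=> r i; rewrite !palg_classE.
  rewrite -!/(blob_psi _) -!/(blob_y _) -!/(blob_e _).
  rewrite mulrA blob_e_y -mulrA blob_e_psi mulrA blob_ySpsi.
  rewrite kdelta_sact mulrBl mulrBr blob_scale1_e blob_e_scale1 kdelta_e.
  by rewrite mulrA blob_e_psi -!mulrA blob_e_y.
- move=> r i; rewrite !palg_classE.
  rewrite -!/(blob_psi _) -!/(blob_y _) -!/(blob_e _).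
  rewrite mulrA blob_e_psi -mulrA blob_e_y mulrA blob_psiyS.
  rewrite kdelta_sact mulrBl mulrBr blob_scale1_e blob_e_scale1 kdelta_e.
  by rewrite mulrA blob_e_y -!mulrA blob_e_psi.
- by move=> r i h; apply/blob_quad/rel_quad_eq.
- by move=> r i h h' h''; apply/blob_quad/rel_quad_far.
- move=> r i h; rewrite (blob_quad (rel_quad_up h)) !palg_classE.
  by rewrite mulrBl mulrBr -!/(blob_y _) -!/(blob_e _) !blob_e_y.
- move=> r i h; rewrite (blob_quad (rel_quad_down h)) !palg_classE.
  by rewrite mulrBl mulrBr -!/(blob_y _) -!/(blob_e _) !blob_e_y.
- move=> r s i rs; have [[rsr srs] rhr] := stransp_braid rs.
  pose j := sact r (sact s (sact r i)).
  have jE k : j k = i (tperm (lo r) (hi s) k) by rewrite !ffunE rsr.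
  have jE' : j = sact s (sact r (sact s i)).
    by apply/ffunP=> k; rewrite jE !ffunE srs.
  have := blob_relE (rel_braid j rs).
  rewrite !palg_classE !jE tpermL tpermR rhr braid_coeff_sym.
  rewrite -!/(blob_psi _) -!/(blob_y _) -!/(blob_e _).
  set a := braid_coeff _ _ _ => H.
  have Hj : a *: blob_e j = a *: blob_e i.
    rewrite /a /braid_coeff; case: eqP => [ac|_]; last by rewrite !scale0r.
    congr (_ *: blob_e _); apply/ffunP=> k; rewrite jE.
    by case: tpermP => // ->.
  rewrite mulrDr blob_e_scale1 -Hj.
  by rewrite !blob_e_psi3 -/j -jE' H mulrDl blob_scale1_e.
Qed.

Lemma trev_cong t u : cong blob_rel t u -> cong blob_rel (trev t) (trev u).
Proof.
elim=> {t u} /=.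
- by move=> t u /trev_rel/palg_eqP.
- by move=> t; apply: cong_refl.
- by move=> t u _; apply: cong_sym.
- by move=> t u v _ tu _; apply: cong_trans tu.
- by move=> t t' u u' _ tt _ uu; apply: cong_add.
- by move=> t t' u u' _ tt _ uu; apply: cong_mul.
- by move=> a t t' _; apply: cong_scale.
- by move=> *; apply: cong_addA.
- by move=> *; apply: cong_addC.
- by move=> *; apply: cong_add0.
- by move=> *; apply: cong_addN.
- by move=> *; apply/cong_sym/cong_mulA.
- by move=> *; apply: cong_mul1r.
- by move=> *; apply: cong_mul1l.
- by move=> *; apply: cong_mulDr.
- by move=> *; apply: cong_mulDl.
- by move=> *; apply: cong_scaleA.
- by move=> *; apply: cong_scale1.
- by move=> *; apply: cong_scaleDr.
- by move=> *; apply: cong_scaleDl.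
- by move=> *; apply: cong_scaleAr.
- by move=> *; apply: cong_scaleAl.
Qed.

Definition blob_star (x : blob) : blob := palg_class blob_rel (trev (repr x)).

Lemma blob_star_class t :
  blob_star (palg_class blob_rel t) = palg_class blob_rel (trev t).
Proof. by apply/palg_eqP/trev_cong/cong_repr. Qed.

Lemma blob_starD x y : blob_star (x + y) = blob_star x + blob_star y.
Proof.
elim/palg_ind: x => t; elim/palg_ind: y => u.
by rewrite -palg_classD !blob_star_class palg_classD.
Qed.

Lemma blob_starM x y : blob_star (x * y) = blob_star y * blob_star x.
Proof.
elim/palg_ind: x => t; elim/palg_ind: y => u.
by rewrite -palg_classM !blob_star_class palg_classM.
Qed.

Lemma blob_starZ a x : blob_star (a *: x) = a *: blob_star x.
Proof.
elim/palg_ind: x => t.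
by rewrite -palg_classZ !blob_star_class palg_classZ.
Qed.

Lemma blob_star1 : blob_star 1 = 1.
Proof. exact: blob_star_class. Qed.

Lemma blob_starK : involutive blob_star.
Proof.
elim/palg_ind=> t; rewrite !blob_star_class; congr palg_class.
by elim: t => //= [t -> u ->|t -> u ->|a t ->].
Qed.

Lemma blob_star_gen g : blob_star (palg_gen blob_rel g) = palg_gen blob_rel g.
Proof. exact: blob_star_class. Qed.

End Blob.

(* A node (r, 1, m) is encoded as (r, m): its column is always 1.  Rows keep   *)
(* their value in {1, .., n}; row 0 is not used.                               *)

Definition node (l n : nat) : Type := ('I_n.+1 * 'I_l)%type.

HB.instance Definition _ l n := Finite.on (node l n).

(* (r, 1, m) <| (r', 1, m') *)
Definition node_lt (l n : nat) (x y : node l n) : bool :=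
  (y.1 < x.1)%N || (x.1 == y.1) && (y.2 < x.2)%N.

(* The component ((1^a_1), .., (1^a_l)); a_m <= n follows from the sum. *)
Definition is_par1 (l n : nat) (a : {ffun 'I_l -> 'I_n.+1}) : bool :=
  (\sum_m (a m : nat) == n)%N.

Definition Par1 (l n : nat) := {a : {ffun 'I_l -> 'I_n.+1} | is_par1 a}.

Section Tableaux.
Variables (l n : nat) (lam : Par1 l n).

Definition diagram : {set node l n} :=
  [set x : node l n | (1 <= x.1 <= val lam x.2)%N].

Definition is_tableau (t : {ffun 'I_n -> node l n}) : bool :=
  injectiveb t && ([set t k | k : 'I_n] == diagram).

Definition Tab := {t : {ffun 'I_n -> node l n} | is_tableau t}.

Definition is_standard (t : Tab) : bool :=
  [forall i : 'I_n, forall j : 'I_n,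
     ((val t i).2 == (val t j).2) && ((val t i).1 < (val t j).1)%N
     ==> (i < j)%N].

Definition Std := {t : Tab | is_standard t}.

Definition node_ge : rel (node l n) := fun x y => ~~ node_lt x y.

Let key (x : node l n) : nat := (x.1 * l + x.2)%N.

Let node_ltE x y : node_lt x y = (key y < key x)%N.
Proof.
have aux (a b : 'I_n.+1) (i j : 'I_l) : (a < b)%N -> (a * l + i < b * l + j)%N.
  move=> ab; apply: (@leq_trans (a.+1 * l)).
    by rewrite mulSn addnC ltn_add2r.
  by apply: leq_trans (leq_addr j _); rewrite leq_mul2r ab orbT.
rewrite /node_lt /key -val_eqE /=; case: (ltngtP x.1 y.1) => /= [xy|yx|->].
- by apply/esym/negbTE; rewrite -leqNgt; apply/ltnW/aux.
- by apply/esym/aux.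
- by rewrite ltn_add2l.
Qed.

Let key_inj : injective key.
Proof.
move=> x y xy; have := node_ltE x y; have := node_ltE y x.
rewrite xy ltnn /node_lt -!val_eqE /=.
case: ltngtP => //= e1; case: ltngtP => //= e2 _ _.
by case: x y e1 e2 {xy} => [a b] [c d] /= /val_inj -> /val_inj ->.
Qed.

Fact node_ge_total : total node_ge.
Proof.
move=> x y; rewrite /node_ge !node_ltE -!leqNgt.
by case: (leqP (key x)) => // /ltnW ->.
Qed.

Fact node_ge_trans : transitive node_ge.
Proof.
move=> y x z; rewrite /node_ge !node_ltE -!leqNgt => yx xz; exact: leq_trans yx xz.
Qed.

Fact card_diagram : #|diagram| = n.
Proof.
rewrite -[RHS](eqP (valP lam)) -sum1_card big_mkcond.
rewrite (eq_bigr (fun x : node l n => (0 < x.1 <= val lam x.2)%N : nat)); last first.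
  by move=> x _; rewrite inE; case: ifP.
rewrite -(pair_bigA _ (fun (r : 'I_n.+1) m => (0 < r <= val lam m)%N : nat)) /=.
rewrite exchange_big; apply: eq_bigr => m _.
rewrite big_ord_recl /= add0n.
have le_an : (val lam m <= n)%N by rewrite -ltnS.
rewrite (eq_bigr (fun i : 'I_n => if (i < val lam m)%N then 1%N else 0%N)); last first.
  by move=> i _; rewrite /=; case: ifP.
by rewrite -big_mkcond (big_ord_narrow le_an) sum_nat_const card_ord muln1.
Qed.

Fact initial_subproof : size (sort node_ge (enum diagram)) == n.
Proof. by rewrite size_sort -cardE card_diagram. Qed.

Definition initial_ffun : {ffun 'I_n -> node l n} :=
  [ffun k => tnth (Tuple initial_subproof) k].

Fact initial_tableau : is_tableau initial_ffun.
Proof.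
have uniq_t : uniq (Tuple initial_subproof) by rewrite sort_uniq enum_uniq.
apply/andP; split.
  apply/injectiveP => i j; rewrite !ffunE.
  by move/tuple_uniqP: uniq_t; apply.
apply/eqP/setP => x; rewrite -[RHS]mem_enum -[RHS](mem_sort node_ge).
apply/imsetP/idP => [[k _ ->]|/(tnthP (Tuple initial_subproof))[k ->]].
  by rewrite ffunE; exact: (mem_tnth k (Tuple initial_subproof)).
by exists k; rewrite ?ffunE.
Qed.

Definition initial : Tab := exist _ initial_ffun initial_tableau.

Lemma initialP (i j : 'I_n) :
  (i < j)%N -> node_lt (val initial j) (val initial i).
Proof.
move=> ij; rewrite node_ltE ltn_neqAle.
have /andP[/injectiveP inj _] := initial_tableau.
rewrite (inj_eq key_inj) (inj_eq inj) -val_eqE neq_ltn ij /=.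
rewrite leqNgt -node_ltE -/(node_ge _ _) !ffunE.
have x0 := tnth (Tuple initial_subproof) i.
rewrite !(tnth_nth x0) /=.
apply: (sorted_ltn_nth node_ge_trans) => //; rewrite ?inE ?(eqP initial_subproof) //.
exact: (sort_sorted node_ge_total).
Qed.

Fact perm_of_tab_subproof (t : Tab) :
  exists w : 'S_n, [forall k, val initial (w k) == val t k].
Proof.
have /andP[/injectiveP tinj /eqP tim] := valP t.
have /andP[_ /eqP iim] := initial_tableau.
have ex k : exists j, val initial j == val t k.
  have : val t k \in [set val initial j | j : 'I_n].
    by rewrite iim -tim imset_f.
  by case/imsetP=> j _ ->; exists j.
pose f k := xchoose (ex k).
have fE k : val initial (f k) = val t k by apply/eqP/(xchooseP (ex k)).
have f_inj : injective f by move=> i j fij; apply: tinj; rewrite -!fE fij.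
by exists (perm f_inj); apply/forallP=> k; rewrite permE fE.
Qed.

(* The tableau t w is the composite function t \o w, so perm_of_tab t is the  *)
(* d(t) with initial \o d(t) = t.                                              *)
Definition perm_of_tab (t : Tab) : 'S_n := xchoose (perm_of_tab_subproof t).

Lemma perm_of_tabP (t : Tab) k : val initial (perm_of_tab t k) = val t k.
Proof. by have /forallP/(_ k)/eqP := xchooseP (perm_of_tab_subproof t). Qed.

End Tableaux.

(* The word [:: r_1; ..; r_N] expresses w if w is the composite function       *)
(* s_{r_1} \o .. \o s_{r_N}.  The product of MathComp's group 'S_n is in the   *)
(* opposite order and is not used.                                             *)
Definition expresses (n : nat) (rs : seq 'I_n.-1) (w : 'S_n) : Prop :=
  forall k, w k = foldr (fun r j => stransp r j) k rs.

Definition reduced_expr (n : nat) (rs : seq 'I_n.-1) (w : 'S_n) : Prop :=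
  expresses rs w /\ forall rs', expresses rs' w -> (size rs <= size rs')%N.

Section Cellular.
Variables (F : fieldType) (e l n : nat) (kappa : 'I_l -> 'Z_e).
Variable rex : 'S_n -> seq 'I_n.-1.

Definition residue (x : node l n) : 'Z_e := kappa x.2 + 1 - (x.1 : nat)%:R.

Definition res_initial (lam : Par1 l n) : resseq e n :=
  [ffun k => residue (val (initial lam) k)].

Definition psi_perm (w : 'S_n) : blob F n kappa :=
  \prod_(r <- rex w) blob_psi F kappa r.

Definition mst (lam : Par1 l n) (s t : Tab lam) : blob F n kappa :=
  blob_star (psi_perm (perm_of_tab s)) * blob_e F kappa (res_initial lam)
  * psi_perm (perm_of_tab t).

Definition StdPair (lam : Par1 l n) : finType := (Std lam * Std lam)%type.

Definition mst_family (x : {lam : Par1 l n & StdPair lam}) : blob F n kappa :=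
  mst (val (tagged x).1) (val (tagged x).2).

End Cellular.

Section Adjacency.
Variables (e l n : nat) (hkappa : 'I_l -> int).

Definition kappa_of (m : 'I_l) : 'Z_e := (hkappa m)%:~R.

(* The last condition compares the representatives in {0, .., e - 1}. *)
Definition strongly_adjacency_free : Prop :=
  [/\ forall m m' : 'I_l, m' = m.+1 :> nat -> n%:Z <= hkappa m' - hkappa m,
      forall i j : 'I_l, i != j ->
        [/\ kappa_of i - kappa_of j != 0,
            kappa_of i - kappa_of j != 1
          & kappa_of i - kappa_of j != -1],
      forall m m' : 'I_l, m = 0%N :> nat -> m'.+1 = l -> kappa_of m != kappa_of m' + 2
    & forall i j : 'I_l, (i < j)%N -> (kappa_of i < kappa_of j)%N].

End Adjacency.

Section Bases.
Variables (F : fieldType) (V : lmodType F) (I : finType) (v : I -> V).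

Definition linearly_independent : Prop :=
  forall c : I -> F, \sum_i c i *: v i = 0 -> forall i, c i = 0.

Definition spanning : Prop :=
  forall x : V, exists c : I -> F, x = \sum_i c i *: v i.

Definition is_basis : Prop := linearly_independent /\ spanning.

End Bases.

(* Main.v *)
Require Import Defs.
From mathcomp Require Import all_boot all_order all_algebra perm.
From mathcomp Require Import ring zify boolp.

(** Both halves follow from one spanning theorem, [gen_alg_span].  It holds
    for the algebra generated, over central scalars, by elements [psi], [y],
    [e] of any ring that satisfy the quiver Hecke relations, the vanishing
    relations of the blob algebra on the first two residues, and
    [y_1 e(i) = x_m e(i)] for residue sequences [i] that start with [kappa_m],
    where [x_m] is a scalar.  The blob algebra is the case [x_m = 0].

    Spanning.  The nodes of a shape, in the order of the initial tableau, form
    a list of natural numbers that is increasing and closed under passing to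
    the node above.  Strong adjacency-freeness enters through the fact
    that two nodes which are closer in this order than a node and the one below
    it have residues that are neither equal nor adjacent, so that their strands
    pass freely through each other ([residue_fun_rkap]).  Hence an idempotent
    whose residue sequence cannot be read as the sequence of an initial tableau
    lies in the ideal generated by idempotents of sequences which are earlier
    in the lexicographic order, and modulo the same ideal each [y_k] acts by a
    scalar on the idempotent of an initial tableau ([straightening]).  So the
    ring is spanned by the two-sided ideals of the idempotents of shapes, taken
    in that order.  On the cell module of a shape the vectors [e psi_w] are
    considered modulo shorter words: there [psi_w] does not depend on the
    reduced word ([v_matsumoto]), words that are not reduced vanish, and so do
    words whose tableau is not standard, because a Garnir relation produces a
    residue sequence that leaves out a node ([v_garnir]).  What survives are
    the elements of the family.

    Independence.  Take [x_m] to be the power [m] of an indeterminate [X], with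
    [m] counted from 1.  Over the field [K] of rational functions the deformed
    relations have a seminormal representation, on a space with a basis of
    words in the components; [y_k] multiplies a word by the parameter of its
    letter number [k] ([klr_seminormal]).  The parameters are distinct, so over
    [K] the matrices generate every matrix unit between words of equal content
    ([gen_alg_unit_perm]).  By the spanning theorem these units lie in the span of
    the matrices of the family.  A standard tableau is determined by the word
    of the components of its entries, so the family has at most as many
    members as there are units, and its matrices are free over [K]
    ([familyK_free]).

    The matrices do not represent the blob algebra itself, but they satisfy
    its relations up to [X] times an element of the algebra over [F[X]] that
    they generate ([ev_rel]).  A linear relation between the elements [m_st],
    with coefficients [c] in [F], therefore gives that the same combination of
    the matrices is [X] times an element of that algebra.  By the spanning
    theorem over [F[X]], this element is a combination of the same matrices
    with coefficients [p] in [F[X]]; freeness yields [c = X p] in [F[X]], and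
    so [c = 0]. *)

Set Implicit Arguments.
Unset Strict Implicit.
Unset Printing Implicit Defensive.

Import GRing.Theory.

(** * Words in the simple transpositions *)

Lemma split_at (T : Type) (s : seq T) r : r.+1 < size s ->
  exists u a b w, s = u ++ a :: b :: w /\ size u = r.
Proof.
move=> rs; have := cat_take_drop r s; have := size_drop r s.
case: (drop r s) => [|a [|b w]] /=; [by lia | by lia | move=> _ <-].
by exists (take r s), a, b, w; rewrite size_takel //; lia.
Qed.

Section Words.
Variable n : nat.

Definition swapn (i j k : nat) : nat := if k == i then j else if k == j then i else k.
Definition adj (r : nat) : nat -> nat := swapn r r.+1.

(** The last letter acts first, so that appending a letter to a word
    exchanges two neighbouring values, as the action of permutations on tableaux
    from the right does. *)
Definition wfun (W : seq nat) (k : nat) : nat := foldr adj k W.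

Definition good (W : seq nat) : bool := all (fun r => r.+1 < n) W.

Definition reduced (W : seq nat) : Prop :=
  good W /\ forall V, good V -> wfun V =1 wfun W -> size W <= size V.

(** A disjunction of equations, from which linear arithmetic derives every
    identity between adjacent transpositions. *)
Lemma adjP r k : k = r /\ adj r k = r.+1 \/ k = r.+1 /\ adj r k = r \/
  k <> r /\ k <> r.+1 /\ adj r k = k.
Proof.
rewrite /adj /swapn; case: (k =P r) => ?; first by left.
by case: (k =P r.+1) => ?; right; [left | right].
Qed.

Lemma adjK r : involutive (adj r).
Proof. by move=> k; move: (adjP r k) (adjP r (adj r k)); lia. Qed.

Lemma adjl r : adj r r = r.+1. Proof. by rewrite /adj /swapn eqxx. Qed.
Lemma adjr r : adj r r.+1 = r.
Proof. by move: (adjP r r.+1); lia. Qed.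
Lemma adjD r k : k != r -> k != r.+1 -> adj r k = k.
Proof. by rewrite /adj /swapn => /negbTE -> /negbTE ->. Qed.

Lemma adj_comm r q k : r.+1 < q -> adj r (adj q k) = adj q (adj r k).
Proof.
move: (adjP q k) (adjP r k) (adjP r (adj q k)) (adjP q (adj r k)); lia.
Qed.

Lemma adj_braid r k :
  adj r (adj r.+1 (adj r k)) = adj r.+1 (adj r (adj r.+1 k)).
Proof.
move: (adjP r k) (adjP r.+1 k) (adjP r (adj r.+1 k)) (adjP r.+1 (adj r k)).
move: (adjP r (adj r.+1 (adj r k))) (adjP r.+1 (adj r (adj r.+1 k))); lia.
Qed.

Lemma wfun_rcons W r k : wfun (rcons W r) k = wfun W (adj r k).
Proof. by rewrite /wfun foldr_rcons. Qed.

Lemma good_rcons W r : good (rcons W r) = (r.+1 < n) && good W.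
Proof. by rewrite /good all_rcons. Qed.

Lemma wfun_inj W : injective (wfun W).
Proof. by elim: W => [//|r W IH] i j /(can_inj (adjK r))/IH. Qed.

Lemma wfun_revK W : cancel (wfun (rev W)) (wfun W).
Proof.
elim: W => [//|r W IH] k /=; rewrite rev_cons wfun_rcons.
by rewrite IH adjK.
Qed.

Lemma adj_lt r k : r.+1 < n -> (adj r k < n) = (k < n).
Proof. by move: (adjP r k); lia. Qed.

Lemma wfun_lt W k : good W -> (wfun W k < n) = (k < n).
Proof. by elim: W => [//|r W IH] /= /andP[rn /IH <-]; apply: adj_lt. Qed.

Lemma wfun_oob W k : good W -> n <= k -> wfun W k = k.
Proof.
elim: W => [//|r W IH] /= /andP[rn gW] kn; rewrite IH //.
by apply: adjD; lia.
Qed.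

(** The strands that start at [i] and [j] end in the opposite order, so they
    cross at some letter; without this letter they exchange their ends. This is
    the strong exchange condition. *)
Lemma exchange W i j : good W -> i < j -> wfun W j < wfun W i ->
  exists2 W', good W' /\ size W = (size W').+1 &
    forall k, wfun W' k = wfun W (swapn i j k).
Proof.
elim/last_ind: W i j => [|W q IH] i j; first by rewrite /wfun /=; lia.
rewrite good_rcons => /andP[qn gW] ij; rewrite !wfun_rcons => ji.
have [qij|qij] := ltnP (adj q i) (adj q j).
  have [W' [gW' sW'] W'E] := IH _ _ gW qij ji.
  exists (rcons W' q); first by rewrite good_rcons qn gW' !size_rcons sW'.
  move=> k; rewrite !wfun_rcons W'E; congr wfun.
  by rewrite /swapn !(can_eq (adjK q)); do 2?case: eqP.
exists W; first by rewrite size_rcons.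
move=> k; rewrite wfun_rcons.
have [-> ->] : i = q /\ j = q.+1.
  by move: (adjP q i) (adjP q j) qij; lia.
by rewrite -/(adj q k) adjK.
Qed.

Lemma exchange_adj W r : good W -> wfun W r.+1 < wfun W r ->
  exists G, [/\ good G, size W = (size G).+1 & wfun G =1 wfun (rcons W r)].
Proof.
move=> gW /(exchange gW (ltnSn r))[G [gG sG] GE]; exists G; split=> // k.
by rewrite wfun_rcons GE.
Qed.

(** A shorter word for [rcons W r] would have a descent at [r], and the
    exchange condition would make of it a word for [W] shorter than [W]. *)
Lemma reduced_up W r : r.+1 < n -> reduced W -> wfun W r < wfun W r.+1 ->
  reduced (rcons W r).
Proof.
move=> rn [gW mW] Wr; split=> [|V gV VE]; first by rewrite good_rcons rn.
have : wfun V r.+1 < wfun V r by rewrite !VE !wfun_rcons adjl adjr.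
case/(exchange_adj gV)=> G [gG -> GE]; rewrite size_rcons ltnS; apply: mW => // k.
by rewrite GE wfun_rcons VE wfun_rcons adjK.
Qed.

Lemma reduced_lt W r : reduced (rcons W r) -> wfun W r < wfun W r.+1.
Proof.
case; rewrite good_rcons size_rcons => /andP[rn gW] mW.
case: ltngtP => // [Wr|/wfun_inj]; last by lia.
have [G [gG sG GE]] := exchange_adj gW Wr.
by have := mW G gG GE; lia.
Qed.

Lemma reduced_rcons W r : reduced (rcons W r) -> reduced W.
Proof.
case; rewrite good_rcons size_rcons => /andP[rn gW] mW; split=> // V gV VE.
rewrite -ltnS -(size_rcons V r); apply: mW; first by rewrite good_rcons rn.
by move=> k; rewrite !wfun_rcons VE.
Qed.

Lemma reduced_eq W V : reduced W -> good V -> wfun V =1 wfun W ->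
  size V <= size W -> reduced V.
Proof.
move=> [gW mW] gV VE sV; split=> // V' gV' V'E; apply: leq_trans sV (mW _ gV' _).
by move=> k; rewrite V'E VE.
Qed.

Lemma reduced_size W V : reduced W -> reduced V -> wfun V =1 wfun W -> size V = size W.
Proof.
by move=> [gW mW] [gV mV] VE; apply/eqP; rewrite eqn_leq mW // mV.
Qed.

(** The exchange condition erases a letter of [W]; appending [r] restores the
    permutation and the length. *)
Lemma reduced_descent W r : reduced W -> wfun W r.+1 < wfun W r ->
  exists G, [/\ reduced (rcons G r), wfun (rcons G r) =1 wfun W,
    size W = (size G).+1 & r.+1 < n].
Proof.
move=> rW Wr; have [gW _] := rW; have [G [gG sG GE]] := exchange_adj gW Wr.
have rn : r.+1 < n.
  rewrite ltnNge; apply/negP=> nr; have := wfun_oob gW nr.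
  case: (ltngtP r.+1 n) nr => // [nr _|rn _] W1.
    by rewrite W1 wfun_oob // in Wr; lia.
  by have := wfun_lt r gW; lia.
have GrE : wfun (rcons G r) =1 wfun W by move=> k; rewrite wfun_rcons GE wfun_rcons adjK.
exists G; split=> //; apply: reduced_eq rW _ GrE _.
  by rewrite good_rcons rn.
by rewrite size_rcons sG.
Qed.

End Words.

Local Open Scope ring_scope.

(** * The quiver Hecke relations *)

Section KLRSystem.
Variables (I : finNzRingType) (n : nat).

(** Strands with such residues pass freely through each other, as [psi]
    squares to 1 on them. *)
Definition far (a b : I) : bool := [&& a != b, a != b + 1 & b != a + 1].

Lemma far_sym a b : far a b = far b a.
Proof. by rewrite /far eq_sym [X in _ && X]andbC. Qed.

Section Relations.
Variables (A : pzRingType) (psi y : nat -> A) (e : seq I -> A).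

Definition quad (r : nat) (a b : I) : A :=
  if a == b then 0 else
  if b == a + 1 then y r.+1 - y r else
  if b == a - 1 then y r - y r.+1 else 1.

Definition braid_sign (a b c : I) : A :=
  if (c == a) && (a == b - 1) then -1
  else if (c == a) && (a == b + 1) then 1
  else 0.

(** The relations of the blob algebra except those on the first residues, in
    any ring. Residue sequences are lists and the generators are indexed by all
    naturals, with value 0 out of range. A place in a sequence is given by the
    length of a prefix, so that a relation is read off from a decomposition of
    the list. *)
Record klr : Prop := Klr {
  klr_e_mul : forall s t, e s * e t = if s == t then e s else 0;
  klr_e_sum : \sum_(s : n.-tuple I) e s = 1;
  klr_e_size : forall s, size s != n -> e s = 0;
  klr_y_oob : forall k, (n <= k)%N -> y k = 0;
  klr_psi_oob : forall r, (n <= r.+1)%N -> psi r = 0;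
  klr_y_e : forall k s, y k * e s = e s * y k;
  klr_psi_e : forall u a b w,
    psi (size u) * e (u ++ a :: b :: w) = e (u ++ b :: a :: w) * psi (size u);
  klr_yy : forall k k', y k * y k' = y k' * y k;
  klr_psi_y : forall r k, k != r -> k != r.+1 -> psi r * y k = y k * psi r;
  klr_psi_psi : forall r r', (r.+1 < r')%N -> psi r * psi r' = psi r' * psi r;
  klr_psi_yS : forall u a b w,
    psi (size u) * y (size u).+1 * e (u ++ a :: b :: w) =
    (y (size u) * psi (size u) - (a == b)%:R) * e (u ++ a :: b :: w);
  klr_yS_psi : forall u a b w,
    y (size u).+1 * psi (size u) * e (u ++ a :: b :: w) =
    (psi (size u) * y (size u) - (a == b)%:R) * e (u ++ a :: b :: w);
  klr_quad : forall u a b w,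
    psi (size u) * psi (size u) * e (u ++ a :: b :: w) =
    quad (size u) a b * e (u ++ a :: b :: w);
  klr_braid : forall u a b c w,
    psi (size u) * psi (size u).+1 * psi (size u) * e (u ++ a :: b :: c :: w) =
    (psi (size u).+1 * psi (size u) * psi (size u).+1 + braid_sign a b c)
      * e (u ++ a :: b :: c :: w) }.

Lemma braid_sign_sym a b c : braid_sign a b c = braid_sign c b a.
Proof. by rewrite /braid_sign eq_sym; case: eqP => [->|]. Qed.

Hypothesis K : klr.

Lemma klr_e_psi u a b w :
  e (u ++ a :: b :: w) * psi (size u) = psi (size u) * e (u ++ b :: a :: w).
Proof. by rewrite (klr_psi_e K). Qed.

Lemma klr_e_psiS u a b c w :
  e (u ++ a :: b :: c :: w) * psi (size u).+1
  = psi (size u).+1 * e (u ++ a :: c :: b :: w).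
Proof.
have := klr_e_psi (rcons u a) b c w.
by rewrite -!cats1 -!catA size_cat addn1.
Qed.

Lemma klr_quad_e u a b w :
  e (u ++ a :: b :: w) * (psi (size u) * psi (size u)) =
  e (u ++ a :: b :: w) * quad (size u) a b.
Proof.
rewrite mulrA klr_e_psi -mulrA klr_e_psi mulrA (klr_quad K) /quad.
by do ?case: ifP => _;
  rewrite ?(mulrBl, mulrBr) ?(klr_y_e K) ?mul0r ?mulr0 ?mul1r ?mulr1.
Qed.

End Relations.

Lemma mulcE (A : pzRingType) (x y : A^c) : x * y = (y : A) * (x : A).
Proof. by []. Qed.

(** Reversing products permutes the relations. Statements on multiplication
    from the right thus give statements on multiplication from the left. *)
Lemma klr_opp (A : pzRingType) (psi y : nat -> A) (e : seq I -> A) :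
  klr psi y e -> @klr A^c psi y e.
Proof.
move=> K; have ep := klr_e_psi K; have epS := klr_e_psiS K.
split.
- by move=> s t; rewrite ?mulcE (klr_e_mul K) eq_sym; case: eqP => [->|].
- exact: klr_e_sum K.
- exact: klr_e_size K.
- exact: klr_y_oob K.
- exact: klr_psi_oob K.
- by move=> k s; rewrite ?mulcE (klr_y_e K).
- by move=> u a b w; rewrite ?mulcE ep.
- by move=> k k'; rewrite ?mulcE (klr_yy K).
- by move=> r k h1 h2; rewrite ?mulcE (klr_psi_y K h1 h2).
- by move=> r k h; rewrite ?mulcE (klr_psi_psi K h).
- move=> u a b w; rewrite ?mulcE mulrA -(klr_y_e K) -mulrA ep mulrA (klr_yS_psi K).
  rewrite ?mulcE eq_sym mulrBl mulrBr -mulrA (klr_y_e K) mulrA -ep -mulrA; congr (_ - _).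
  by case: eqP => [->|_]; rewrite ?mulcE ?mul0r ?mulr0 // mul1r mulr1.
- move=> u a b w; rewrite ?mulcE mulrA ep -mulrA -(klr_y_e K) mulrA (klr_psi_yS K).
  rewrite ?mulcE eq_sym mulrBl mulrBr -mulrA -ep mulrA (klr_y_e K) -mulrA; congr (_ - _).
  by case: eqP => [->|_]; rewrite ?mulcE ?mul0r ?mulr0 // mul1r mulr1.
- by move=> u a b w; rewrite ?mulcE (klr_quad_e K).
- move=> u a b c w; rewrite ?mulcE.
  have E1 : e (u ++ [:: a, b, c & w]) * (psi (size u) * (psi (size u).+1 * psi (size u)))
      = psi (size u) * psi (size u).+1 * psi (size u) * e (u ++ [:: c, b, a & w]).
    by rewrite mulrA ep -mulrA (mulrA (e _)) epS -mulrA ep !mulrA.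
  have E2 : e (u ++ [:: a, b, c & w]) * (psi (size u).+1 * (psi (size u) * psi (size u).+1))
      = psi (size u).+1 * psi (size u) * psi (size u).+1 * e (u ++ [:: c, b, a & w]).
    by rewrite mulrA epS -mulrA (mulrA (e _)) ep -mulrA epS !mulrA.
  rewrite E1 (klr_braid K) mulrDl mulrDr E2 braid_sign_sym /braid_sign /=.
  congr (_ + _); case: eqP => [->|_]; last by rewrite mul0r mulr0.
  by do 2?case: ifP => _; rewrite ?(mulN1r, mulrN1, mul1r, mulr1, mul0r, mulr0).
Qed.

End KLRSystem.

(** * Ideals of the generated algebra and moves of residues *)

Section GeneratedAlgebra.
Variables (I : finNzRingType) (A : pzRingType).
Variables (Z : A -> Prop) (psi y : nat -> A) (e : seq I -> A).

(** Scalars are central elements of the ring, singled out by a predicate, so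
    that one argument serves a field and a polynomial ring inside its field of
    fractions. *)
Record central_scalars : Prop := CentralScalars {
  cs1 : Z 1;
  csN1 : Z (- 1);
  csD : forall z z', Z z -> Z z' -> Z (z + z');
  csM : forall z z', Z z -> Z z' -> Z (z * z');
  csC : forall z x, Z z -> z * x = x * z }.

Inductive gen_alg : A -> Prop :=
| gen_alg_Z z : Z z -> gen_alg z
| gen_alg_psi r : gen_alg (psi r)
| gen_alg_y k : gen_alg (y k)
| gen_alg_e s : gen_alg (e s)
| gen_alg_D a b : gen_alg a -> gen_alg b -> gen_alg (a + b)
| gen_alg_M a b : gen_alg a -> gen_alg b -> gen_alg (a * b).

(** The multipliers come from the generated algebra and not from the whole
    ring: over a polynomial ring, an ideal of all matrices over the field of
    fractions would be too large. *)
Inductive ideal (G : A -> Prop) : A -> Prop :=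
| ideal_gen x : G x -> ideal G x
| ideal_0 : ideal G 0
| ideal_D x x' : ideal G x -> ideal G x' -> ideal G (x + x')
| ideal_L a x : gen_alg a -> ideal G x -> ideal G (a * x)
| ideal_R a x : gen_alg a -> ideal G x -> ideal G (x * a).

Inductive zspan (G : A -> Prop) : A -> Prop :=
| zspan_0 : zspan G 0
| zspan_D x x' : zspan G x -> zspan G x' -> zspan G (x + x')
| zspan_gen z x : Z z -> G x -> zspan G (z * x).

Lemma ideal_mono G G' : (forall x, G x -> ideal G' x) ->
  forall x, ideal G x -> ideal G' x.
Proof.
move=> GG' x; elim=> {x}; eauto using ideal.
Qed.

Hypothesis CS : central_scalars.

Lemma cs0 : Z 0.
Proof. by have := csD CS (cs1 CS) (csN1 CS); rewrite subrr. Qed.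

Lemma ideal_N G x : ideal G x -> ideal G (- x).
Proof. by rewrite -mulN1r; apply/ideal_L/gen_alg_Z/(csN1 CS). Qed.

Lemma ideal_B G x x' : ideal G x -> ideal G x' -> ideal G (x - x').
Proof. by move=> Gx /ideal_N; apply: ideal_D. Qed.

Lemma zspan_in G x : G x -> zspan G x.
Proof. by rewrite -{2}(mul1r x); apply/zspan_gen/(cs1 CS). Qed.

Lemma zspan_Z G z x : Z z -> zspan G x -> zspan G (z * x).
Proof.
move=> Zz; elim=> [|x1 x2 _ h1 _ h2|z' x' Zz' Gx'].
- by rewrite mulr0; apply: zspan_0.
- by rewrite mulrDr; apply: zspan_D.
- by rewrite mulrA; apply: zspan_gen => //; apply: csM.
Qed.

Lemma zspan_N G x : zspan G x -> zspan G (- x).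
Proof. by rewrite -mulN1r; apply/zspan_Z/(csN1 CS). Qed.

Lemma zspan_B G x x' : zspan G x -> zspan G x' -> zspan G (x - x').
Proof. by move=> Gx /zspan_N; apply: zspan_D. Qed.

Lemma zspan_sum G (T : Type) (r : seq T) (P : pred T) F :
  (forall i, P i -> zspan G (F i)) -> zspan G (\sum_(i <- r | P i) F i).
Proof.
by move=> h; elim/big_ind: _ => //; [apply: zspan_0 | apply: zspan_D].
Qed.

Lemma zspan_mono G G' : (forall x, G x -> zspan G' x) ->
  forall x, zspan G x -> zspan G' x.
Proof.
move=> GG' x; elim=> [|x1 x2 _ h1 _ h2|z' x' Zz' /GG' Gx'].
- exact: zspan_0.
- exact: zspan_D.
- exact: zspan_Z.
Qed.

Lemma zspan_mulr G G' a : (forall x, G x -> zspan G' (x * a)) ->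
  forall x, zspan G x -> zspan G' (x * a).
Proof.
move=> GG' x; elim=> [|x1 x2 _ h1 _ h2|z' x' Zz' /GG' Gx'].
- by rewrite mul0r; apply: zspan_0.
- by rewrite mulrDl; apply: zspan_D.
- by rewrite -mulrA; apply: zspan_Z.
Qed.

Lemma zspan_mull G G' a : (forall x, G x -> zspan G' (a * x)) ->
  forall x, zspan G x -> zspan G' (a * x).
Proof.
move=> GG' x; elim=> [|x1 x2 _ h1 _ h2|z' x' Zz' /GG' Gx'].
- by rewrite mulr0; apply: zspan_0.
- by rewrite mulrDr; apply: zspan_D.
- by rewrite mulrA -(csC CS a Zz') -mulrA; apply: zspan_Z.
Qed.

End GeneratedAlgebra.

#[local] Hint Resolve gen_alg_psi gen_alg_y gen_alg_e : core.

Section LocalMoves.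
Variables (I : finNzRingType) (n : nat) (A : pzRingType).
Variables (Z : A -> Prop) (psi y : nat -> A) (e : seq I -> A).
Hypothesis two_neq0 : 1 + 1 != 0 :> I.
Hypothesis CS : central_scalars Z.
Hypothesis K : klr n psi y e.
Variable G : A -> Prop.

Local Notation J := (ideal Z psi y e G).

Lemma quad_far r (a b : I) : far a b -> quad y r a b = 1.
Proof.
rewrite /quad => /and3P[/negbTE -> ab /negbTE ->]; case: eqP => // ba.
by rewrite ba subrK eqxx in ab.
Qed.

Lemma quad_pred r (a : I) : quad y r a (a - 1) = y r - y r.+1.
Proof.
rewrite /quad eqxx -subr_eq0 opprB addrC subrK oner_eq0.
case: eqP => // /addrI/eqP.
by rewrite eq_sym -subr_eq0 opprK (negbTE two_neq0).
Qed.

Lemma e_far u a b w : far a b ->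
  e (u ++ a :: b :: w) = psi (size u) * e (u ++ b :: a :: w) * psi (size u).
Proof.
move=> ab; rewrite -mulrA (klr_e_psi K) mulrA (klr_quad K) quad_far //.
by rewrite mul1r.
Qed.

Lemma ideal_swap u a b w : far a b ->
  J (e (u ++ b :: a :: w)) -> J (e (u ++ a :: b :: w)).
Proof.
by move=> ab h; rewrite e_far //; apply/ideal_R/ideal_L.
Qed.

Lemma ideal_move_left u v c w : all (far c) v ->
  J (e (u ++ c :: v ++ w)) -> J (e (u ++ v ++ c :: w)).
Proof.
elim/last_ind: v w => [//|v d IH] w; rewrite all_rcons => /andP[cd cv].
rewrite !cat_rcons => h; rewrite catA; apply: ideal_swap; first by rewrite far_sym.
by rewrite -catA; apply: IH.
Qed.

Lemma ideal_y_move_left u v c w x : Z x -> all (far c) v ->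
  J ((y (size u) - x) * e (u ++ c :: v ++ w)) ->
  J ((y (size (u ++ v)) - x) * e (u ++ v ++ c :: w)).
Proof.
move=> Zx; elim/last_ind: v w => [|v d IH] w; first by rewrite cats0.
rewrite all_rcons => /andP[cd cv]; rewrite !cat_rcons => /(IH _ cv) {IH}.
rewrite -rcons_cat size_rcons !catA; set r := size (u ++ v) => h.
have dc : far d c by rewrite far_sym.
rewrite e_far // mulrBl !mulrA.
have yp := klr_yS_psi K (u ++ v) c d w.
rewrite -/r in yp *; rewrite yp; have /negbTE -> : c != d by case/and3P: cd.
rewrite subr0 (csC CS (psi r) Zx) -!mulrBl -mulrBr -!mulrA.
by apply: ideal_L => //; rewrite mulrA; apply: ideal_R.
Qed.

(** Two equal neighbouring residues give a copy of the nilHecke algebra, in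
    which [y] is not a scalar unless the idempotent vanishes. *)
Lemma ideal_nilHecke u a w x : Z x ->
  J ((y (size u) - x) * e (u ++ a :: a :: w)) -> J (e (u ++ a :: a :: w)).
Proof.
set r := size u; set E := e _ => Zx; set D := (_ - _) * E => JD.
have pE : E * psi r = psi r * E by rewrite /E (klr_e_psi K).
have qE : psi r * psi r * E = 0 by rewrite (klr_quad K) /quad eqxx mul0r.
have ypE : y r * (psi r * E) = x * (psi r * E) + D * psi r.
  rewrite /D -mulrA pE mulrBl.
  by rewrite [RHS]addrC subrK.
have EE : E = x * (psi r * E) + D * psi r - psi r * (E * y r.+1).
  have H := klr_psi_yS K u a a w.
  rewrite -/r -/E eqxx mulrBl mul1r -!mulrA (klr_y_e K) in H.
  by rewrite H ypE subKr.
have JpE : J (psi r * E).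
  have -> : psi r * E = psi r * (D * psi r).
    rewrite {1}EE mulrBr mulrDr [psi r * (x * _)]mulrA -(csC CS (psi r) Zx).
    rewrite -(mulrA x) (mulrA (psi r) (psi r) E) qE mulr0 add0r.
    by rewrite (mulrA (psi r) (psi r)) (mulrA _ E) qE mul0r subr0.
  by apply/ideal_L/ideal_R.
rewrite EE; apply: ideal_B => //.
  apply: ideal_D; last exact: ideal_R.
  by apply: ideal_L => //; apply: gen_alg_Z.
by rewrite mulrA; apply: ideal_R.
Qed.

(** Here [psi] squares to the difference of the two [y], and the square
    passes through the idempotent of the second hypothesis; so both [y] act by
    the same scalar. *)
Lemma ideal_y_next u a w x :
  J ((y (size u) - x) * e (u ++ a :: a - 1 :: w)) ->
  J (e (u ++ a - 1 :: a :: w)) ->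
  J ((y (size u).+1 - x) * e (u ++ a :: a - 1 :: w)).
Proof.
move=> h1 h2.
have -> : (y (size u).+1 - x) * e (u ++ a :: a - 1 :: w)
   = (y (size u) - x) * e (u ++ a :: a - 1 :: w)
     - psi (size u) * e (u ++ a - 1 :: a :: w) * psi (size u).
  rewrite -[X in _ = _ - X]mulrA (klr_e_psi K) (mulrA (psi _)) (klr_quad K).
  by rewrite quad_pred -mulrBl; congr (_ * _); rewrite opprB [RHS]addrC addrA subrK.
by apply: ideal_B => //; apply/ideal_R/ideal_L.
Qed.

(** The extra scalar 1 of the braid relation writes the idempotent as a
    difference of two products, and each of them passes through one of the
    idempotents of the hypotheses. *)
Lemma ideal_braid u a w :
  J (e (u ++ a :: a :: a - 1 :: w)) -> J (e (u ++ a - 1 :: a :: a :: w)) ->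
  J (e (u ++ a :: a - 1 :: a :: w)).
Proof.
move=> h1 h2; have := klr_braid K u a (a - 1) a w.
rewrite /braid_sign eqxx subrK eqxx /=.
have -> : (a == a - 1 - 1) = false.
  by apply: contraNF two_neq0; rewrite -addrA -opprD -subr_eq0 opprB addrC subrK.
rewrite mulrDl mul1r [X in _ = X]addrC => /eqP; rewrite -subr_eq => /eqP <-; apply: ideal_B => //.
  by rewrite -mulrA (klr_psi_e K); apply: ideal_L; [apply: gen_alg_M|apply: ideal_R].
have := klr_e_psiS K u a a (a - 1) w; rewrite -mulrA => <-.
by apply: ideal_L; [apply: gen_alg_M|apply: ideal_R].
Qed.

End LocalMoves.

(** * Straightening residue sequences *)

Section RowLists.
Variables (I : finNzRingType) (l : nat) (rk : nat -> I).

(** The node in row [h], counted from 0, and column [m] has the key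
    [h * l + m]. Keys increase along the rows, [x + l] is the node below [x], and
    the keys strictly in between lie in the other columns, one in each. *)
Record residue_fun : Prop := ResidueFun {
  rf_l : (0 < l)%N;
  rf_two : 1 + 1 != 0 :> I;
  rf_S : forall x, rk (x + l)%N = rk x - 1%R;
  rf_far : forall x z, (x < z)%N -> (z < x + l)%N -> far (rk x) (rk z) }.

(** The initial segments of the initial tableaux of one-column shapes: a node
    is preceded by the node above it. *)
Definition rowlist (L : seq nat) : bool :=
  sorted ltn L && all (fun x => (x < l)%N || ((x - l)%N \in L)) L.

Hypothesis RF : residue_fun.

Lemma rowlist_rcons L z : rowlist (rcons L z) =
  [&& rowlist L, all (ltn^~ z) L & (z < l)%N || ((z - l)%N \in L)].
Proof.
have l0 := rf_l RF.
rewrite /rowlist !(sorted_pairwise ltn_trans) pairwise_rcons all_rcons mem_rcons inE.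
have [Lz|] := boolP (all (ltn^~ z) L); last by rewrite !andbF.
rewrite /= -andbA [X in _ && X]andbC; congr [&& _, _ & _].
  apply: eq_in_all => x xL; rewrite mem_rcons inE.
  have : (x < z)%N := allP Lz x xL.
  by case: (x - l =P z)%N => //; lia.
by case: (ltnP z l) => //= lz; case: eqP => //; lia.
Qed.

Lemma rowlist_cat L1 L2 : rowlist (L1 ++ L2) -> rowlist L1.
Proof.
elim/last_ind: L2 => [|L2 x IH]; first by rewrite cats0.
by rewrite -rcons_cat rowlist_rcons => /andP[/IH].
Qed.

Lemma rowlist_next L z : rowlist (rcons L z) -> rowlist (rcons (rcons L z) (z + l)%N).
Proof.
move=> Lz; rewrite rowlist_rcons Lz /= addnK mem_rcons inE eqxx orbT andbT.
move: Lz; rewrite rowlist_rcons => /and3P[_ Lz _]; have l0 := rf_l RF.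
rewrite all_rcons -[X in X && _]/(z < z + l)%N -{1}[z]addn0 ltn_add2l l0 /=.
by apply: sub_all Lz => x /= xz; apply: leq_trans xz (leq_addr _ _).
Qed.

Lemma rowlist_above L x : rowlist (rcons L x) -> (l <= x)%N ->
  exists L2 M, L = rcons L2 (x - l)%N ++ M /\
    all (fun z => (x - l < z)%N && (z < x)%N) M.
Proof.
rewrite rowlist_rcons => /and3P[/andP[sL _] Lx /orP[|pL] lx]; first by lia.
case/splitPr: pL sL Lx => L2 M sL Lx; exists L2, M; split; first by rewrite cat_rcons.
apply/allP=> z zM; apply/andP; split; last first.
  by apply: (allP Lx); rewrite mem_cat inE zM !orbT.
move: sL; rewrite (sorted_pairwise ltn_trans) pairwise_cat /= => /and4P[_ _ /allP h _].
exact: h.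
Qed.
End RowLists.

Section BlobSystem.
Variables (I : finNzRingType) (n l : nat) (rk : nat -> I) (A : pzRingType).
Variables (Z : A -> Prop) (X psi y : nat -> A) (e : seq I -> A).

(** The blob algebra has [X = 0]; for other values of [X] these relations
    define a deformation of it. *)
Record blob_system : Prop := BlobSystem {
  bs_klr : klr n psi y e;
  bs_X : forall x, Z (X x);
  bs_XS : forall x, X (x + l)%N = X x;
  bs_cyc : forall a w, (forall x, (x < l)%N -> rk x != a) -> e (a :: w) = 0;
  bs_blob : forall x w, (x < l)%N -> e (rk x :: rk x + 1 :: w) = 0;
  bs_y : forall x w, (x < l)%N -> y 0%N * e (rk x :: w) = X x * e (rk x :: w) }.

(** Residue sequences that leave [L] towards a smaller key precede [L] in the
    lexicographic order of row lists. All computations on [L] are done modulo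
    their idempotents. *)
Definition higher (L : seq nat) (a : A) : Prop :=
  exists k z s, [/\ (k < size L)%N, (z < nth 0%N L k)%N,
    rowlist l (rcons (take k L) z) & a = e (map rk (rcons (take k L) z) ++ s)].

Local Notation J G := (ideal Z psi y e G).
Local Notation U L := (J (higher L)).

Lemma higher_cat L L' a : higher L a -> higher (L ++ L') a.
Proof.
move=> [k [z [s [kL zk Lz ->]]]]; exists k, z, s.
by rewrite size_cat nth_cat takel_cat ?(ltnW kL) // kL; split=> //; apply: ltn_addr.
Qed.

Lemma U_cat L L' a : U L a -> U (L ++ L') a.
Proof. by apply: ideal_mono => x Lx; apply/ideal_gen/higher_cat. Qed.

Lemma U_last L x z s : (z < x)%N -> rowlist l (rcons L z) ->
  U (rcons L x) (e (map rk (rcons L z) ++ s)).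
Proof.
move=> zx Lz; apply: ideal_gen; exists (size L), z, s.
have -> : take (size L) (rcons L x) = L by rewrite -cats1 take_size_cat.
by rewrite size_rcons ltnSn nth_rcons ltnn eqxx.
Qed.

Hypothesis RF : residue_fun l rk.
Hypothesis CS : central_scalars Z.
Hypothesis BS : blob_system.
Let K := bs_klr BS.
Let two := rf_two RF.

Lemma far_shift (a b : I) : far (a + 1) b = far a (b - 1).
Proof.
rewrite /far (can2_eq (addrK 1) (subrK 1)) subrK (inj_eq (addIr 1)).
by rewrite (can2_eq (subrK 1) (addrK 1)).
Qed.

Lemma far_up x z : (x < z)%N -> (z < x + l)%N -> far (rk z + 1) (rk x).
Proof.
move=> xz zx; rewrite far_shift -(rf_S RF); apply: (rf_far RF) => //.
by rewrite ltn_add2r.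
Qed.

Let incompatible L c := forall z, rowlist l (rcons L z) -> rk z != c.

Definition straightens L := forall c s, incompatible L c -> U L (e (map rk L ++ c :: s)).

Definition y_scalar L x := forall s,
  U (rcons L x) ((y (size L) - X x) * e (map rk (rcons L x) ++ s)).

Lemma pred_neq (a : I) : a != a - 1.
Proof. by rewrite -subr_eq0 opprB addrC subrK oner_eq0. Qed.

(** An addable node with residue [rk p - 1] and a key above [p] would have a
    key below [p + l], and its residue would be adjacent to that of [p]. So
    either there is one with a key below [p], or the sequence cannot be
    continued. *)
Lemma skip_node L p s : straightens L -> rowlist l (rcons L p) ->
  U (rcons L p) (e (map rk L ++ rk p - 1 :: s)).
Proof.
move=> SL Lp; have [[z Lz zp]|nz] := pselect (exists2 z, rowlist l (rcons L z) & rk z = rk p - 1).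
  case: (ltngtP z p) => [lt_zp|lt_pz|eq_zp].
  - by rewrite -zp -cat_rcons -map_rcons; apply: U_last.
  - have zpl : (z < p + l)%N.
      move: Lz Lp; rewrite !(rowlist_rcons RF) => /and3P[_ _ /orP[zl|zL]] /and3P[_ Lp _].
        by apply: leq_trans zl (leq_addl _ _).
      by have := allP Lp _ zL; rewrite /=; lia.
    by have := rf_far RF lt_pz zpl; rewrite /far zp subrK eqxx andbF.
  - by have := pred_neq (rk p); rewrite -zp eq_zp eqxx.
rewrite -cats1; apply/U_cat/SL => z Lz; apply/eqP=> zp; by case: nz; exists z.
Qed.

(** The strand of [x] moves to the left through far residues until it is next
    to the node above [x], where [ideal_y_next] gives the scalar; in the first
    row it reaches the first place, where the scalar is given by a relation. *)
Lemma y_scalar_step L x :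
  (forall L', (size L' < size L)%N -> rowlist l L' -> straightens L') ->
  (forall L' x', (size L' < size L)%N -> rowlist l (rcons L' x') -> y_scalar L' x') ->
  rowlist l (rcons L x) -> y_scalar L x.
Proof.
move=> IHs IHy Lx s; rewrite map_rcons cat_rcons.
have [xl|lx] := ltnP x l.
  rewrite -[size L](size_map rk).
  apply: (ideal_y_move_left CS K (u := [::]) (v := map rk L)).
  - exact: bs_X BS x.
  - rewrite all_map; apply/allP=> z zL; rewrite /= far_sym.
    move: Lx; rewrite (rowlist_rcons RF) => /and3P[_ /allP/(_ z zL) zx _].
    apply: (rf_far RF) => //; exact: leq_trans xl (leq_addl _ _).
  - by rewrite mulrBl (bs_y BS) // subrr; apply: ideal_0.
have [L2 [M [LE Mx]]] := rowlist_above RF Lx lx.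
set p := (x - l)%N in LE Mx; have xE : x = (p + l)%N by rewrite subnK.
have L2p : rowlist l (rcons L2 p).
  apply: (@rowlist_cat _ _ _ RF _ M); rewrite -LE.
  by move: Lx; rewrite (rowlist_rcons RF) => /andP[].
have sz : (size L2 < size L)%N by rewrite LE size_cat size_rcons leq_addr.
have Up a : U (rcons L2 p) a -> U (rcons L (p + l)%N) a by rewrite LE rcons_cat; apply: U_cat.
have -> : map rk L = map rk (rcons L2 p) ++ map rk M by rewrite LE map_cat.
have -> : size L = size (map rk (rcons L2 p) ++ map rk M).
  by rewrite LE !size_cat !size_map.
rewrite -catA; apply: (ideal_y_move_left CS K); first exact: bs_X BS x.
  rewrite all_map; apply: sub_all Mx => z /= /andP[pz zx]; rewrite xE (rf_S RF).
  by rewrite far_sym -(rf_S RF); apply: (rf_far RF); lia.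
rewrite xE (rf_S RF) (bs_XS BS) size_map size_rcons map_rcons cat_rcons.
rewrite -[size L2](size_map rk).
have L2s : rowlist l L2 by move: L2p; rewrite (rowlist_rcons RF) => /andP[].
apply: (ideal_y_next two CS K).
  rewrite size_map -cat_rcons -map_rcons.
  apply: Up; exact: IHy.
by apply: Up; apply: skip_node => //; apply: IHs.
Qed.

(** Let [x] be the last node and [c] the residue that follows. If they are
    far, they are exchanged and induction applies. If they are equal, the scalar
    of [y] meets the nilHecke relation. The node below [x] has the residue
    [rk x - 1], so [c] is not this one. There remains [c = rk x + 1]: below the
    first row this is the residue of the node [p] above [x], and both strands
    move next to it, where the braid relation applies to the residues [rk p],
    [rk p - 1], [rk p]; in the first row they move to the front, where the
    idempotent vanishes by a relation. *)
Lemma straightens_step L :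
  (forall L', (size L' < size L)%N -> rowlist l L' -> straightens L') ->
  (forall L' x', (size L' < size L)%N -> rowlist l (rcons L' x') -> y_scalar L' x') ->
  rowlist l L -> straightens L.
Proof.
case/lastP: L => [_ _ _ c s nc|L x].
  by rewrite (bs_cyc BS) => [|z zl]; [apply: ideal_0 | apply: nc; rewrite /rowlist /= zl].
rewrite size_rcons => IHs IHy Lx c s nc.
have YLx := IHy L x (ltnSn _) Lx.
have Ls : rowlist l L by move: Lx; rewrite (rowlist_rcons RF) => /andP[].
rewrite map_rcons cat_rcons.
have [xc|xc] := boolP (far (rk x) c).
  apply: (ideal_swap K xc).
  have [[z Lz zc]|nz] := pselect (exists2 z, rowlist l (rcons L z) & rk z = c).
    case: (ltngtP z x) => [lt_zx|lt_xz|eq_zx].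
    - by rewrite -zc -cat_rcons -map_rcons; apply: U_last.
    - suff Lxz : rowlist l (rcons (rcons L x) z) by have := nc z Lxz; rewrite zc eqxx.
      rewrite (rowlist_rcons RF) Lx all_rcons /= lt_xz /=.
      move: Lz; rewrite (rowlist_rcons RF) => /and3P[_ -> /orP[->|] //].
      by rewrite mem_rcons inE => ->; rewrite !orbT.
    - by move: xc; rewrite -zc eq_zx /far eqxx.
  rewrite -cats1; apply/U_cat/IHs => // z Lz; apply/eqP=> zc; by case: nz; exists z.
have [xc1|xc1] := eqVneq (rk x) c.
  rewrite -xc1; apply: (ideal_nilHecke CS K (x := X x)); first exact: bs_X BS x.
  by rewrite size_map -cat_rcons -map_rcons; apply: YLx.
have [xc2|xc2] := eqVneq (rk x) (c + 1).
  by have := nc _ (rowlist_next RF Lx); rewrite (rf_S RF) xc2 addrK eqxx.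
have {xc xc1 xc2}cE : c = rk x + 1.
  by move: xc; rewrite /far xc1 xc2 /= => /negPn/eqP.
have [xl|lx] := ltnP x l.
  have Lfar z : z \in L -> (z < x)%N && (x < z + l)%N.
    move: Lx; rewrite (rowlist_rcons RF) => /and3P[_ /allP h _] /h /= ->.
    exact: leq_trans xl (leq_addl _ _).
  apply: (ideal_move_left K (u := [::]) (v := map rk L)).
    rewrite all_map; apply/allP=> z /Lfar /andP[zx xz].
    by rewrite /= far_sym; apply: (rf_far RF).
  apply: (ideal_move_left K (u := [:: rk x]) (v := map rk L)) => /=.
    by rewrite all_map; apply/allP=> z /Lfar /andP[zx xz] /=; rewrite cE; apply: far_up.
  by rewrite cE (bs_blob BS) //; apply: ideal_0.
have [L2 [M [LE Mx]]] := rowlist_above RF Lx lx.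
set p := (x - l)%N in LE Mx; have xE : x = (p + l)%N by rewrite subnK.
have L2p : rowlist l (rcons L2 p).
  by apply: (@rowlist_cat _ _ _ RF _ M); rewrite -LE.
have L2s : rowlist l L2 by move: L2p; rewrite (rowlist_rcons RF) => /andP[].
have sz : (size L2 < size L)%N by rewrite LE size_cat size_rcons leq_addr.
have Up a : U (rcons L2 p) a -> U (rcons L x) a by rewrite LE rcons_cat; apply: U_cat.
have cp : c = rk p by rewrite cE xE (rf_S RF) subrK.
have xp : rk x = rk p - 1 by rewrite xE (rf_S RF).
have -> : map rk L = map rk (rcons L2 p) ++ map rk M by rewrite LE map_cat.
rewrite -catA; apply: (ideal_move_left K).
  rewrite all_map; apply: sub_all Mx => z /= /andP[pz zx].
  by rewrite far_sym; apply: (rf_far RF) => //; lia.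
rewrite -cat_rcons; apply: (ideal_move_left K).
  rewrite all_map; apply: sub_all Mx => z /= /andP[pz zx].
  by rewrite cp; apply: (rf_far RF) => //; lia.
rewrite map_rcons !cat_rcons cp xp; apply: (ideal_braid two CS K); apply: Up.
  apply: (ideal_nilHecke CS K (x := X p)); first exact: bs_X BS p.
  rewrite size_map -cat_rcons -map_rcons; apply: IHy => //; lia.
by apply: skip_node => //; apply: IHs => //; lia.
Qed.

(** The two claims need each other: each step for [L] uses both of them for
    shorter lists. *)
Lemma straightening m L : (size L <= m)%N ->
  (rowlist l L -> straightens L) /\ (forall x, rowlist l (rcons L x) -> y_scalar L x).
Proof.
elim: m L => [|m IH] L szL.
  split; [apply: straightens_step | move=> x; apply: y_scalar_step];
    by move: szL; case: L.
split; [apply: straightens_step | move=> x; apply: y_scalar_step] => L' => [lt|x' lt|lt|x' lt];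
  by have [? ?] := IH L' (leq_trans lt szL); eauto.
Qed.

End BlobSystem.

(** * The cell module of a row list *)

Section CellModule.
Variables (I : finNzRingType) (n l : nat) (rk : nat -> I) (A : pzRingType).
Variables (Z : A -> Prop) (X psi y : nat -> A) (e : seq I -> A).
Hypothesis RF : residue_fun l rk.
Hypothesis CS : central_scalars Z.
Hypothesis K : klr n psi y e.
Hypothesis ZX : forall x, Z (X x).

Definition psiw (W : seq nat) : A := \prod_(r <- W) psi r.

Lemma psiw_rcons W r : psiw (rcons W r) = psiw W * psi r.
Proof. by rewrite /psiw -cats1 big_cat big_seq1. Qed.

Definition swap_seq (s : seq I) r := mkseq (fun k => nth 0 s (adj r k)) n.

Lemma swap_seqE u a b w : size (u ++ a :: b :: w) = n ->
  swap_seq (u ++ a :: b :: w) (size u) = u ++ b :: a :: w.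
Proof.
move=> sn; apply: (@eq_from_nth _ 0) => [|k]; rewrite size_mkseq.
  by rewrite -sn !size_cat.
move=> kn; rewrite nth_mkseq // !nth_cat.
have [->|ku] := eqVneq k (size u).
  by rewrite adjl ltnn ltnNge leqnSn /= subnn subSnn.
have [->|kSu] := eqVneq k (size u).+1.
  by rewrite adjr ltnn ltnNge leqnSn /= subnn subSnn.
rewrite adjD //; case: ltnP => // uk.
move: (size u) ku kSu uk => m /eqP km /eqP kSm mk.
by have -> : (k - m = (k - m.+2).+2)%N by lia.
Qed.

Lemma e_psi_swap s r : size s = n -> (r.+1 < n)%N ->
  e s * psi r = psi r * e (swap_seq s r).
Proof.
move=> sn rn; have [|u [a [b [w [sE <-]]]]] := @split_at _ s r; first by rewrite sn.
by rewrite sE swap_seqE -?sE // sE (klr_psi_e K).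
Qed.

Variables (L : seq nat) (U : A -> Prop).
Hypothesis Lrow : rowlist l L.
Hypothesis Lsize : size L = n.
(* Modulo [U] the idempotent of [L] generates a cell module: [y] acts on it
   by scalars, and a residue sequence that takes up the residue below a node
   before that node vanishes. *)
Hypothesis HU : forall x, ideal Z psi y e U x -> U x.
Hypothesis Uy : forall k, (k < n)%N -> U ((y k - X (nth 0%N L k)) * e (map rk L)).
Hypothesis Uskip : forall k s, (k < n)%N ->
  U (e (map rk (take k L) ++ rk (nth 0%N L k) - 1 :: s)).

Local Notation v := (e (map rk L)).

Let UR x a : gen_alg Z psi y e a -> U x -> U (x * a).
Proof. by move=> ga Ux; apply/HU/ideal_R => //; apply: ideal_gen. Qed.
Let UL x a : gen_alg Z psi y e a -> U x -> U (a * x).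
Proof. by move=> ga Ux; apply/HU/ideal_L => //; apply: ideal_gen. Qed.

(** Length of words filters the right module generated by [v] modulo [U]. The
    generators [y] and [e] preserve the filtration and [psi] raises it by one. *)
Definition short N (x : A) : Prop :=
  U x \/ exists2 W, good n W && (size W < N)%N & x = v * psiw W.

Local Notation M N := (zspan Z (short N)).

Lemma M_U N x : U x -> M N x.
Proof. by move=> Ux; apply: (zspan_in CS); left. Qed.

Lemma M_word N W : good n W -> (size W < N)%N -> M N (v * psiw W).
Proof. by move=> gW WN; apply: (zspan_in CS); right; exists W; rewrite ?gW. Qed.

Lemma M_mono N N' x : (N <= N')%N -> M N x -> M N' x.
Proof.
move=> NN'; apply: (zspan_mono CS) => z [Uz|[W /andP[gW WN] ->]]; first exact: M_U.
by apply: M_word => //; apply: leq_trans NN'.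
Qed.

Lemma M_psi N x r : M N x -> M N.+1 (x * psi r).
Proof.
apply: zspan_mulr => // z [Uz|[W /andP[gW WN] ->]]; first by apply/M_U/UR.
have [rn|nr] := ltnP r.+1 n; last by rewrite (klr_psi_oob K) // mulr0; apply: zspan_0.
by rewrite -mulrA -psiw_rcons; apply: M_word; rewrite ?good_rcons ?rn ?size_rcons.
Qed.

Definition resw W := mkseq (fun k => nth 0 (map rk L) (wfun W k)) n.

Lemma size_resw W : size (resw W) = n. Proof. exact: size_mkseq. Qed.

Lemma v_psiw W : good n W -> v * psiw W = psiw W * e (resw W).
Proof.
elim/last_ind: W => [_|W r IH].
  rewrite /psiw big_nil mulr1 mul1r; congr e; apply: (@eq_from_nth _ 0).
    by rewrite size_resw size_map.
  by move=> k; rewrite size_map Lsize => kn; rewrite nth_mkseq.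
rewrite good_rcons => /andP[rn /IH {}IH].
rewrite psiw_rcons mulrA IH -!mulrA e_psi_swap ?size_resw //; congr (_ * (_ * e _)).
apply: (@eq_from_nth _ 0); rewrite !size_mkseq // => k kn.
by rewrite !nth_mkseq ?wfun_rcons ?adj_lt.
Qed.

Lemma e_idem s : e s * e s = e s.
Proof. by rewrite (klr_e_mul K) eqxx. Qed.

Lemma v_psiw_e W : good n W -> v * psiw W = v * psiw W * e (resw W).
Proof. by move=> gW; rewrite v_psiw // -mulrA e_idem. Qed.

Lemma M_e N x s : M N x -> M N (x * e s).
Proof.
apply: zspan_mulr => // z [Uz|[W /andP[gW WN] ->]]; first by apply/M_U/UR.
rewrite v_psiw // -mulrA (klr_e_mul K); case: eqP => _; last by rewrite mulr0; apply: zspan_0.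
by rewrite -v_psiw //; apply: M_word.
Qed.

(** [y] moves to the left through the letters, up to shorter words, and acts
    on [v] by a scalar. *)
Lemma M_y_word W k : good n W -> M (size W).+1 (v * psiw W * y k).
Proof.
elim/last_ind: W k => [|W r IH] k.
  move=> _; rewrite /psiw big_nil mulr1 -(klr_y_e K).
  have [kn|nk] := ltnP k n; last by rewrite (klr_y_oob K) // mul0r; apply: zspan_0.
  rewrite -[y k](subrK (X (nth 0%N L k))) mulrDl; apply: zspan_D; first exact/M_U/Uy.
  apply: (zspan_Z CS) => //; rewrite -[v]mulr1.
  by have := @M_word 1 [::] isT isT; rewrite /psiw big_nil.
move=> gW; have := gW; rewrite good_rcons => /andP[rn gW0].
rewrite v_psiw_e // -mulrA -(klr_y_e K) !mulrA psiw_rcons size_rcons.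
set s := resw _; have sn : size s = n by apply: size_resw.
have [|u [a [b [w [sE su]]]]] := @split_at _ s r; first by rewrite sn.
rewrite mulrA -!mulrA (mulrA (psi r)) [X in M _ X]mulrA.
have My j : M (size W).+2 (v * psiw W * (y j * psi r * e s)).
  by rewrite !mulrA; apply/M_e/M_psi/IH.
have Md j : M (size W).+2 (v * psiw W * (j%:R * e s)).
  rewrite mulr_natl mulrnAr -mulr_natl; elim: j => [|j IHj].
    by rewrite mul0r; apply: zspan_0.
  by rewrite mulrS mulrDl mul1r; apply: zspan_D => //; apply/M_e/M_word.
have [->|kr] := eqVneq k r.
  have := klr_yS_psi K u a b w; rewrite -sE su mulrBl => /eqP.
  by rewrite eq_sym subr_eq => /eqP ->; rewrite mulrDr; apply: zspan_D.
have [->|kSr] := eqVneq k r.+1.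
  have := klr_psi_yS K u a b w; rewrite -sE su mulrBl => ->.
  by rewrite mulrBr; apply: zspan_B.
by rewrite (klr_psi_y K).
Qed.

Lemma M_y N x k : M N x -> M N (x * y k).
Proof.
apply: zspan_mulr => // z [Uz|[W /andP[gW WN] ->]]; first by apply/M_U/UR.
by apply: (M_mono WN); apply: M_y_word.
Qed.

Lemma M_alg N x a : gen_alg Z psi y e a -> M N x -> exists N', M N' (x * a).
Proof.
move=> ga; elim: ga N x => [z Zz|r|k|s|a1 a2 _ IH1 _ IH2|a1 a2 _ IH1 _ IH2] N x Mx.
- by exists N; rewrite -(csC CS) //; apply: zspan_Z.
- by exists N.+1; apply: M_psi.
- by exists N; apply: M_y.
- by exists N; apply: M_e.
- have [N1 h1] := IH1 N x Mx; have [N2 h2] := IH2 N x Mx.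
  exists (maxn N1 N2); rewrite mulrDr; apply: zspan_D.
    by apply: M_mono h1; apply: leq_maxl.
  by apply: M_mono h2; apply: leq_maxr.
- have [N1 h1] := IH1 N x Mx; have [N2 h2] := IH2 N1 _ h1.
  by exists N2; rewrite mulrA.
Qed.

(** The relations of [psi] need an idempotent next to them, and the
    idempotents sum to 1. *)
Lemma M_sum_e N x : (forall s, size s = n -> M N (x * e s)) -> M N x.
Proof.
move=> h; rewrite -[x]mulr1 -(klr_e_sum K) mulr_sumr; apply: zspan_sum => s _.
by apply: h; rewrite size_tuple.
Qed.

Lemma M_quad N x r : M N x -> M N (x * psi r * psi r).
Proof.
move=> Mx; have [rn|nr] := ltnP r.+1 n; last first.
  by rewrite (klr_psi_oob K) // mulr0; apply: zspan_0.
apply: M_sum_e => s sn; have [|u [a [b [w [-> <-]]]]] := @split_at _ s r.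
  by rewrite sn.
rewrite -2!mulrA (mulrA (psi _)) (klr_quad K) mulrA; apply: M_e.
rewrite /quad; case: ifP => _; first by rewrite mulr0; apply: zspan_0.
case: ifP => _; first by rewrite mulrBr; apply: zspan_B => //; apply: M_y.
case: ifP => _; first by rewrite mulrBr; apply: zspan_B => //; apply: M_y.
by rewrite mulr1.
Qed.

Lemma M_braid N x r : M N x ->
  M N (x * psi r * psi r.+1 * psi r - x * psi r.+1 * psi r * psi r.+1).
Proof.
move=> Mx; have [rn|nr] := ltnP r.+2 n; last first.
  by rewrite (klr_psi_oob K (r := r.+1)) // !(mulr0, mul0r) subrr; apply: zspan_0.
apply: M_sum_e => s sn; have [|u [a [b [w [sE su]]]]] := @split_at _ s r.
  by rewrite sn; apply: ltnW.
case: w sE => [|c w] sE.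
  by move: sn; rewrite sE size_cat su /=; lia.
have := klr_braid K u a b c w; rewrite su -sE => BR.
rewrite mulrDl -!mulrA in BR.
rewrite mulrBl -!mulrA BR mulrDr addrC addKr mulrA; apply: M_e.
rewrite /braid_sign; case: ifP => _; first by rewrite mulrN1; apply: (zspan_N CS).
by case: ifP => _; rewrite ?mulr1 // mulr0; apply: zspan_0.
Qed.

(** The braid relation holds up to a scalar, hence up to shorter words, and
    so does the theorem of Matsumoto. If two reduced words of a permutation end
    in different letters, both letters are descents, and the words can be made to
    end in the two sides of a commutation or of a braid relation. *)
Lemma v_matsumoto W V : reduced n W -> reduced n V -> wfun V =1 wfun W ->
  M (size W) (v * psiw W - v * psiw V).
Proof.
have [N] := ubnP (size W); elim: N W V => // N IH W V sWN rW rV VW.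
have sVW := reduced_size rW rV VW.
case/lastP: W => [|W r] in sWN rW VW sVW *.
  by case: V sVW {rV VW} => // _; rewrite subrr; apply: zspan_0.
case/lastP: V => [|V q] in rV VW sVW *; first by rewrite size_rcons in sVW.
move: sVW sWN; rewrite !size_rcons => -[sVW] sWN.
wlog rq : W V r q rW rV VW sVW sWN / (r <= q)%N => [hw|].
  have [|/ltnW] := leqP r q; first exact: hw.
  move=> qr; rewrite -opprB -sVW; apply: (zspan_N CS); apply: hw => //; last by rewrite sVW.
have rW0 := reduced_rcons rW; have rV0 := reduced_rcons rV.
have Wr := reduced_lt rW; have Vq := reduced_lt rV.
have VWk k : wfun V k = wfun W (adj r (adj q k)).
  by have := VW (adj q k); rewrite !wfun_rcons adjK.
have prefix W' V' p : size W' = size W -> reduced n W' -> reduced n V' ->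
    wfun V' =1 wfun W' -> M (size W).+1 (v * psiw (rcons W' p) - v * psiw (rcons V' p)).
  move=> sW' rW' rV' VW'; rewrite !psiw_rcons !mulrA -mulrBl; apply: M_psi.
  by rewrite -sW'; apply: IH => //; rewrite sW'.
have split3 a b c d : M (size W).+1 (a - b) -> M (size W).+1 (c - d) ->
    M (size W).+1 (b - d) -> M (size W).+1 (a - c).
  move=> ab cd bd; have -> : a - c = (a - b) + (b - d) - (c - d) by rewrite subrKA opprB subrKA.
  by apply: (zspan_B CS) => //; apply: zspan_D.
have [rq1|qr|qr] := ltngtP r.+1 q.
(* distant letters commute *)
- have Wq : (wfun W q.+1 < wfun W q)%N.
    by move: Vq; rewrite !VWk adjl adjr !adjD //; lia.
  have [G [rGq GqE sWG qn]] := reduced_descent rW0 Wq.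
  have GE k : wfun G k = wfun W (adj q k) by rewrite -GqE wfun_rcons adjK.
  have GrE : wfun (rcons G r) =1 wfun V.
    by move=> k; rewrite wfun_rcons GE VWk (adj_comm k rq1).
  have rGr : reduced n (rcons G r).
    apply: reduced_eq rV0 _ GrE _; last by rewrite size_rcons sVW sWG.
    by have [] := reduced_rcons rGq; rewrite good_rcons => -> _; rewrite andbT; lia.
  apply: (split3 _ (v * psiw (rcons (rcons G q) r)) _ (v * psiw (rcons (rcons G r) q))).
  + exact: prefix.
  + by apply: prefix => // k; rewrite GrE.
  + by rewrite !psiw_rcons -!mulrA (klr_psi_psi K rq1) subrr; apply: zspan_0.
- have {qr rq} rq : r = q by lia.
  by rewrite rq in VWk *; apply: prefix => // k; rewrite VWk adjK.
(* neighbouring letters satisfy the braid relation *)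
- rewrite -{q}qr in rV VW rq Vq VWk *.
  have [Wr2 W0] : (wfun W r.+2 < wfun W r)%N /\ (wfun W r < wfun W r.+1)%N.
    split=> //; move: Vq; rewrite !VWk adjl adjr adjr [adj r r.+2]adjD //; lia.
  have [|G1 [rG1 G1E sWG1 qn]] := reduced_descent (r := r.+1) rW0; first by lia.
  have G1k k : wfun G1 k = wfun W (adj r.+1 k) by rewrite -G1E wfun_rcons adjK.
  have rG10 := reduced_rcons rG1.
  have [|G [rG GE sG1G rn]] := reduced_descent (r := r) rG10.
    by rewrite !G1k adjl adjD //; lia.
  have Gk k : wfun G k = wfun W (adj r.+1 (adj r k)).
    by rewrite -G1k -GE wfun_rcons adjK.
  have gG : good n G by have [] := reduced_rcons rG.
  have gGr : good n (rcons (rcons G r) r.+1) by rewrite !good_rcons rn qn.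
  have gGq : good n (rcons (rcons G r.+1) r) by rewrite !good_rcons rn qn.
  have GrqE : wfun (rcons (rcons G r) r.+1) =1 wfun W.
    by move=> k; rewrite !wfun_rcons Gk adjK adjK.
  have GqrE : wfun (rcons (rcons G r.+1) r) =1 wfun V.
    by move=> k; rewrite !wfun_rcons Gk VWk -(adj_braid r (adj r k)) adjK.
  apply: (split3 _ (v * psiw (rcons (rcons (rcons G r) r.+1) r)) _
                   (v * psiw (rcons (rcons (rcons G r.+1) r) r.+1))).
  + by apply: prefix => //; apply: reduced_eq rW0 _ _ _; rewrite ?size_rcons ?sWG1 ?sG1G.
  + apply: prefix => //.
    by apply: reduced_eq rV0 _ _ _; rewrite ?size_rcons ?sVW ?sWG1 ?sG1G.
  + rewrite !psiw_rcons !mulrA; apply: M_braid; apply: M_word => //; lia.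
Qed.

Lemma v_descent W r : reduced n W -> (wfun W r.+1 < wfun W r)%N ->
  exists G, [/\ reduced n G, (r.+1 < n)%N, size W = (size G).+1,
    wfun W =1 wfun (rcons G r) & M (size W) (v * psiw W - v * psiw G * psi r)].
Proof.
move=> rW Wr; have [G [rG GE sG rn]] := reduced_descent rW Wr.
exists G; split=> //; first exact: reduced_rcons rG.
by rewrite -mulrA -psiw_rcons; apply: v_matsumoto.
Qed.

(** Before the first letter that decreases the length, the word can be made
    to end in the same letter, and the square of [psi] is at most linear in
    [y]. *)
Lemma v_not_reduced W : good n W -> reduced n W \/ M (size W) (v * psiw W).
Proof.
elim/last_ind: W => [_|W r IH]; first by left; split.
rewrite good_rcons size_rcons => /andP[rn gW].
have [rW|MW] := IH gW; last by right; rewrite psiw_rcons mulrA; apply: M_psi.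
have [Wr|Wr|/wfun_inj] := ltngtP (wfun W r) (wfun W r.+1); last by lia.
  by left; apply: reduced_up.
have [G [rG _ sG _ MG]] := v_descent rW Wr.
right; rewrite psiw_rcons mulrA -[v * psiw W](subrK (v * psiw G * psi r)) mulrDl.
apply: zspan_D; first exact: M_psi.
apply: M_quad; apply: M_word; first by case: rG.
by rewrite sG.
Qed.

Lemma L_lt i j : (i < n)%N -> (j < n)%N -> (nth 0 L i < nth 0 L j)%N = (i < j)%N.
Proof.
move=> iN jN; have [/andP[sL _]] := Lrow.
have mono a b : (a < b)%N -> (b < n)%N -> (nth 0 L a < nth 0 L b)%N.
  move=> ab bn; apply: (sorted_ltn_nth ltn_trans 0%N sL) => //; rewrite inE Lsize //.
  exact: ltn_trans ab bn.
have [ij|ji|->] := ltngtP i j; [exact: mono | | by rewrite ltnn].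
by apply/negbTE; rewrite -leqNgt ltnW // mono.
Qed.

Lemma gen_alg_psiw W : gen_alg Z psi y e (psiw W).
Proof.
rewrite /psiw; elim/big_ind: _ => //; first exact/gen_alg_Z/(cs1 CS).
by move=> a b ga gb; apply: gen_alg_M.
Qed.

(** The missing descents order the values to the left of [r] and to the right
    of [r.+1]. By the two inequalities, the values to the right exceed [wfun W r]
    and those to the left stay below [wfun W r.+1]. So the values below
    [wfun W r] fill the first places, in order. *)
Lemma block_word W r : (wfun W r < wfun W r.+1)%N ->
    (forall j, (j.+1 < r)%N || (r.+1 < j)%N -> (wfun W j < wfun W j.+1)%N) ->
    (wfun W r < wfun W r.+2)%N ->
    (forall r', r = r'.+1 -> (wfun W r' < wfun W r.+1)%N) ->
  [/\ (wfun W r <= r)%N, (forall i, (i < wfun W r)%N -> wfun W i = i)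
    & forall i, (wfun W r <= i)%N -> (i < r)%N -> (wfun W r < wfun W i < wfun W r.+1)%N].
Proof.
move Ep: (wfun W r) => p; move Ep': (wfun W r.+1) => p' pp' up Wr2 Wr1.
have mono_left i j : (i < j)%N -> (j < r)%N -> (wfun W i < wfun W j)%N.
  elim: j => // j IHj; rewrite ltnS leq_eqVlt => /orP[/eqP ->|ij] jr.
    by apply: up; rewrite jr.
  by apply: ltn_trans (IHj ij (ltnW jr)) (up _ _); rewrite jr.
have right_above i : (r.+1 < i)%N -> (p < wfun W i)%N.
  elim: i => // i IHi; rewrite ltnS leq_eqVlt => /orP[/eqP <- //|ri].
  by apply: ltn_trans (IHi ri) (up _ _); rewrite ri orbT.
have fixed i : (i < p)%N -> wfun W i = i /\ (i < r)%N.
  elim/ltn_ind: i => i IHi ip; pose x := wfun (rev W) i.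
  have Wx : wfun W x = i by rewrite /x wfun_revK.
  have ix : (i <= x)%N.
    by rewrite leqNgt; apply/negP=> xi; have [] := IHi x xi (ltn_trans xi ip); lia.
  have xr : (x < r)%N.
    rewrite ltnNge leq_eqVlt; apply/negP=> /orP[/eqP rx|].
      by move: Wx; rewrite -rx; lia.
    rewrite leq_eqVlt => /orP[/eqP rx|/right_above]; last by rewrite Wx; lia.
    by move: Wx; rewrite -rx; lia.
  split; last exact: leq_ltn_trans ix xr.
  move: ix; rewrite leq_eqVlt => /orP[/eqP {1}->|ix] //.
  have := mono_left i x ix xr; rewrite Wx => Wi.
  by have [/wfun_inj] := IHi _ Wi (ltn_trans Wi ip); lia.
split=> [|i /fixed[] //|i pi ir].
  by rewrite leqNgt; apply/negP=> /fixed[]; lia.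
apply/andP; split.
  rewrite ltn_neqAle; apply/andP; split; first by rewrite -Ep; apply/eqP=> /wfun_inj; lia.
  by rewrite leqNgt; apply/negP=> /[dup] Wip /fixed[/wfun_inj]; lia.
case: r ir {Ep Ep' up Wr2 mono_left right_above fixed} (mono_left i r.-1) Wr1.
  by [].
move=> r ir h /(_ r erefl).
by move: ir; rewrite ltnS leq_eqVlt => /orP[/eqP ->//|ir]; apply: ltn_trans; apply: h.
Qed.

(** The Garnir relation. Descents of [W] that interfere with the two strands
    can be pulled through them. Without such descents the first [wfun W r]
    strands stay in place, the strands between them and the two have far
    residues, and the residue sequence of [rcons W r] takes up the residue below
    the node of [wfun W r] before that node. *)
Lemma v_garnir W r : reduced n W -> (r.+1 < n)%N ->
  nth 0%N L (wfun W r.+1) = (nth 0%N L (wfun W r) + l)%N ->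
  M (size W).+1 (v * psiw W * psi r).
Proof.
have [N] := ubnP (size W); elim: N W r => // N IH W r sWN rW rn below.
have [gW mW] := rW; have l0 := rf_l RF.
have pn : (wfun W r < n)%N by rewrite wfun_lt // ltnW.
have p'n : (wfun W r.+1 < n)%N by rewrite wfun_lt.
have pp' : (wfun W r < wfun W r.+1)%N by rewrite -L_lt // below; lia.
have [[j [rj Wj]]|nodesc] := pselect (exists j,
    ((j.+1 < r)%N || (r.+1 < j)%N) /\ (wfun W j.+1 < wfun W j)%N).
  have [G [rG jn sG GE MG]] := v_descent rW Wj.
  have GW k : wfun G k = wfun W (adj j k) by rewrite GE wfun_rcons adjK.
  rewrite -(subrK (v * psiw G * psi j) (v * psiw W)) mulrDl.
  apply: zspan_D; first exact: M_psi.
  have -> : v * psiw G * psi j * psi r = v * psiw G * psi r * psi j.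
    by rewrite -!mulrA; case/orP: rj => rj; rewrite (klr_psi_psi K rj).
  rewrite sG; apply/M_psi/IH => //; first by rewrite -sG.
  by rewrite !GW !adjD //; lia.
(* The strand that starts at [r.+2] ends to the left of both: the braid
   relation pulls it through them. *)
have [Wr2|Wr2] := ltnP (wfun W r.+2) (wfun W r).
  have [|G1 [rG1 r2n sG1 G1E MG1]] := v_descent (r := r.+1) rW; first exact: ltn_trans Wr2 pp'.
  have G1W k : wfun G1 k = wfun W (adj r.+1 k) by rewrite G1E wfun_rcons adjK.
  have [|G [rG _ sG GE MG]] := v_descent (r := r) rG1.
    by rewrite !G1W adjl adjD //; lia.
  have GW k : wfun G k = wfun W (adj r.+1 (adj r k)) by rewrite -G1W GE wfun_rcons adjK.
  rewrite -(subrK (v * psiw G1 * psi r.+1) (v * psiw W)) mulrDl.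
  apply: zspan_D; first exact: M_psi.
  rewrite -(subrK (v * psiw G * psi r) (v * psiw G1)) 2!mulrDl.
  rewrite sG1 in MG1 *; apply: zspan_D; first exact/M_psi/M_psi.
  have MGv : M (size G).+1 (v * psiw G) by apply: M_word => //; case: rG.
  rewrite -(subrK (v * psiw G * psi r.+1 * psi r * psi r.+1) (_ * psi r)).
  rewrite sG; apply: zspan_D; first by apply: M_mono (M_braid r MGv); lia.
  apply/M_psi/M_psi/IH => //; first by lia.
  by rewrite !GW adjr [adj r r.+2]adjD ?[adj r.+1 r]adjD ?adjr //; lia.
have {Wr2} Wr2 : (wfun W r < wfun W r.+2)%N.
  by rewrite ltn_neqAle Wr2 andbT; apply/eqP=> /wfun_inj; lia.
(* Likewise for a strand that starts at [r.-1] and ends to the right of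
   both. *)
have [[r' [rE Wr']]|Wr1] := pselect (exists r', r = r'.+1 /\ (wfun W r.+1 < wfun W r')%N).
  rewrite {r}rE in rn below pn p'n pp' nodesc Wr' Wr2 *.
  have [|G1 [rG1 r1n sG1 G1E MG1]] := v_descent (r := r') rW; first exact: ltn_trans pp' Wr'.
  have G1W k : wfun G1 k = wfun W (adj r' k) by rewrite G1E wfun_rcons adjK.
  have [|G [rG _ sG GE MG]] := v_descent (r := r'.+1) rG1.
    by rewrite !G1W adjr adjD //; lia.
  have GW k : wfun G k = wfun W (adj r' (adj r'.+1 k)) by rewrite -G1W GE wfun_rcons adjK.
  rewrite -(subrK (v * psiw G1 * psi r') (v * psiw W)) mulrDl.
  apply: zspan_D; first exact: M_psi.
  rewrite -(subrK (v * psiw G * psi r'.+1) (v * psiw G1)) 2!mulrDl.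
  rewrite sG1 in MG1 *; apply: zspan_D; first exact/M_psi/M_psi.
  have MGv : M (size G).+1 (v * psiw G) by apply: M_word => //; case: rG.
  rewrite -(subrK (v * psiw G * psi r' * psi r'.+1 * psi r') (_ * psi r'.+1)).
  rewrite sG; apply: zspan_D.
    by rewrite -opprB; apply: (zspan_N CS); apply: M_mono (M_braid r' MGv); lia.
  apply/M_psi/M_psi/IH => //; first by lia.
  by rewrite !GW adjl [adj r'.+1 r']adjD ?[adj r' r'.+2]adjD ?adjl //; lia.
(* No descent interferes: the residue sequence follows [L] up to the node of
   [wfun W r], continues with residues far from it, and then has the residue of
   the node below. *)
have [||r' rE|pr fixed between] := @block_word W r pp'.
- move=> j rj; rewrite ltnNge leq_eqVlt; apply/norP; split.
    by apply/eqP=> /wfun_inj; lia.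
  by apply/negP=> Wj; case: nodesc; exists j.
- exact: Wr2.
- rewrite ltnNge leq_eqVlt; apply/norP; split.
    by apply/eqP=> /wfun_inj; lia.
  by apply/negP=> Wj; case: Wr1; exists r'.
have gWr : good n (rcons W r) by rewrite good_rcons rn.
rewrite -mulrA -psiw_rcons v_psiw //; apply/M_U/UL; first exact: gen_alg_psiw.
pose mid := map (fun k => rk (nth 0%N L (wfun W k))) (iota (wfun W r) (r - wfun W r)).
have [t ->] : exists t, resw (rcons W r) = map rk (take (wfun W r) L) ++ mid ++
    rk (nth 0%N L (wfun W r.+1)) :: t.
  pose f k := nth 0 (map rk L) (wfun (rcons W r) k).
  exists (map f (iota r.+1 (n - r.+1))).
  rewrite /resw /mkseq -/f.
  have -> : iota 0 n = iota 0 (wfun W r) ++ iota (wfun W r) (r - wfun W r)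
                        ++ r :: iota r.+1 (n - r.+1).
    have -> : r :: iota r.+1 (n - r.+1) = iota r (n - r) by rewrite -(subnSK (ltnW rn)).
    rewrite -[in X in _ = _ ++ iota _ _ ++ X](subnKC pr) -iotaD.
    by rewrite -{1}[X in iota X]add0n -iotaD; congr iota; lia.
  rewrite !map_cat /=; congr (_ ++ (_ ++ _ :: _)).
  - rewrite -(@map_nth_iota0 _ 0%N) ?Lsize ?(ltnW pn) // -map_comp.
    apply/eq_in_map => k; rewrite mem_iota add0n => /andP[_ kp].
    by rewrite /f wfun_rcons adjD ?(fixed k kp) ?(nth_map 0%N) ?Lsize //; lia.
  - apply/eq_in_map => k; rewrite mem_iota => kp.
    rewrite /f wfun_rcons adjD ?(nth_map 0%N) ?Lsize ?wfun_lt //; lia.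
  - by rewrite /f wfun_rcons adjl (nth_map 0%N) ?Lsize.
apply: HU; apply: (ideal_move_left K).
  rewrite all_map; apply/allP=> k; rewrite mem_iota /= => kp.
  have kr : (k < r)%N by lia.
  have /andP[k1 k2] : (wfun W r < wfun W k < wfun W r.+1)%N by apply: between => //; lia.
  have kn : (wfun W k < n)%N by rewrite wfun_lt //; lia.
  rewrite -L_lt // in k1; rewrite -L_lt // below in k2.
  by rewrite far_sym; apply: (rf_far RF); rewrite below ?ltn_add2r.
by rewrite below (rf_S RF); apply/ideal_gen/Uskip.
Qed.

(** Keys that agree modulo [l] are nodes of one column, so this is
    standardness of the tableau that [W] makes of the initial one. *)
Definition std_word W := forall i j, (i < j)%N -> (j < n)%N ->
  nth 0%N L (wfun W i) = nth 0%N L (wfun W j) %[mod l] -> (wfun W i < wfun W j)%N.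

(** The first letter that destroys standardness exchanges two entries of one
    column. The tableau before it is standard, so these entries are in
    neighbouring rows, and the Garnir relation applies. *)
Lemma v_not_standard W : reduced n W -> std_word W \/ M (size W) (v * psiw W).
Proof.
elim/last_ind: W => [_|W r IH rWr]; first by left=> i j ij _ _.
have rW := reduced_rcons rWr; have Wr := reduced_lt rWr.
have [gWr _] := rWr; move: gWr; rewrite good_rcons => /andP[rn gW].
rewrite size_rcons psiw_rcons mulrA.
have [sW|MW] := IH rW; last by right; apply: M_psi.
have [same|diff] := eqVneq (nth 0%N L (wfun W r) %% l)%N (nth 0%N L (wfun W r.+1) %% l)%N.
  right; apply: v_garnir => //.
  have r0n : (wfun W r < n)%N by rewrite wfun_lt // ltnW.
  have r1n : (wfun W r.+1 < n)%N by rewrite wfun_lt.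
  set a := nth 0%N L (wfun W r) in same *; set b := nth 0%N L _ in same *.
  have ab : (a < b)%N by rewrite L_lt.
  have al : (a + l <= b)%N.
    rewrite -leq_subRL ?(ltnW ab) //; apply: dvdn_leq; first by rewrite subn_gt0.
    by rewrite -eqn_mod_dvd ?(ltnW ab) // same.
  apply/eqP; rewrite eqn_leq al andbT leqNgt; apply/negP=> bl.
  have bL : (b - l)%N \in L.
    have [/andP[_ /allP/(_ b)]] := Lrow; rewrite mem_nth ?Lsize // => /(_ isT)/orP[|//].
    by lia.
  have sn : (index (b - l)%N L < n)%N by rewrite -Lsize index_mem.
  pose x := wfun (rev W) (index (b - l)%N L).
  have Wx : wfun W x = index (b - l)%N L by rewrite /x wfun_revK.
  have Lx : nth 0%N L (wfun W x) = (b - l)%N by rewrite Wx nth_index.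
  have xn : (x < n)%N by rewrite -(wfun_lt _ gW) Wx.
  have cong : b = (b - l)%N %[mod l] by rewrite -[in LHS](@subnK l b) ?modnDr //; lia.
  have l0 := rf_l RF.
  have [xr|rx|xE] := ltngtP x r.
  - have := sW x r xr (ltnW rn); rewrite Lx -/a same -cong => /(_ erefl).
    by rewrite -L_lt ?Lx -/a ?Wx //; lia.
  - have [rx1|rx1|xE] := ltngtP x r.+1; [by lia | | by move: Lx; rewrite xE -/b; lia].
    have := sW r.+1 x rx1 xn; rewrite Lx -/b -cong => /(_ erefl).
    by rewrite -L_lt ?Lx -/b ?Wx //; lia.
  - by move: Lx; rewrite xE -/a; lia.
left=> i j ij jn; rewrite !wfun_rcons.
have [ijr|ijr] := boolP ((i == r) && (j == r.+1)).
  case/andP: ijr => /eqP-> /eqP->; rewrite adjl adjr => /eqP.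
  by rewrite eq_sym (negbTE diff).
by apply: sW; [move: ijr (adjP r i) (adjP r j); lia | rewrite adj_lt].
Qed.

Variable R : seq nat -> Prop.
Hypothesis R_chosen : forall W, reduced n W -> std_word W ->
  exists W', [/\ R W', reduced n W' & wfun W' =1 wfun W].

(** Up to shorter words, a word is reduced, standard and equal to the one
    chosen for its permutation; the filtration allows an induction. *)
Lemma cell_span a : gen_alg Z psi y e a ->
  zspan Z (fun x => U x \/ exists2 W, R W & x = v * psiw W) (v * a).
Proof.
move=> ga; have v1 : M 1 v.
  by have := @M_word 1 [::] isT isT; rewrite /psiw big_nil mulr1.
have [N] := M_alg ga v1; elim/ltn_ind: N (v * a) => N IH x.
apply: (zspan_mono CS) => {}x [Ux|[W /andP[gW WN] ->]].
  by apply: (zspan_in CS); left.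
have [rW|] := v_not_reduced gW; last exact: IH.
have [sW|] := v_not_standard rW; last exact: IH.
have [W' [RW' rW' W'E]] := R_chosen rW sW.
rewrite -[v * psiw W](subrK (v * psiw W')); apply: zspan_D.
  by apply: IH WN _ _; apply: v_matsumoto.
by apply: (zspan_in CS); right; exists W'.
Qed.

End CellModule.

(** * The spanning theorem *)

Section Opposite.
Variables (I : finNzRingType) (A : pzRingType).
Variables (Z : A -> Prop) (psi y : nat -> A) (e : seq I -> A).
Hypothesis CS : central_scalars Z.

Lemma central_scalars_opp : @central_scalars A^c Z.
Proof.
split; [exact: cs1 CS | exact: csN1 CS | exact: csD CS | | ].
- by move=> z z' Zz Zz'; rewrite mulcE; apply: csM.
- by move=> z x Zz; rewrite !mulcE (csC CS x Zz).
Qed.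

Lemma gen_alg_opp a : gen_alg Z psi y e a -> @gen_alg I A^c Z psi y e a.
Proof.
elim=> {a}; try by constructor.
- by move=> a b _ IHa _ IHb; apply: gen_alg_D.
- by move=> a b _ IHa _ IHb; rewrite -mulcE; apply: gen_alg_M.
Qed.

Lemma gen_alg_of_opp a : @gen_alg I A^c Z psi y e a -> gen_alg Z psi y e a.
Proof.
elim=> {a}; try by constructor.
- by move=> a b _ IHa _ IHb; apply: gen_alg_D.
- by move=> a b _ IHa _ IHb; rewrite mulcE; apply: gen_alg_M.
Qed.

Lemma ideal_of_opp G x : @ideal I A^c Z psi y e G x -> ideal Z psi y e G x.
Proof.
elim=> {x}.
- by move=> x; apply: ideal_gen.
- exact: ideal_0.
- by move=> x x' _ h _ h'; apply: ideal_D.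
- by move=> a x /gen_alg_of_opp ga _ h; rewrite mulcE; apply: ideal_R.
- by move=> a x /gen_alg_of_opp ga _ h; rewrite mulcE; apply: ideal_L.
Qed.

Lemma zspan_of_opp G x : @zspan A^c Z G x -> zspan Z G x.
Proof.
elim=> {x} [|x x' _ h _ h'|z x Zz Gx]; first exact: zspan_0.
- exact: zspan_D.
- by rewrite mulcE -(csC CS) //; apply: zspan_gen.
Qed.

Lemma psiw_opp W : @psiw A^c psi W = psiw psi (rev W).
Proof. exact: rev_prodr. Qed.

Lemma ideal_idem G x : ideal Z psi y e (ideal Z psi y e G) x -> ideal Z psi y e G x.
Proof. elim=> {x}; eauto using ideal. Qed.

End Opposite.

Section Spanning.
Variables (I : finNzRingType) (n l : nat) (rk : nat -> I) (A : pzRingType).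
Variables (Z : A -> Prop) (X psi y : nat -> A) (e : seq I -> A).
Hypothesis RF : residue_fun l rk.
Hypothesis CS : central_scalars Z.
Hypothesis BS : blob_system n l rk Z X psi y e.
Let K := bs_klr BS.

Variable R : seq nat -> seq nat -> Prop.
Hypothesis R_chosen : forall L W, rowlist l L -> size L = n ->
  reduced n W -> std_word n l L W ->
  exists W', [/\ R L W', reduced n W' & wfun W' =1 wfun W].

(** For an anti-involution that fixes the generators, the first factor is the
    image of [psiw psi W]. *)
Definition cellular (x : A) : Prop := exists L W V,
  [/\ rowlist l L /\ size L = n, R L W, R L V
    & x = psiw psi (rev W) * e (map rk L) * psiw psi V].

Local Notation S := (zspan Z cellular).
Local Notation gal := (gen_alg Z psi y e).
Local Notation U L := (ideal Z psi y e (higher l rk e L)).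

Let Sideal (x : A) : Prop := forall a b, gal a -> gal b -> S (a * x * b).

Let gal1 : gal 1. Proof. exact/gen_alg_Z/(cs1 CS). Qed.

Lemma ideal_Sideal G : (forall x, G x -> Sideal x) ->
  forall x, ideal Z psi y e G x -> Sideal x.
Proof.
move=> GS x; elim=> {x} [//||x x' _ h _ h'|c x gc _ h|c x gc _ h] a b ga gb.
- by rewrite mulr0 mul0r; apply: zspan_0.
- by rewrite mulrDr mulrDl; apply: zspan_D; auto.
- by rewrite mulrA; apply: h => //; apply: gen_alg_M.
- by rewrite mulrA -mulrA; apply: h => //; apply: gen_alg_M.
Qed.

(** The right cell module of [L] and the left one, which is a right one in
    the opposite ring, are spanned by the chosen words modulo the ideal of the
    higher idempotents. *)
Lemma Sideal_full L : rowlist l L -> size L = n ->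
  (forall x, higher l rk e L x -> Sideal x) -> Sideal (e (map rk L)).
Proof.
move=> Lrow Ln hS a b ga gb; set v := e _.
have US x : U L x -> S x.
  by move=> /(ideal_Sideal hS)/(_ 1 1 gal1 gal1); rewrite mul1r mulr1.
have split_L k : (k < n)%N -> L = rcons (take k L) (nth 0%N L k) ++ drop k.+1 L.
  by move=> kn; rewrite -take_nth ?Ln // cat_take_drop.
have row_take k : (k < n)%N -> rowlist l (rcons (take k L) (nth 0%N L k)).
  by move=> kn; apply: (@rowlist_cat _ _ _ RF _ (drop k.+1 L)); rewrite -split_L.
have U_take k a' : (k < n)%N -> U (rcons (take k L) (nth 0%N L k)) a' -> U L a'.
  by move=> kn Ua; have := U_cat (drop k.+1 L) Ua; rewrite -split_L.
have Uy k : (k < n)%N -> U L ((y k - X (nth 0%N L k)) * v).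
  move=> kn; have [_ /(_ _ (row_take k kn)) Yk] := straightening RF CS BS (leqnn (size (take k L))).
  have := Yk (map rk (drop k.+1 L)); rewrite -map_cat -split_L // size_takel ?Ln ?(ltnW kn) //.
  exact: U_take.
have Uskip k s : (k < n)%N -> U L (e (map rk (take k L) ++ rk (nth 0%N L k) - 1 :: s)).
  move=> kn; apply: (U_take k _ kn); apply: (skip_node RF) => //; last exact: row_take.
  have [Sk _] := straightening RF CS BS (leqnn (size (take k L))); apply: Sk.
  by have := row_take k kn; rewrite (rowlist_rcons RF) => /andP[].
have right_span := @cell_span I n l rk A Z X psi y e RF CS K (bs_X BS) L (U L)
  Lrow Ln (@ideal_idem _ _ _ _ _ _ _) Uy Uskip (R L) (fun W => @R_chosen L W Lrow Ln).
have left_span := @cell_span I n l rk A^c Z X psi y e RF (central_scalars_opp CS)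
  (klr_opp K) (bs_X BS) L (U L) Lrow Ln.
have {left_span} left_span c : gal c ->
    zspan Z (fun x => U L x \/ exists2 W, R L W & x = psiw psi (rev W) * v) (c * v).
  move=> gc; have := left_span _ _ _ (R L) _ c (gen_alg_opp gc).
  have op1 x : @ideal I A^c Z psi y e (U L) x -> U L x.
    by move=> /ideal_of_opp/ideal_idem.
  have op2 k : (k < n)%N -> U L (v * (y k - X (nth 0%N L k))).
    by move=> kn; rewrite mulrBr -(csC CS v (bs_X BS _)) -(klr_y_e K) -mulrBl; apply: Uy.
  move=> /(_ op1 op2 Uskip (fun W => @R_chosen L W Lrow Ln))/(zspan_of_opp CS).
  apply: (zspan_mono CS) => x [Ux|[W RW ->]]; apply: (zspan_in CS); first by left.
  by right; exists W => //; rewrite mulcE psiw_opp.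
have -> : a * v * b = a * (v * b) by rewrite mulrA.
move: (right_span b gb); apply: (zspan_mull CS) => x [Ux|[V RV ->]].
  by apply/US/ideal_L.
rewrite mulrA; move: (left_span a ga); apply: (zspan_mulr CS) => x' [Ux|[W RW ->]].
  by apply/US/ideal_R => //; apply: gen_alg_psiw.
by apply: (zspan_in CS); exists L, W, V.
Qed.

Lemma higher_rcons P z x : higher l rk e (rcons P z) x -> higher l rk e P x \/
  exists z' s, [/\ (z' < z)%N, rowlist l (rcons P z') & x = e (map rk (rcons P z') ++ s)].
Proof.
move=> [k [z' [s []]]]; rewrite size_rcons ltnS leq_eqVlt => /orP[/eqP ->|kP].
  have -> : take (size P) (rcons P z) = P by rewrite -cats1 take_size_cat.
  by rewrite nth_rcons ltnn eqxx => z'z Pz' ->; right; exists z', s.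
have -> : take k (rcons P z) = take k P by rewrite -cats1 takel_cat // ltnW.
rewrite nth_rcons kP => h1 h2 h3.
by left; exists k, z', s.
Qed.

(** Lexicographic induction, on the number of places left and then on the
    next key. A sequence without a next key is straightened. *)
Lemma Sideal_prefix m P : (size P + m = n)%N -> rowlist l P ->
  (forall x, higher l rk e P x -> Sideal x) -> forall s, Sideal (e (map rk P ++ s)).
Proof.
have S0 : Sideal 0 by move=> a b _ _; rewrite mulr0 mul0r; apply: zspan_0.
elim: m P => [|m IH] P Pm Pr hP s.
  rewrite addn0 in Pm; case: s => [|c s]; first by rewrite cats0; apply: Sideal_full.
  by rewrite (klr_e_size K) // size_cat size_map Pm /=; lia.
have next z : rowlist l (rcons P z) -> forall s, Sideal (e (map rk (rcons P z) ++ s)).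
  elim/ltn_ind: z => z IHz Pz; apply: IH => //; first by rewrite size_rcons addSnnS.
  by move=> x /higher_rcons [/hP //|[z' [s' [z'z Pz' ->]]]]; apply: IHz.
case: s => [|c s].
  by rewrite (klr_e_size K) // cats0 size_map; lia.
have [[z Pz <-]|nz] := pselect (exists2 z, rowlist l (rcons P z) & rk z = c).
  by rewrite -cat_rcons -map_rcons; apply: next.
apply: (ideal_Sideal hP).
have [Sk _] := straightening RF CS BS (leqnn (size P)); apply: Sk => // z Pz.
by apply/eqP=> zc; case: nz; exists z.
Qed.

(** The idempotents sum to 1, and [Sideal_prefix] applies to each of them
    with the empty row list. *)
Theorem gen_alg_span a : gal a -> S a.
Proof.
move=> ga; rewrite -[a]mulr1 -(klr_e_sum K) mulr_sumr; apply: zspan_sum => s _.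
rewrite -[_ * _]mulr1; apply: (@Sideal_prefix n [::]) => //.
by move=> x [k [z [t []]]].
Qed.

End Spanning.

(** * The blob algebra *)

Section Sequences.
Variables (e n : nat).

Definition ffun_of_seq (s : seq 'Z_e) : resseq e n := [ffun k : 'I_n => nth 0 s k].

Lemma ffun_of_seq_inj s t : size s = n -> size t = n ->
  ffun_of_seq s = ffun_of_seq t -> s = t.
Proof.
move=> sn tn st; apply: (@eq_from_nth _ 0) => [|k]; first by rewrite sn.
rewrite sn => kn; have /ffunP/(_ (Ordinal kn)) := st; by rewrite !ffunE.
Qed.

Lemma ffun_of_mkseq (i : resseq e n) : ffun_of_seq [seq i k | k : 'I_n] = i.
Proof.
apply/ffunP=> k; rewrite ffunE (nth_map k) ?size_enum_ord //.
by congr (i _); apply: val_inj; rewrite /= nth_enum_ord.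
Qed.

Lemma sact_ffun_of_seq (r : 'I_n.-1) u a b w :
  r = size u :> nat -> size (u ++ a :: b :: w) = n ->
  sact r (ffun_of_seq (u ++ a :: b :: w)) = ffun_of_seq (u ++ b :: a :: w).
Proof.
move=> ru sn; apply/ffunP=> k; rewrite !ffunE -(swap_seqE sn) /swap_seq.
rewrite nth_mkseq //; congr (nth _ _ _); rewrite -ru.
rewrite /stransp; case: tpermP => [->|->|/eqP klo /eqP khi].
- by rewrite adjl.
- by rewrite adjr.
- by rewrite adjD.
Qed.

End Sequences.

Section BlobInstance.
Variables (F : fieldType) (e l n : nat) (kappa : 'I_l -> 'Z_e).

Local Notation B := (blob F n kappa).

Definition psiB (r : nat) : B :=
  if insub r is Some i then blob_psi F kappa i else 0.
Definition yB (k : nat) : B := if insub k is Some i then blob_y F kappa i else 0.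
Definition eB (s : seq 'Z_e) : B :=
  if size s == n then blob_e F kappa (ffun_of_seq n s) else 0.

Lemma psiB_ord (i : 'I_n.-1) : psiB i = blob_psi F kappa i.
Proof. by rewrite /psiB valK. Qed.
Lemma yB_ord (i : 'I_n) : yB i = blob_y F kappa i.
Proof. by rewrite /yB valK. Qed.
Lemma eB_ffun (i : resseq e n) : eB [seq i k | k : 'I_n] = blob_e F kappa i.
Proof. by rewrite /eB size_map size_enum_ord eqxx ffun_of_mkseq. Qed.

Lemma eB0 s : size s != n -> eB s = 0.
Proof. by rewrite /eB => /negbTE ->. Qed.

Lemma eB_size s : size s = n -> eB s = blob_e F kappa (ffun_of_seq n s).
Proof. by rewrite /eB => ->; rewrite eqxx. Qed.

(** Either the list has the wrong length and every relation is trivial, or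
    its decomposition is a place at which the relations of the presentation
    apply. *)
Variant split_spec (s : seq 'Z_e) (r : nat) (a b : 'Z_e) : Prop :=
| SplitNone of size s != n
| SplitSome (i : 'I_n.-1) of r = i & eB s = blob_e F kappa (ffun_of_seq n s)
   & size s = n
   & ffun_of_seq n s (lo i) = a & ffun_of_seq n s (hi i) = b.

Lemma splitP u a b w : split_spec (u ++ a :: b :: w) (size u) a b.
Proof.
have [sn|sn] := eqVneq (size (u ++ a :: b :: w)) n; last first.
  by constructor 1.
have ru : (size u < n.-1)%N by move: sn; rewrite size_cat /=; lia.
apply: (@SplitSome _ _ _ _ (Ordinal ru)) => //; first by rewrite /eB sn eqxx.
  by rewrite ffunE /= nth_cat ltnn subnn.
by rewrite ffunE /= nth_cat ltnNge leqnSn /= subSnn.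
Qed.

Lemma klr_blob : klr n psiB yB eB.
Proof.
have relE := @blob_relE F e l n kappa.
split.
- move=> s t; rewrite /eB; case: eqP => [sn|_]; last by rewrite mul0r; case: ifP.
  case: (size t =P n) => [tn|tn]; last by rewrite mulr0; case: eqP => // st; rewrite -st in tn.
  case: (s =P t) => [->|st].
    by have := relE _ _ (rel_idem F kappa (ffun_of_seq n t)); rewrite !palg_classE; exact.
  have st' : ffun_of_seq n s != ffun_of_seq n t by apply/eqP=> /(ffun_of_seq_inj sn tn).
  by have := relE _ _ (rel_orth F kappa st'); rewrite !palg_classE; exact.
- have := relE _ _ (rel_sum F n kappa).
  rewrite (big_morph (palg_class _) (palg_classD _) (palg_class0 _)) palg_class1 => <-.
  pose h (i : resseq e n) : n.-tuple 'Z_e := [tuple i k | k < n].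
  pose h' (s : n.-tuple 'Z_e) := ffun_of_seq n s.
  rewrite (reindex h); last first.
    exists h' => [i _|s _]; first exact: ffun_of_mkseq.
    apply: val_inj; apply: (@ffun_of_seq_inj e n); rewrite ?size_tuple //.
    exact: ffun_of_mkseq.
  by apply: eq_bigr => i _; rewrite eB_ffun.
- by move=> s /negbTE sn; rewrite /eB sn.
- by move=> k nk; rewrite /yB insubF // ltnNge nk.
- by move=> r nr; rewrite /psiB insubF //; lia.
- move=> k s; rewrite /eB /yB; case: eqP => _; last by rewrite mul0r mulr0.
  by case: insubP => [i _ _|_]; rewrite ?mul0r ?mulr0 // blob_e_y.
- move=> u a b w.
  have sE : size (u ++ b :: a :: w) = size (u ++ a :: b :: w) by rewrite !size_cat.
  case: (splitP u a b w) => [sn|i ui eE sn _ _].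
    by rewrite !eB0 ?sE // mulr0 mul0r.
  rewrite eE ui psiB_ord eB_size ?sE //.
  by rewrite -(@sact_ffun_of_seq e n i u b a w) ?sE // blob_e_psi.
- move=> k k'; rewrite /yB; case: insubP => [i _ _|_]; last by rewrite mul0r mulr0.
  case: insubP => [j _ _|_]; last by rewrite mul0r mulr0.
  by have := relE _ _ (rel_yy F kappa i j); rewrite !palg_classE.
- move=> r k kr kSr; rewrite /yB /psiB.
  case: insubP => [i _ ir|_]; last by rewrite mul0r mulr0.
  case: insubP => [j _ jk|_]; last by rewrite mul0r mulr0.
  have jlo : j != lo i by rewrite -val_eqE /= jk ir.
  have jhi : j != hi i by rewrite -val_eqE /= jk ir.
  by have := relE _ _ (rel_psiy F kappa jlo jhi); rewrite !palg_classE.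
- move=> r r' rr'; rewrite /psiB.
  case: insubP => [i _ ir|_]; last by rewrite mul0r mulr0.
  case: insubP => [j _ jr'|_]; last by rewrite mul0r mulr0.
  have ij : (i.+1 < j)%N || (j.+1 < i)%N by rewrite ir jr' rr'.
  by have := relE _ _ (rel_psipsi F kappa ij); rewrite !palg_classE.
- move=> u a b w; case: (splitP u a b w) => [sn|i ui eE sn ia ib].
    by rewrite !eB0 // !mulr0.
  rewrite eE ui psiB_ord -[i.+1]/(val (hi i)) yB_ord -[val i]/(val (lo i)) yB_ord blob_psiyS.
  by rewrite /kdelta ia ib; case: eqP => _; rewrite ?scale1r ?scale0r.
- move=> u a b w; case: (splitP u a b w) => [sn|i ui eE sn ia ib].
    by rewrite !eB0 // !mulr0.
  rewrite eE ui psiB_ord -[i.+1]/(val (hi i)) yB_ord -[val i]/(val (lo i)) yB_ord blob_ySpsi.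
  by rewrite /kdelta ia ib; case: eqP => _; rewrite ?scale1r ?scale0r.
- move=> u a b w; case: (splitP u a b w) => [sn|i ui eE sn ia ib].
    by rewrite !eB0 // !mulr0.
  move: (ffun_of_seq n _) eE ia ib => j eE ia ib.
  rewrite eE ui psiB_ord /quad -[i.+1]/(val (hi i)) yB_ord -[val i]/(val (lo i)) yB_ord.
  case: eqP => [ab|/eqP ab].
    rewrite mul0r; have iab : j (lo i) = j (hi i) by rewrite ia ib.
    by have := relE _ _ (rel_quad_eq F kappa iab); rewrite !palg_classE.
  case: eqP => [ba|/eqP ba].
    rewrite -ia -ib in ba.
    by have := relE _ _ (rel_quad_up F kappa ba); rewrite !palg_classE.
  case: eqP => [ba'|/eqP ba'].
    rewrite -ia -ib in ba'.
    by have := relE _ _ (rel_quad_down F kappa ba'); rewrite !palg_classE.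
  rewrite mul1r.
  have h1 : a != b - 1 by apply: contra_neq ba => ->; rewrite subrK.
  have h2 : a != b + 1 by apply: contra_neq ba' => ->; rewrite addrK.
  rewrite -ia -ib in ab h1 h2.
  by have := relE _ _ (rel_quad_far F kappa ab h2 h1); rewrite !palg_classE.
- move=> u a b c w; case: (splitP u a b (c :: w)) => [sn|i ui eE sn ia ib].
    by rewrite !eB0 // !mulr0.
  have jn : (i.+1 < n.-1)%N by move: sn; rewrite size_cat ui /=; lia.
  pose j := Ordinal jn.
  have jc : ffun_of_seq n (u ++ a :: b :: c :: w) (hi j) = c.
    rewrite ffunE /= -ui nth_cat ltnNge !leqW //=.
    by have -> : ((size u).+2 - size u = 2)%N by lia.
  rewrite eE ui psiB_ord -[i.+1]/(val j) psiB_ord.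
  have ji : j = i.+1 :> nat by [].
  have := relE _ _ (rel_braid F kappa (ffun_of_seq n (u ++ a :: b :: c :: w)) ji).
  rewrite !palg_classE -!/(blob_psi _ _ _) -!/(blob_e _ _ _) => ->.
  rewrite ia ib jc /braid_coeff /braid_sign; congr ((_ + _) * _).
  case: ifP => _; first by rewrite scaleN1r.
  by case: ifP => _; rewrite ?scale1r ?scale0r.
Qed.

Definition scalarB (x : B) : Prop := exists a : F, x = a *: (1 : B).

Lemma central_scalarB : central_scalars scalarB.
Proof.
split.
- by exists 1; rewrite scale1r.
- by exists (-1); rewrite scaleN1r.
- by move=> _ _ [a ->] [b ->]; exists (a + b); rewrite scalerDl.
- by move=> _ _ [a ->] [b ->]; exists (a * b); rewrite -palg_scalerAl mul1r scalerA.
- by move=> _ x [a ->]; rewrite blob_scalar_comm.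
Qed.

Lemma gen_alg_blob (x : B) : gen_alg scalarB psiB yB eB x.
Proof.
elim/palg_ind: x; elim=> [[r|k|i]|||t ht u hu|t ht u hu|a t ht].
- by rewrite -[palg_class _ _]/(blob_psi F kappa r) -psiB_ord; apply: gen_alg_psi.
- by rewrite -[palg_class _ _]/(blob_y F kappa k) -yB_ord; apply: gen_alg_y.
- by rewrite -[palg_class _ _]/(blob_e F kappa i) -eB_ffun; apply: gen_alg_e.
- by apply: gen_alg_Z; exists 0; rewrite scale0r.
- by apply: gen_alg_Z; exists 1; rewrite scale1r.
- by rewrite palg_classD; apply: gen_alg_D.
- by rewrite palg_classM; apply: gen_alg_M.
- rewrite palg_classZ -[palg_class _ _]mul1r palg_scalerAl; apply: gen_alg_M => //.
  by apply: gen_alg_Z; exists a.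
Qed.

Variable rk : nat -> 'Z_e.
Hypothesis rk_kappa : forall x (xl : (x < l)%N), rk x = kappa (Ordinal xl).

Lemma is_kappaP a : reflect (exists2 x, (x < l)%N & rk x = a) (is_kappa kappa a).
Proof.
apply: (iffP existsP) => [[m /eqP ->]|[x xl <-]].
  by exists m => //; rewrite (rk_kappa (ltn_ord m)); congr kappa; apply: val_inj.
by exists (Ordinal xl); rewrite rk_kappa.
Qed.

Lemma blob_system_blob : blob_system n l rk scalarB (fun=> 0) psiB yB eB.
Proof.
have relE := @blob_relE F e l n kappa.
split=> //; first exact: klr_blob.
- by move=> x; exists 0; rewrite scale0r.
- move=> a w ha; have [sn|sn] := eqVneq (size (a :: w)) n; last exact: eB0.
  have n0 : (0 < n)%N by rewrite -sn.
  rewrite eB_size //; apply: (relE _ _ (rel_cyclo F (p1 := Ordinal n0) _ _)) => //.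
  by rewrite ffunE /=; apply/is_kappaP=> -[x xl xa]; have := ha x xl; rewrite xa eqxx.
- move=> x w xl; have [sn|sn] := eqVneq (size (rk x :: rk x + 1 :: w)) n; last exact: eB0.
  have n0 : (0 < n)%N by rewrite -sn. have n1 : (1 < n)%N by rewrite -sn.
  rewrite eB_size //.
  apply: (relE _ _ (rel_blob F (p1 := Ordinal n0) (p2 := Ordinal n1) _ _ _ _)) => //.
    by rewrite ffunE /=; apply/is_kappaP; exists x.
  by rewrite !ffunE.
- move=> x w xl; have [sn|sn] := eqVneq (size (rk x :: w)) n; last by rewrite eB0 // !mulr0.
  have n0 : (0 < n)%N by rewrite -sn.
  rewrite eB_size // -[0%N]/(val (Ordinal n0)) yB_ord mul0r.
  have h : is_kappa kappa (ffun_of_seq n (rk x :: w) (Ordinal n0)).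
    by rewrite ffunE /=; apply/is_kappaP; exists x.
  by have := relE _ _ (rel_y1 F (p1 := Ordinal n0) erefl h); rewrite !palg_classE.
Qed.

End BlobInstance.

(** * A seminormal representation of the deformed algebra *)

Section Seminormal.
Variables (K : fieldType) (I : finNzRingType) (n l : nat).
Variables (kap : 'I_l -> I) (x : 'I_l -> K).
Hypothesis two_neq0 : 1 + 1 != 0 :> I.
Hypothesis x_inj : injective x.

Local Notation word := (seq 'I_l).
Local Notation N := #|{: n.-tuple 'I_l}|.

Lemma add2_neq (a : I) : (a == a + 1 + 1) = false.
Proof.
by rewrite -addrA -[X in X == _]addr0 (inj_eq (addrI a)) eq_sym (negbTE two_neq0).
Qed.

(** A word lists the columns of the entries of a tableau. The entry that
    follows [u], when it is put in column [a], is below the [count_mem a u]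
    entries already there. *)
Definition letter_res (u : word) (a : 'I_l) : I := kap a - (count_mem a u)%:R.

Fixpoint tail_res (u w : word) : seq I :=
  if w is a :: w' then letter_res u a :: tail_res (rcons u a) w' else [::].
Definition word_res (w : word) : seq I := tail_res [::] w.

Lemma letter_res_rcons u a b :
  letter_res (rcons u a) b = if a == b then letter_res u b - 1 else letter_res u b.
Proof.
rewrite /letter_res -cats1 count_cat /= addn0 natrD opprD addrA.
by case: eqP => _; rewrite ?subr0.
Qed.

Lemma letter_res_perm u u' : perm_eq u u' -> letter_res u =1 letter_res u'.
Proof. by move=> /seq.permP uu' a; rewrite /letter_res uu'. Qed.

Lemma tail_res_perm u u' w : perm_eq u u' -> tail_res u w = tail_res u' w.
Proof.
elim: w u u' => //= a w IH u u' uu'; congr (_ :: _); first exact: letter_res_perm.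
by apply: IH; rewrite -!cats1 perm_cat2r.
Qed.

Lemma tail_res_cat u w w' : tail_res u (w ++ w') = tail_res u w ++ tail_res (u ++ w) w'.
Proof.
elim: w u => [|a w IH] u /=; first by rewrite cats0.
by rewrite IH cat_rcons.
Qed.

Lemma size_tail_res u w : size (tail_res u w) = size w.
Proof. by elim: w u => //= a w IH u; rewrite IH. Qed.

Lemma size_word_res w : size (word_res w) = size w. Proof. exact: size_tail_res. Qed.

Lemma perm_swap2 (u : word) a b : perm_eq (rcons (rcons u a) b) (rcons (rcons u b) a).
Proof. by apply/seq.permP=> P; rewrite -!cats1 !count_cat /=; lia. Qed.

Lemma word_res_cat2 u a b v : word_res (u ++ a :: b :: v) =
  word_res u ++ letter_res u a :: (if a == b then letter_res u b - 1 else letter_res u b)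
    :: tail_res (rcons (rcons u a) b) v.
Proof. by rewrite /word_res tail_res_cat /= letter_res_rcons. Qed.

(** Words of the wrong length are sent to 0, so that the identities below
    need no condition on the length. *)
Definition cv (w : word) : 'cV[K]_N :=
  if insub w is Some t then delta_mx (enum_rank (t : n.-tuple 'I_l)) 0 else 0.

Definition mx_of (f : word -> 'cV[K]_N) : 'M[K]_N :=
  \matrix_(i, j) f (enum_val j : n.-tuple 'I_l) i 0.

Lemma cv_tuple (t : n.-tuple 'I_l) : cv t = delta_mx (enum_rank t) 0.
Proof. by rewrite /cv valK. Qed.

Lemma cv_size w : size w != n -> cv w = 0.
Proof. by move=> wn; rewrite /cv insubF //; apply/negbTE. Qed.

Lemma mx_of_cv f w : size w = n -> mx_of f *m cv w = f w.
Proof.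
move=> wn; have [t <-] : exists t : n.-tuple 'I_l, val t = w.
  by exists (Tuple (introT eqP wn)).
rewrite cv_tuple -colE; apply/colP=> i; rewrite !mxE enum_rankK //.
Qed.

Lemma cv_ext (M M' : 'M[K]_N) :
  (forall w, size w = n -> M *m cv w = M' *m cv w) -> M = M'.
Proof.
move=> MM'; apply/matrixP=> i j; have := MM' _ (size_tuple (enum_val j)).
by rewrite cv_tuple enum_valK -!colE => /colP/(_ i); rewrite !mxE.
Qed.

(** The coefficients of [psi] on the plane spanned by a word and its swap.
    For equal residues, [psi] is a divided difference. For other residues, the
    product of the two off-diagonal coefficients must be the value of the square
    of [psi]; when this is a difference of parameters, one coefficient takes it
    all and the other is 1. *)
Definition pcoef (al be : I) a b : K := if al == be then (x a - x b)^-1 else 0.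
Definition scoef (al be : I) a b : K :=
  if al == be then (x a - x b)^-1 else if be == al + 1 then x b - x a else 1.

Definition yM (k : nat) : 'M[K]_N :=
  mx_of (fun w => if drop k w is a :: _ then x a *: cv w else 0).
Definition eM (s : seq I) : 'M[K]_N :=
  mx_of (fun w => if word_res w == s then cv w else 0).
(** Two equal letters stand for a node and the node below it, whose entries
    cannot be exchanged in a standard tableau. *)
Definition psiM (r : nat) : 'M[K]_N :=
  mx_of (fun w => if drop r w is a :: b :: v then
    if a == b then 0 else let u := take r w in
      pcoef (letter_res u a) (letter_res u b) a b *: cv w
      + scoef (letter_res u a) (letter_res u b) a b *: cv (u ++ b :: a :: v)
    else 0).

Lemma yM_cv u a v : yM (size u) *m cv (u ++ a :: v) = x a *: cv (u ++ a :: v).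
Proof.
have [sn|sn] := eqVneq (size (u ++ a :: v)) n; last by rewrite cv_size // mulmx0 scaler0.
by rewrite mx_of_cv // drop_size_cat.
Qed.

Lemma yMS_cv u a b v : yM (size u).+1 *m cv (u ++ a :: b :: v) = x b *: cv (u ++ a :: b :: v).
Proof. by rewrite -cat_rcons -(size_rcons u a) yM_cv. Qed.

Lemma eM_cv s w : eM s *m cv w = if word_res w == s then cv w else 0.
Proof.
have [sn|sn] := eqVneq (size w) n; last by rewrite cv_size // mulmx0 if_same.
by rewrite mx_of_cv.
Qed.

Lemma psiM_cv_same u a v : psiM (size u) *m cv (u ++ a :: a :: v) = 0.
Proof.
have [sn|sn] := eqVneq (size (u ++ a :: a :: v)) n; last by rewrite cv_size // mulmx0.
by rewrite mx_of_cv // drop_size_cat // eqxx.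
Qed.

Lemma psiM_cv u a b v : a != b -> psiM (size u) *m cv (u ++ a :: b :: v) =
  pcoef (letter_res u a) (letter_res u b) a b *: cv (u ++ a :: b :: v)
  + scoef (letter_res u a) (letter_res u b) a b *: cv (u ++ b :: a :: v).
Proof.
move=> ab; have [sn|sn] := eqVneq (size (u ++ a :: b :: v)) n; last first.
  by rewrite !cv_size ?mulmx0 ?scaler0 ?addr0 //; move: sn; rewrite !size_cat.
by rewrite mx_of_cv // drop_size_cat // (negbTE ab) take_size_cat.
Qed.

Lemma psiMS_cv_same u c a v : psiM (size u).+1 *m cv (u ++ c :: a :: a :: v) = 0.
Proof. by rewrite -cat_rcons -(size_rcons u c) psiM_cv_same. Qed.

Lemma psiMS_cv u c a b v : a != b -> psiM (size u).+1 *m cv (u ++ c :: a :: b :: v) =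
  pcoef (letter_res (rcons u c) a) (letter_res (rcons u c) b) a b *: cv (u ++ c :: a :: b :: v)
  + scoef (letter_res (rcons u c) a) (letter_res (rcons u c) b) a b *: cv (u ++ c :: b :: a :: v).
Proof. by move=> ab; rewrite -2!(cat_rcons c u) -(size_rcons u c) psiM_cv. Qed.

Lemma eM_ext (M M' : 'M[K]_N) s :
  (forall w, size w = n -> word_res w = s -> M *m cv w = M' *m cv w) -> M *m eM s = M' *m eM s.
Proof.
move=> MM'; apply: cv_ext => w wn; rewrite -!mulmxA eM_cv.
by case: eqP => [ws|_]; [apply: MM' | rewrite !mulmx0].
Qed.

Lemma word_res_split w su al be sw : word_res w = su ++ al :: be :: sw ->
  exists u a b v, [/\ w = u ++ a :: b :: v, size u = size su, al = letter_res u a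
    & be = if a == b then letter_res u b - 1 else letter_res u b].
Proof.
move=> ws; have sw' : ((size su).+1 < size w)%N.
  by rewrite -size_word_res ws size_cat /=; lia.
have [u [a [b [v [wE su']]]]] := split_at sw'; exists u, a, b, v; split=> //.
  have /eqP := ws; rewrite wE word_res_cat2 eqseq_cat ?size_word_res //.
  by rewrite !eqseq_cons => /and4P[_ /eqP-> _ _].
have /eqP := ws; rewrite wE word_res_cat2 eqseq_cat ?size_word_res //.
by rewrite !eqseq_cons => /and4P[_ _ /eqP-> _].
Qed.

Lemma word_res_swap u a b v su al be sw : a != b -> size u = size su ->
  (word_res (u ++ a :: b :: v) == su ++ al :: be :: sw) =
  (word_res (u ++ b :: a :: v) == su ++ be :: al :: sw).
Proof.
move=> ab us; rewrite !word_res_cat2 !eqseq_cat ?size_word_res // !eqseq_cons.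
have /negbTE ba : b != a by rewrite eq_sym.
rewrite (negbTE ab) ba.
by rewrite (tail_res_perm v (perm_swap2 u a b)); congr (_ && _); rewrite andbCA.
Qed.

Ltac mx_simp :=
  rewrite ?(mulmxDr, mulmxDl, mulmxBl, mulmxBr, mulNmx, mul1mx, mulmx0, mul0mx) -?scalemxAr.

Lemma psiM_e u a b w :
  psiM (size u) *m eM (u ++ a :: b :: w) = eM (u ++ b :: a :: w) *m psiM (size u).
Proof.
apply: cv_ext => t tn; rewrite -!mulmxA eM_cv.
have [rt|rt] := ltnP (size u).+1 (size t); last first.
  have -> : (word_res t == u ++ a :: b :: w) = false.
    by apply/eqP=> /(congr1 size); rewrite size_word_res size_cat /=; lia.
  rewrite mx_of_cv // mulmx0; case E: (drop _ _) => [|c [|d v]]; rewrite ?mulmx0 //.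
  by have := size_drop (size u) t; rewrite E /=; lia.
have [u' [c [d [v [tE u'E]]]]] := split_at rt.
rewrite tE -u'E; have [<-|cd] := eqVneq c d.
  by rewrite psiM_cv_same mulmx0; case: ifP; rewrite ?mulmx0 ?psiM_cv_same.
rewrite (psiM_cv _ _ cd); mx_simp; rewrite !eM_cv -(word_res_swap _ _ _ _ cd u'E).
have [ts|ts] := boolP (word_res _ == _).
  rewrite (psiM_cv _ _ cd) /pcoef; congr (_ + _).
  case: eqP => [cdE|_]; last by rewrite !scale0r.
  move: ts; rewrite !word_res_cat2 !eqseq_cat ?size_word_res // !eqseq_cons (negbTE cd) -cdE.
  by move=> /and4P[/eqP-> /eqP-> /eqP-> /eqP->]; rewrite !eqxx.
rewrite mulmx0 scaler0 addr0 /pcoef; case: eqP => [cdE|_]; last by rewrite scale0r.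
case: ifP; last by rewrite scaler0.
move: ts; rewrite !word_res_cat2 !eqseq_cat ?size_word_res // !eqseq_cons (negbTE cd) -cdE.
by move=> /negP tsN /and4P[h1 h2 h3 h4]; case: tsN; rewrite h1 h2 h3 h4.
Qed.

Lemma xsub_neq0 a b : a != b -> x a - x b != 0.
Proof. by move=> ab; rewrite subr_eq0 (inj_eq x_inj). Qed.

Lemma quadM u a b w : psiM (size u) *m psiM (size u) *m eM (u ++ a :: b :: w) =
   @quad I 'M[K]_N yM (size u) a b *m eM (u ++ a :: b :: w).
Proof.
apply: eM_ext => t tn /word_res_split[u' [c [d [v [-> <- -> ->]]]]].
rewrite -mulmxA; have [<-|cd] := eqVneq c d.
  by rewrite psiM_cv_same mulmx0 quad_pred // mulmxBl yM_cv yMS_cv subrr.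
have dc : d != c by rewrite eq_sym.
rewrite (psiM_cv _ _ cd); mx_simp; rewrite (psiM_cv _ _ cd) (psiM_cv _ _ dc).
have h1 := xsub_neq0 cd; have h2 := xsub_neq0 dc.
rewrite /quad /pcoef /scoef [letter_res u' d == letter_res u' c]eq_sym.
have [cdE|cdN] := eqVneq (letter_res u' c) (letter_res u' d).
  rewrite [RHS]mul0mx; apply/colP=> i; rewrite !mxE; field.
  by rewrite h1 h2.
have [E1|E1] := eqVneq (letter_res u' d) (letter_res u' c + 1).
  have -> : (letter_res u' c == letter_res u' d + 1) = false.
    by rewrite E1 add2_neq.
  rewrite mulmxBl yM_cv yMS_cv; apply/colP=> i; rewrite !mxE; ring.
have [E2|E2] := eqVneq (letter_res u' c) (letter_res u' d + 1).
  rewrite E2 addrK eqxx mulmxBl yM_cv yMS_cv; apply/colP=> i; rewrite !mxE; ring.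
have -> : (letter_res u' d == letter_res u' c - 1) = false.
  by apply/eqP=> h; move: E2; rewrite h subrK eqxx.
by rewrite [RHS]mul1mx; apply/colP=> i; rewrite !mxE; ring.
Qed.

Lemma psiM_yM u a b w :
  (psiM (size u) *m yM (size u).+1 *m eM (u ++ a :: b :: w) =
    yM (size u) *m psiM (size u) *m eM (u ++ a :: b :: w)
    - (a == b)%:R *: eM (u ++ a :: b :: w)) /\
  (yM (size u).+1 *m psiM (size u) *m eM (u ++ a :: b :: w) =
    psiM (size u) *m yM (size u) *m eM (u ++ a :: b :: w)
    - (a == b)%:R *: eM (u ++ a :: b :: w)).
Proof.
split; rewrite -[X in _ - (_ *: X)]mul1mx scalemxAl -mulmxBl;
  apply: eM_ext => t tn /word_res_split[u' [c [d [v [-> <- -> ->]]]]];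
  rewrite mulmxBl -!mulmxA -scalemxAl mul1mx.
  rewrite yMS_cv; have [<-|cd] := eqVneq c d.
    rewrite -scalemxAr psiM_cv_same mulmx0 scaler0.
    by rewrite (negbTE (pred_neq _)) scale0r subr0.
  rewrite -scalemxAr (psiM_cv _ _ cd) /pcoef /scoef; mx_simp; rewrite !yM_cv.
  have h1 := xsub_neq0 cd; case: eqP => _; apply/colP=> i; rewrite !mxE /=; [field|ring].
  by rewrite h1.
rewrite yM_cv; have [<-|cd] := eqVneq c d.
  rewrite -scalemxAr psiM_cv_same mulmx0 scaler0.
  by rewrite (negbTE (pred_neq _)) scale0r subr0.
rewrite -scalemxAr (psiM_cv _ _ cd) /pcoef /scoef; mx_simp; rewrite !yMS_cv.
have h1 := xsub_neq0 cd; case: eqP => _; apply/colP=> i; rewrite !mxE /=; [field|ring].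
by rewrite h1.
Qed.

Lemma word_at (w : word) k : (k < size w)%N -> exists u a v, w = u ++ a :: v /\ size u = k.
Proof.
move=> kw; have := cat_take_drop k w; have := size_drop k w.
case: (drop k w) => [|a v] /=; first by lia.
by move=> _ <-; exists (take k w), a, v; rewrite size_takel ?(ltnW kw).
Qed.

Lemma yM_nth k w (a0 : 'I_l) : (k < size w)%N -> yM k *m cv w = x (nth a0 w k) *: cv w.
Proof.
move=> /word_at[u [a [v [-> <-]]]]; rewrite yM_cv.
by rewrite nth_cat ltnn subnn.
Qed.

Lemma yM_oob k w : (size w <= k)%N -> yM k *m cv w = 0.
Proof.
move=> wk; have [wn|wn] := eqVneq (size w) n; last by rewrite cv_size // mulmx0.
by rewrite mx_of_cv // drop_oversize.
Qed.

Lemma psiM_oob r w : (size w <= r.+1)%N -> psiM r *m cv w = 0.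
Proof.
move=> wr; have [wn|wn] := eqVneq (size w) n; last by rewrite cv_size // mulmx0.
rewrite mx_of_cv //; have := size_drop r w.
by case: (drop r w) => [|a [|b v]] //=; lia.
Qed.

Lemma yM_comm k k' : yM k *m yM k' = yM k' *m yM k.
Proof.
apply: cv_ext => w wn; rewrite -!mulmxA.
have [kw|wk] := ltnP k (size w); last first.
  have [k'w|wk'] := ltnP k' (size w); last by rewrite !yM_oob // !mulmx0.
  have [u [a [v [wE <-]]]] := word_at k'w.
  by rewrite wE yM_cv -wE -scalemxAr yM_oob // scaler0 mulmx0.
have [u [a [v [wE <-]]]] := word_at kw.
rewrite wE yM_cv -wE -scalemxAr; have [k'w|wk'] := ltnP k' (size w); last first.
  by rewrite yM_oob // scaler0 mulmx0.
have [u' [a' [v' [wE' <-]]]] := word_at k'w.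
by rewrite wE' yM_cv -wE' -scalemxAr wE yM_cv scalerA mulrC -scalerA.
Qed.

Lemma yM_e k s : yM k *m eM s = eM s *m yM k.
Proof.
apply: cv_ext => w wn; rewrite -!mulmxA eM_cv.
have [kw|wk] := ltnP k (size w); last first.
  by rewrite yM_oob // mulmx0; case: eqP; rewrite ?mulmx0 ?yM_oob.
have [u [a [v [-> <-]]]] := word_at kw.
rewrite yM_cv -scalemxAr eM_cv; case: eqP => _; last by rewrite mulmx0 scaler0.
by rewrite yM_cv.
Qed.

Lemma psiM_y r k : k != r -> k != r.+1 -> psiM r *m yM k = yM k *m psiM r.
Proof.
move=> kr kSr; apply: cv_ext => w wn; rewrite -!mulmxA.
have [rw|wr] := ltnP r.+1 (size w); last first.
  rewrite psiM_oob // mulmx0; have [kw|wk] := ltnP k (size w); last by rewrite yM_oob // mulmx0.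
  have [u [a [v [wE <-]]]] := word_at kw.
  by rewrite wE yM_cv -wE -scalemxAr psiM_oob // scaler0.
have [u [a [b [v [wE uE]]]]] := split_at rw.
have [kw|wk] := ltnP k (size w); last first.
  rewrite yM_oob // mulmx0 wE -uE; have [<-|ab] := eqVneq a b.
    by rewrite psiM_cv_same mulmx0.
  rewrite (psiM_cv _ _ ab) mulmxDr -!scalemxAr !yM_oob ?scaler0 ?addr0 //.
    by move: wk; rewrite wE !size_cat.
  by rewrite -wE.
rewrite (@yM_nth k w a) // -scalemxAr wE -uE; have [<-|ab] := eqVneq a b.
  by rewrite psiM_cv_same mulmx0 scaler0.
rewrite (psiM_cv _ _ ab) mulmxDr -!scalemxAr !(@yM_nth k _ a) -?wE //; last first.
  by move: kw; rewrite wE !size_cat.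
have -> : nth a (u ++ b :: a :: v) k = nth a w k.
  rewrite wE !nth_cat; case: ltnP => // uk.
  rewrite uE; move: uk kr kSr; rewrite uE => rk /eqP kr /eqP kSr.
  by have -> : (k - r = (k - r.+2).+2)%N by lia.
by rewrite scalerDr !scalerA; congr (_ *: _ + _ *: _); rewrite mulrC.
Qed.

Lemma psiM_psi r r' : (r.+1 < r')%N -> psiM r *m psiM r' = psiM r' *m psiM r.
Proof.
move=> rr'; apply: cv_ext => w wn; rewrite -!mulmxA.
have [rw|wr] := ltnP r.+1 (size w); last first.
  by rewrite !psiM_oob ?mulmx0 //; lia.
have [u [a [b [v0 [wE uE]]]]] := split_at rw.
have [r'w|wr'] := ltnP r'.+1 (size w); last first.
  rewrite (@psiM_oob r') // mulmx0 wE -uE; have [<-|ab] := eqVneq a b.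
    by rewrite psiM_cv_same mulmx0.
  rewrite (psiM_cv _ _ ab) mulmxDr -!scalemxAr !psiM_oob ?scaler0 ?addr0 //.
    by move: wr'; rewrite wE !size_cat.
  by rewrite -wE.
have [|m [c [d [v [v0E mE]]]]] := @split_at _ v0 (r' - r.+2).
  by move: r'w; rewrite wE size_cat /=; lia.
have r'E a' b' : r' = size (u ++ a' :: b' :: m) by rewrite size_cat /= mE; lia.
have assoc a' b' t : u ++ a' :: b' :: m ++ t = (u ++ a' :: b' :: m) ++ t by rewrite -catA.
have ru : letter_res (u ++ b :: a :: m) =1 letter_res (u ++ a :: b :: m).
  by apply: letter_res_perm; apply/seq.permP=> P; rewrite !count_cat /=; lia.
rewrite wE v0E -uE.
have [<-|ab] := eqVneq a b.
  rewrite psiM_cv_same mulmx0 assoc (r'E a a); have [<-|cd] := eqVneq c d.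
    by rewrite psiM_cv_same mulmx0.
  by rewrite (psiM_cv _ _ cd) mulmxDr -!scalemxAr -!assoc !psiM_cv_same !scaler0 addr0.
rewrite (psiM_cv _ _ ab) {1}assoc mulmxDr -!scalemxAr !assoc.
rewrite {1 2}(r'E a b) (r'E b a).
have [<-|cd] := eqVneq c d.
  by rewrite !psiM_cv_same mulmx0 !scaler0 addr0.
rewrite !(psiM_cv _ _ cd) !ru mulmxDr -!scalemxAr -!assoc !(psiM_cv _ _ ab).
by apply/colP=> i; rewrite !mxE; ring.
Qed.

Lemma braid_sign_cv (al be ga : I) (t : 'cV[K]_N) :
  braid_sign 'M[K]_N al be ga *m t = braid_sign K al be ga *: t.
Proof.
rewrite /braid_sign; case: ifP => _; first by rewrite mulNmx [1 *m _]mul1mx scaleN1r.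
by case: ifP => _; rewrite ?[1 *m _]mul1mx ?scale1r // [LHS]mul0mx scale0r.
Qed.

Lemma word_res_split3 w (su : seq I) al be ga sw : word_res w = su ++ al :: be :: ga :: sw ->
  exists u a b c v, [/\ w = u ++ a :: b :: c :: v, size u = size su, al = letter_res u a,
    be = letter_res (rcons u a) b & ga = letter_res (rcons (rcons u a) b) c].
Proof.
move=> ws; have [u [a [b [v [wE us alE beE]]]]] := word_res_split ws.
case: v wE => [|c v] wE.
  by have := congr1 size ws; rewrite size_word_res wE !size_cat /= us; lia.
exists u, a, b, c, v; split=> //; first by rewrite letter_res_rcons.
have /eqP := ws; rewrite wE word_res_cat2 eqseq_cat ?size_word_res //=.
by rewrite !eqseq_cons => /and5P[_ _ _ /eqP-> _].
Qed.

Lemma far_pred (a : I) : (a - 1 == a + 1) = false.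
Proof. by rewrite (can2_eq (subrK 1) (addrK 1)) add2_neq. Qed.

Lemma sub2_neq (a : I) : (a == a - 1 - 1) = false.
Proof. by have := add2_neq (a - 1 - 1); rewrite !subrK eq_sym. Qed.

Lemma succ_neq (a : I) : (a == a + 1) = false.
Proof. by rewrite -[X in X == _]addr0 (inj_eq (addrI a)) eq_sym oner_eq0. Qed.

(** Two equal letters and a third one span three words. The table of both
    operators on them reduces the braid relation to arithmetic in [K]. *)
Lemma braidM_aab u a b v : a != b ->
  let s := letter_res u a in let t := letter_res u b in
  let w1 := u ++ a :: a :: b :: v in let w2 := u ++ a :: b :: a :: v in
  let w3 := u ++ b :: a :: a :: v in

  [/\ psiM (size u) *m cv w1 = 0,
    psiM (size u) *m cv w2 = pcoef s t a b *: cv w2 + scoef s t a b *: cv w3,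
    psiM (size u) *m cv w3 = pcoef t s b a *: cv w3 + scoef t s b a *: cv w2 &
   [/\ psiM (size u).+1 *m cv w1 = pcoef (s - 1) t a b *: cv w1 + scoef (s - 1) t a b *: cv w2,
    psiM (size u).+1 *m cv w2 = pcoef t (s - 1) b a *: cv w2 + scoef t (s - 1) b a *: cv w1 &
    psiM (size u).+1 *m cv w3 = 0]].
Proof.
move=> ab s t w1 w2 w3; have ba : b != a by rewrite eq_sym.
rewrite /w1 /w2 /w3 psiM_cv_same psiMS_cv_same !psiM_cv // !psiMS_cv //.
by rewrite !letter_res_rcons eqxx (negbTE ab).
Qed.

(** Three distinct letters span six words. For each pattern of equal and
    adjacent residues the relation is an identity of rational functions in the
    three parameters. *)
Lemma braidM_abc u a b c v : a != b -> b != c -> a != c ->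
  psiM (size u) *m (psiM (size u).+1 *m (psiM (size u) *m cv (u ++ a :: b :: c :: v)))
  = psiM (size u).+1 *m (psiM (size u) *m (psiM (size u).+1 *m cv (u ++ a :: b :: c :: v)))
    + braid_sign K (letter_res u a) (letter_res u b) (letter_res u c) *: cv (u ++ a :: b :: c :: v).
Proof.
move=> ab bc ac; have [ba cb ca] : [/\ b != a, c != b & c != a] by split; rewrite eq_sym.
do 5![rewrite ?psiM_cv // ?psiMS_cv //; mx_simp].
rewrite !letter_res_rcons !(negbTE ab, negbTE bc, negbTE ac, negbTE ba, negbTE cb, negbTE ca).
have h1 := xsub_neq0 ab; have h2 := xsub_neq0 bc; have h3 := xsub_neq0 ac.
have h4 := xsub_neq0 ba; have h5 := xsub_neq0 cb; have h6 := xsub_neq0 ca.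
have hs := (h1, h2, h3, h4, h5, h6).
move: (letter_res u a) (letter_res u b) (letter_res u c) => al be ga.
apply/colP=> i; rewrite !mxE /pcoef /scoef /braid_sign.
move: (cv (u ++ a :: b :: c :: v) i 0) (cv (u ++ a :: c :: b :: v) i 0).
move: (cv (u ++ b :: a :: c :: v) i 0) (cv (u ++ b :: c :: a :: v) i 0).
move: (cv (u ++ c :: a :: b :: v) i 0) (cv (u ++ c :: b :: a :: v) i 0).
move=> V1 V2 V3 V4 V5 V6.
have [<-|abE] := eqVneq al be.
  have [acE|acE] := eqVneq al ga; last by rewrite /=; field; rewrite !hs.
  rewrite (negbTE (pred_neq _)) succ_neq /=; field.
  by rewrite !hs.
have [<-|bcE] := eqVneq be ga.
  by rewrite [be == al]eq_sym (negbTE abE) /=; field; rewrite !hs.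
have [<-|acE] := eqVneq al ga; last by rewrite /=; ring.
rewrite -(can2_eq (addrK 1) (subrK 1)) [al + 1 == be]eq_sym /=.
have [->|beE] := eqVneq be (al + 1).
  by rewrite add2_neq; field; rewrite !hs.
by have [_|_] := eqVneq al (be + 1); field; rewrite !hs.
Qed.

Lemma braidM u al be ga w :
  psiM (size u) *m psiM (size u).+1 *m psiM (size u) *m eM (u ++ al :: be :: ga :: w) =
  (psiM (size u).+1 *m psiM (size u) *m psiM (size u).+1 + braid_sign 'M[K]_N al be ga)
    *m eM (u ++ al :: be :: ga :: w).
Proof.
apply: eM_ext => t tn /word_res_split3[u' [a [b [c [v [-> <- -> -> ->]]]]]].
rewrite mulmxDl braid_sign_cv -!mulmxA !letter_res_rcons.
have [<-|ab] := eqVneq a b.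
  have [<-|ac] := eqVneq a c.
    rewrite psiM_cv_same psiMS_cv_same !mulmx0 /braid_sign.
    by rewrite [_ - 1 - 1 == _]eq_sym sub2_neq /= scale0r addr0.
  have [w1 w2 w3 [w1' w2' w3']] := braidM_aab u' v ac.
  rewrite w1 w1' !mulmx0 mulmxDr -!scalemxAr w1 w2 scaler0 add0r.
  rewrite scalerDr mulmxDr -!scalemxAr w2' w3' /braid_sign /scoef /pcoef subrK.
  have h := xsub_neq0 ac; apply/colP=> i; rewrite !mxE.
  have [<-|st] := eqVneq (letter_res u' a) (letter_res u' c); last by rewrite /=; ring.
  rewrite [_ - 1 == letter_res u' a]eq_sym (negbTE (pred_neq _)) far_pred.
  by rewrite sub2_neq eqxx /=; field.
have [<-|bc] := eqVneq b c.
  have ba : b != a by rewrite eq_sym.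
  rewrite (negbTE ab).
  have [w1 w2 w3 [w1' w2' w3']] := braidM_aab u' v ba.
  rewrite w3 w3' !mulmx0 add0r !mulmxDr -!scalemxAr w2' w3' !(mulmx0, scaler0, add0r).
  rewrite mulmxDr -!scalemxAr w1 w2 scaler0 addr0 /braid_sign /scoef /pcoef.
  have h := xsub_neq0 ba; have h' := xsub_neq0 ab; apply/colP=> i; rewrite !mxE.
  rewrite [letter_res u' b - 1 == _]eq_sym.
  have [->|st] := eqVneq (letter_res u' a) (letter_res u' b - 1).
    rewrite ?subrK ?eqxx ?[letter_res u' b - 1 == letter_res u' b]eq_sym.
    rewrite ?(negbTE (pred_neq _)) ?far_pred /=; field.
    by rewrite h'.
  by rewrite /=; ring.
have [<-|ac] := eqVneq a c; last by rewrite braidM_abc.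
have [w1 w2 w3 [w1' w2' w3']] := braidM_aab u' v ab.
do 5![rewrite ?w1 ?w2 ?w1' ?w2' ?w3' ?mulmxDr -?scalemxAr ?mulmx0 ?scaler0 ?addr0].
rewrite /braid_sign [letter_res u' a - 1 == _]eq_sym (negbTE (pred_neq _)) scale0r addr0 /pcoef.
apply/colP=> i; rewrite !mxE.
have [st|st] := eqVneq (letter_res u' a) (letter_res u' b); last by rewrite /=; ring.
by rewrite -st (negbTE (pred_neq _)) /=; ring.
Qed.

Lemma eM_mul s t : eM s *m eM t = if s == t then eM s else 0.
Proof.
apply: cv_ext => w wn; rewrite -mulmxA !eM_cv.
have [->|st] := eqVneq s t.
  by rewrite eM_cv; case: eqP => [wt|_]; [rewrite eM_cv wt eqxx | rewrite mulmx0].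
rewrite mul0mx; case: (word_res w =P t) => [wt|_]; last by rewrite mulmx0.
by rewrite eM_cv wt eq_sym (negbTE st).
Qed.

Lemma klr_seminormal : @klr I n 'M[K]_N psiM yM eM.
Proof.
split.
- exact: eM_mul.
- apply: cv_ext => w wn; rewrite mulmx_suml [RHS]mul1mx.
  have sw : size (word_res w) == n by rewrite size_word_res wn.
  rewrite (bigD1 (Tuple sw)) //= eM_cv eqxx big1 ?addr0 // => t tw.
  rewrite eM_cv; case: eqP => // wt; case/eqP: tw; exact: val_inj.
- move=> s sn; apply: cv_ext => w wn; rewrite eM_cv mul0mx.
  by case: eqP => // ws; move: sn; rewrite -ws size_word_res wn eqxx.
- by move=> k nk; apply: cv_ext => w wn; rewrite yM_oob ?wn // mul0mx.
- by move=> r nr; apply: cv_ext => w wn; rewrite psiM_oob ?wn // mul0mx.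
- exact: yM_e.
- exact: psiM_e.
- exact: yM_comm.
- exact: psiM_y.
- exact: psiM_psi.
- move=> u a b w; have [H _] := psiM_yM u a b w; apply: (etrans H).
  rewrite [RHS]mulmxBl; congr (_ - _).
  by case: eqP => _; rewrite ?scale1r ?scale0r ?[RHS]mul1mx ?[RHS]mul0mx.
- move=> u a b w; have [_ H] := psiM_yM u a b w; apply: (etrans H).
  rewrite [RHS]mulmxBl; congr (_ - _).
  by case: eqP => _; rewrite ?scale1r ?scale0r ?[RHS]mul1mx ?[RHS]mul0mx.
- exact: quadM.
- exact: braidM.
Qed.

Variable P : K -> Prop.
Hypotheses (P1 : P 1) (PN1 : P (-1)) (PD : forall a b, P a -> P b -> P (a + b)).
Hypothesis PM : forall a b, P a -> P b -> P (a * b).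

Definition scalarM (M : 'M[K]_N) : Prop := exists2 c, P c & M = c%:M.

Lemma central_scalarM : central_scalars scalarM.
Proof.
split.
- by exists 1.
- by exists (-1) => //; rewrite raddfN.
- by move=> _ _ [a Pa ->] [b Pb ->]; exists (a + b); rewrite ?raddfD //; apply: PD.
- by move=> _ _ [a Pa ->] [b Pb ->]; exists (a * b); rewrite ?scalar_mxM //; apply: PM.
- by move=> _ M [a Pa ->]; apply: (esym (scalar_mxC a M)).
Qed.

Variables (rk : nat -> I) (X : nat -> K).
Hypothesis rk_kap : forall k (kl : (k < l)%N), rk k = kap (Ordinal kl).
Hypothesis X_x : forall k (kl : (k < l)%N), X k = x (Ordinal kl).
Hypothesis XS : forall k, X (k + l)%N = X k.
Hypothesis PX : forall k, P (X k).
Hypothesis kap_inj : injective kap.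
Hypothesis kap_sep : forall a b, kap b != kap a + 1.

(** The residue sequence of a word starts with the residue of its first
    letter. The second residue is one less if the letter is repeated, and
    otherwise it is that of another column; it is never one more. *)
Lemma blob_system_seminormal :
  blob_system n l rk scalarM (fun k => (X k)%:M) psiM yM eM.
Proof.
split.
- exact: klr_seminormal.
- by move=> k; exists (X k).
- by move=> k; rewrite XS.
- move=> a w ha; apply: cv_ext => t tn; rewrite eM_cv mul0mx.
  case: eqP => //; case: t {tn} => // b t [ab _].
  have := ha b (ltn_ord b); rewrite -ab /letter_res /= subr0 rk_kap.
  by case/eqP; congr kap; apply: val_inj.
- move=> k w kl; apply: cv_ext => t tn; rewrite eM_cv mul0mx.
  case: eqP => //; case: t {tn} => [|a [|b t]] //=; rewrite /word_res /= => -[ak bk _].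
  move: bk; rewrite -ak (letter_res_rcons [::] a b) /letter_res /= !subr0.
  case: eqP => [->|ab] /eqP.
    by rewrite far_pred.
  by rewrite (negbTE (kap_sep a b)).
- move=> k w kl; apply: cv_ext => t tn; rewrite -!mulmxA eM_cv.
  case: eqP => [|_]; last by rewrite !mulmx0.
  case: t {tn} => // a t; rewrite /word_res /= /letter_res /= subr0 rk_kap => -[/kap_inj aE _].
  by rewrite (yM_cv [::] a t) mul_scalar_mx (X_x kl) aE.
Qed.

End Seminormal.

(** * Matrix units and linear independence of matrices *)

Section MatrixUnits.
Variables (K : fieldType) (I : finNzRingType) (n l : nat).
Variables (kap : 'I_l -> I) (x : 'I_l -> K).
Hypothesis two_neq0 : 1 + 1 != 0 :> I.
Hypothesis x_inj : injective x.

Local Notation word := (seq 'I_l).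
Local Notation N := #|{: n.-tuple 'I_l}|.
Local Notation cv := (@cv K n l).
Local Notation psiM := (psiM n kap x).
Local Notation yM := (yM n x).
Local Notation eM := (@eM K I n l kap).
Local Notation Z := (@scalarM K n l (fun=> True)).
Local Notation gal := (gen_alg Z psiM yM eM).

Definition unit_mx (u w : word) : 'M[K]_N := cv u *m (cv w)^T.

Lemma cv_dot u w : size u = n -> size w = n ->
  (cv u)^T *m cv w = if u == w then 1%:M else 0.
Proof.
move=> un wn; rewrite -[u]/(val (Tuple (introT eqP un))) -[w]/(val (Tuple (introT eqP wn))).
move: (Tuple _) (Tuple _) => {un wn} {}u {}w.
rewrite !cv_tuple trmx_delta mul_delta_mx_cond (inj_eq enum_rank_inj) -val_eqE.
by case: eqP => _; apply/matrixP=> i j; rewrite !ord1 !mxE /= ?mxE.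
Qed.

Lemma unit_mxM u w t : size w = n -> unit_mx u w *m unit_mx w t = unit_mx u t.
Proof.
by move=> wn; rewrite /unit_mx mulmxA -(mulmxA (cv u)) cv_dot // eqxx mulmx1.
Qed.

Lemma gen_alg_scale c M : gal M -> gal (c *: M).
Proof.
move=> gM; rewrite -mul_scalar_mx; apply: (gen_alg_M (a := c%:M)) => //.
by apply: gen_alg_Z; exists c.
Qed.

(** The parameters along a word are its eigenvalues under the [y] and
    determine it, so that Lagrange interpolation gives the projection. *)
Lemma gen_alg_diag u : size u = n -> gal (unit_mx u u).
Proof.
move=> un; case: u un => [|a0 u0] un.
  suff -> : unit_mx [::] [::] = 1%:M by apply: gen_alg_Z; exists 1.
  apply: cv_ext => w wn; rewrite mul1mx /unit_mx -mulmxA cv_dot //.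
  by move: un wn => <-; case: w => //; rewrite eqxx mulmx1.
move: (a0 :: u0) un => u un {u0}.
pose M : 'M[K]_N := \prod_(k < n) \prod_(m | m != nth a0 u k) (yM k - (x m)%:M).
pose c w := \prod_(k < n) \prod_(m | m != nth a0 u k) (x (nth a0 w k) - x m).
have diagM w : size w = n -> M *m cv w = c w *: cv w.
  move=> wn; apply: (big_rec2 (fun (B : 'M[K]_N) b => B *m cv w = b *: cv w)).
    by rewrite scale1r [LHS]mul1mx.
  move=> k b B _ IH; rewrite -[LHS]mulmxA IH -scalemxAr mulrC -scalerA; congr (_ *: _).
  apply: (big_rec2 (fun (B : 'M[K]_N) b => B *m cv w = b *: cv w)).
    by rewrite scale1r [LHS]mul1mx.
  move=> m b' B' _ IH'; rewrite -[LHS]mulmxA IH' -scalemxAr mulrC -scalerA.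
  by rewrite mulmxBl (yM_nth n x two_neq0 a0) ?wn // mul_scalar_mx scalerBl.
have cu : c u != 0.
  apply/prodf_neq0 => k _; apply/prodf_neq0 => m mk.
  by rewrite subr_eq0 (inj_eq x_inj) eq_sym.
have c0 w : size w = n -> w != u -> c w = 0.
  move=> wn wu; have [k kn wk] : exists2 k, (k < n)%N & nth a0 w k != nth a0 u k.
    apply: contrapT => h; case/eqP: wu; apply: (@eq_from_nth _ a0); rewrite ?un // => k kw.
    by apply/eqP; apply: contraT => wk; case: h; exists k; rewrite -?wn.
  rewrite /c (bigD1 (Ordinal kn)) //= (bigD1 (nth a0 w k)) //=.
  by rewrite subrr mul0r mul0r.
suff -> : unit_mx u u = (c u)^-1 *: M.
  apply: gen_alg_scale; rewrite /M; elim/big_ind: _ => //.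
  - by apply: gen_alg_Z; exists 1.
  - by move=> a b; apply: gen_alg_M.
  move=> k _; elim/big_ind: _ => //.
  - by apply: gen_alg_Z; exists 1.
  - by move=> a b; apply: gen_alg_M.
  move=> m _; apply: gen_alg_D => //; apply: gen_alg_Z; exists (- x m) => //.
  by rewrite raddfN.
apply: cv_ext => w wn; rewrite -scalemxAl diagM // /unit_mx -mulmxA cv_dot //.
have [<-|uw] := eqVneq u w; first by rewrite mulmx1 scalerA mulVf // scale1r.
by rewrite (c0 w wn) 1?eq_sym // scale0r scaler0 mulmx0.
Qed.

(** [psi] has a nonzero coefficient between a word and its swap, which the
    diagonal units cut out. *)
Lemma gen_alg_adjacent u a b v : size (u ++ a :: b :: v) = n ->
  gal (unit_mx (u ++ b :: a :: v) (u ++ a :: b :: v)).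
Proof.
case: (eqVneq a b) => [<-|ab] wn; first exact: gen_alg_diag.
have wn' : size (u ++ b :: a :: v) = n by rewrite -wn !size_cat.
set w := u ++ a :: b :: v in wn *; set w' := u ++ b :: a :: v in wn' *.
have ww' : (w' == w) = false.
  apply/negbTE; rewrite /w /w' eqseq_cat // eqxx /= eqseq_cons eq_sym.
  by rewrite (negbTE ab).
pose s := scoef x (letter_res kap u a) (letter_res kap u b) a b.
have s0 : s != 0.
  rewrite /s /scoef; do 2?case: ifP => _; rewrite ?oner_eq0 ?invr_eq0 ?subr_eq0 //.
    by rewrite (inj_eq x_inj).
  by rewrite (inj_eq x_inj) eq_sym.
have -> : unit_mx w' w = s^-1 *: (unit_mx w' w' *m psiM (size u) *m unit_mx w w).
  rewrite /unit_mx -!mulmxA (mulmxA (psiM _)) psiM_cv // -/s -/w -/w'.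
  rewrite mulmxDl !mulmxDr -!scalemxAl -!scalemxAr !(mulmxA (_^T)) !cv_dot // ww' eqxx.
  by rewrite mul0mx mulmx0 scaler0 add0r mul1mx scalerA mulVf // scale1r.
apply: gen_alg_scale; apply: (gen_alg_M (a := _ *m _)); last exact: gen_alg_diag.
by apply: (gen_alg_M (b := psiM _)) => //; apply: gen_alg_diag.
Qed.

Lemma gen_alg_unit_trans u w t : size w = n ->
  gal (unit_mx u w) -> gal (unit_mx w t) -> gal (unit_mx u t).
Proof. by move=> wn guw gwt; rewrite -(unit_mxM u t wn); apply: gen_alg_M. Qed.

(** The first letter of [u] is moved to the front of [w] by swaps; the prefix
    [p] collects the letters in place. *)
Lemma gen_alg_unit_perm p u w : perm_eq u w -> size (p ++ u) = n ->
  gal (unit_mx (p ++ u) (p ++ w)).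
Proof.
elim: u p w => [|a u IH] p w.
  rewrite perm_sym => /perm_nilP -> pn; exact: gen_alg_diag.
move=> uw pn; have aw : a \in w by rewrite -(perm_mem uw) inE eqxx.
case/splitPr: w / aw uw => w1 w2 uw.
have uw' : perm_eq u (w1 ++ w2).
  by rewrite -(perm_cons a); apply: perm_trans uw _; rewrite perm_catC /= perm_cons perm_catC.
have sz : size u = (size w1 + size w2)%N by rewrite (perm_size uw') size_cat.
have pn1 : size (p ++ a :: w1 ++ w2) = n by rewrite -pn !size_cat /= size_cat sz.
apply: (gen_alg_unit_trans pn1).
  by rewrite -!cat_rcons; apply: IH => //; rewrite cat_rcons.
elim/last_ind: w1 w2 {uw uw' sz} pn1 => [|w1 b IH1] w2 pn1; first exact: gen_alg_diag.
rewrite !cat_rcons in pn1 *; apply: (gen_alg_unit_trans (w := p ++ w1 ++ a :: b :: w2)).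
- by move: pn1; rewrite !size_cat /= !size_cat /=; lia.
- exact: IH1.
- rewrite !(catA p w1); apply: gen_alg_adjacent.
  by move: pn1; rewrite !size_cat /= !size_cat /=; lia.
Qed.

End MatrixUnits.

(** The coefficients of the units on the family, times the entries of the
    family at the units, form an identity matrix of size [#|Q|]. So the entries
    form a matrix of rank at least [#|Q|], and its [#|J|] rows are
    independent. *)
Lemma free_of_span (K : fieldType) (N : nat) (J Q : finType)
    (M : J -> 'M[K]_N) (row col : Q -> 'I_N) :
  injective (fun q => (row q, col q)) -> (#|J| <= #|Q|)%N ->
  (forall q, exists c : J -> K, delta_mx (row q) (col q) = \sum_j c j *: M j) ->
  forall c : J -> K, \sum_j c j *: M j = 0 -> forall j, c j = 0.
Proof.
move=> rc_inj JQ span c c0 j.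
have [d dE] : exists d : Q -> J -> K,
    forall q, delta_mx (row q) (col q) = \sum_j d q j *: M j.
  by exists (fun q => projT1 (cid (span q))) => q; apply: (projT2 (cid (span q))).
pose C := \matrix_(a < #|J|, b < #|Q|) M (enum_val a) (row (enum_val b)) (col (enum_val b)).
pose D := \matrix_(b < #|Q|, a < #|J|) d (enum_val b) (enum_val a).
have combE (f : J -> K) q : (\sum_j f j *: M j) (row q) (col q)
    = \sum_(a < #|J|) f (enum_val a) * M (enum_val a) (row q) (col q).
  rewrite summxE (reindex (@enum_val J predT)) /=; last exact/onW_bij/enum_val_bij.
  by apply: eq_bigr => a _; rewrite mxE.
have DC : D *m C = 1%:M.
  apply/matrixP=> b b'; rewrite !mxE -(inj_eq enum_val_inj).
  transitivity ((\sum_j d (enum_val b) j *: M j) (row (enum_val b')) (col (enum_val b'))).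
    by rewrite combE; apply: eq_bigr => a _; rewrite !mxE.
  rewrite -dE mxE -(inj_eq rc_inj) xpair_eqE.
  by rewrite [row (enum_val b') == _]eq_sym [col (enum_val b') == _]eq_sym.
have freeC : row_free C.
  rewrite /row_free eqn_leq rank_leq_row (leq_trans JQ) //.
  by rewrite -{1}(@mxrank1 K #|Q|) -DC; apply: mxrankM_maxr.
pose cr := \row_(a < #|J|) c (enum_val a).
have : cr *m C = 0.
  apply/rowP=> b; have h := combE c (enum_val b); rewrite c0 mxE in h.
  rewrite [RHS]mxE h [LHS]mxE.
  by apply: eq_bigr => a _; rewrite !mxE.
move/eqP; rewrite (mulmx_free_eq0 _ freeC) => /eqP/rowP/(_ (enum_rank j)).
by rewrite !mxE enum_rankK.
Qed.

(** * Residues, words and tableaux *)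

Section Residues.
Variables (e l n : nat) (hkappa : 'I_l -> int).
Hypotheses (e_gt1 : (1 < e)%N) (l_gt1 : (1 < l)%N).
Hypothesis free : strongly_adjacency_free e n hkappa.

Local Notation kappa := (kappa_of e hkappa).

Let l_gt0 : (0 < l)%N := ltnW l_gt1.

Definition rkap (x : nat) : 'Z_e :=
  kappa (Ordinal (ltn_pmod x l_gt0)) - (x %/ l)%:R.

Lemma rkap_small x (xl : (x < l)%N) : rkap x = kappa (Ordinal xl).
Proof.
rewrite /rkap divn_small // subr0; congr kappa; apply: val_inj.
by rewrite /= modn_small.
Qed.

Lemma val_Zadd (a b : 'Z_e) : (a + b : 'Z_e) = ((a + b) %% e)%N :> nat.
Proof. by rewrite /=; congr (_ %% _)%N; apply: Zp_cast. Qed.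

Lemma val_Zone : (1 : 'Z_e) = 1%N :> nat.
Proof. by rewrite /= Zp_cast // modn_small. Qed.

Lemma lt_Z (a : 'Z_e) : (a < e)%N.
Proof. by rewrite -[X in (_ < X)%N](Zp_cast e_gt1). Qed.

Lemma kappa_sub i j : i != j -> kappa i != kappa j /\ kappa i != kappa j + 1.
Proof.
have [_ h _ _] := free; move=> /h[h0 h1 _]; split; first by rewrite -subr_eq0.
by rewrite addrC -subr_eq.
Qed.

Lemma kappa_inj : injective kappa.
Proof.
by move=> i j ij; apply/eqP; apply: contraT => /kappa_sub[]; rewrite ij eqxx.
Qed.

(** The difference of two residues [kappa] is neither 0 nor 1, so there are
    more than two classes. *)
Lemma two_neq0_Z : 1 + 1 != 0 :> 'Z_e.
Proof.
apply/eqP=> /(congr1 (@nat_of_ord _)); rewrite val_Zadd val_Zone /= => e2.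
have {e2} e2 : e = 2%N by case: e e_gt1 e2 => [|[|[|m]]] // _; rewrite modn_small.
have [_ h _ _] := free.
have [|h0 h1 _] := h (Ordinal l_gt0) (Ordinal l_gt1); first by rewrite -val_eqE.
move: (_ - _) h0 h1 => d /eqP h0 /eqP h1.
have d0 : nat_of_ord d <> 0%N by move=> d0; apply/h0/val_inj.
have d1 : nat_of_ord d <> 1%N.
  by move=> d1; apply/h1/val_inj; rewrite [LHS]d1 [RHS]val_Zone.
by have := lt_Z d; rewrite [X in (_ < X)%N]e2; lia.
Qed.

(** The representatives of the residues increase, and those of the first and
    of the last component do not differ by two; together this excludes a
    difference of two around the cycle of residues. *)
Lemma kappa_add2 (i j : 'I_l) : (i < j)%N -> kappa i != kappa j + 1 + 1.
Proof.
move=> ij; apply/eqP=> ijE; have [_ _ h3 h4] := free.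
have vij := h4 _ _ ij.
have vE : (kappa i = (kappa j + 2) %% e :> nat)%N.
  rewrite ijE !val_Zadd val_Zone modnDml -addnA //.
have wrap : (e <= kappa j + 2)%N.
  by rewrite leqNgt; apply/negP=> lt; move: vij; rewrite vE modn_small; lia.
have ltj := lt_Z (kappa j).
have viE : (kappa i = kappa j + 2 - e :> nat)%N.
  by rewrite vE -[in LHS](subnK wrap) modnDr modn_small; lia.
have succ a b : (kappa a = (kappa b).+1 :> nat) -> a != b -> False.
  move=> ab /kappa_sub[_ /eqP]; apply; apply: val_inj.
  by rewrite [LHS]ab [RHS]val_Zadd val_Zone addn1 modn_small // -ab; apply: lt_Z.
have [i0|i0] := posnP i; last first.
  have := h4 (Ordinal l_gt0) i i0; move=> v0.
  by apply: (succ i (Ordinal l_gt0)); [lia | rewrite -val_eqE /= -lt0n].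
have [jl|jl] := eqVneq j.+1 l.
  by have := h3 i j i0 jl; rewrite ijE -addrA eqxx.
have ll : (l.-1 < l)%N by rewrite prednK.
have jll : (j < Ordinal ll)%N by have := ltn_ord j; rewrite /=; lia.
have := h4 _ _ jll; have := lt_Z (kappa (Ordinal ll)); move=> v1 v2.
by apply: (succ (Ordinal ll) j); [lia | rewrite -val_eqE /=; lia].
Qed.

Lemma far_sub (a b c : 'Z_e) : far (a - c) (b - c) = far a b.
Proof. by rewrite /far ![_ - c + 1]addrAC !(inj_eq (addIr _)). Qed.

(** A key between [x] and [x + l] is to the right of [x] in the same row or
    to the left of [x] in the next row. In the second case the residues are
    shifted by one, and a difference of two between the [kappa] has to be
    excluded as well, by [kappa_add2]. *)
Lemma residue_fun_rkap : residue_fun l rkap.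
Proof.
split=> //; first exact: two_neq0_Z.
  move=> x; rewrite /rkap divnDr ?dvdnn // divnn l_gt0 natrD opprD addrA.
  by congr (kappa _ - _ - _); apply: val_inj; rewrite /= modnDr.
move=> x z xz zxl; rewrite /rkap.
set i := Ordinal (ltn_pmod x _); set j := Ordinal (ltn_pmod z _).
have xE := divn_eq x l; have zE := divn_eq z l.
have il := ltn_pmod x l_gt0; have jl := ltn_pmod z l_gt0.
have [q_eq|q_eq] : (z %/ l = x %/ l \/ z %/ l = (x %/ l).+1)%N.
  have h1 : (x %/ l <= z %/ l)%N by apply: leq_div2r; apply: ltnW.
  have h2 : (z %/ l <= (x %/ l).+1)%N.
    by have := leq_div2r l (ltnW zxl); rewrite divnDr ?dvdnn // divnn l_gt0 addn1.
  by lia.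
- have ij : (i < j)%N by rewrite /= -(ltn_add2l (x %/ l * l)) -xE -q_eq -zE.
  have ijN : i != j by rewrite neq_ltn ij.
  have jiN : j != i by rewrite eq_sym.
  rewrite q_eq far_sub; have [h1 h2] := kappa_sub ijN; have [_ h3] := kappa_sub jiN.
  by apply/and3P.
- have ji : (j < i)%N.
    by rewrite /= -(ltn_add2l ((x %/ l).+1 * l)) -{1}q_eq -zE mulSn -addnA -xE addnC.
  have ijN : i != j by rewrite neq_ltn ji orbT.
  have jiN : j != i by rewrite eq_sym.
  rewrite q_eq -natr1 opprD addrA.
  have [h1 h2] := kappa_sub ijN; have [_ h3] := kappa_sub jiN; have h4 := kappa_add2 ji.
  rewrite -far_shift addrAC far_sub; apply/and3P; split.
  - by rewrite eq_sym.
  - by rewrite (inj_eq (addIr 1)).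
  - exact: h4.
Qed.

End Residues.

Section PermutationWords.
Variable n : nat.

Lemma stransp_adj (r : 'I_n.-1) (j : 'I_n) : stransp r j = adj r j :> nat.
Proof.
rewrite /stransp; case: tpermP => [->|->|/eqP jlo /eqP jhi].
- by rewrite adjl.
- by rewrite adjr.
- by rewrite adjD.
Qed.

Lemma expressesE (rs : seq 'I_n.-1) (w : 'S_n) :
  expresses rs w <-> forall k : 'I_n, w k = wfun (map val rs) k :> nat.
Proof.
have foldE (k : 'I_n) :
    foldr (fun r j => stransp r j) k rs = wfun (map val rs) k :> nat.
  by elim: rs => //= r rs IH; rewrite stransp_adj IH.
split=> [h k|h k]; first by rewrite h foldE.
by apply: val_inj; rewrite /= h foldE.
Qed.

Lemma good_map_val (rs : seq 'I_n.-1) : good n (map val rs).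
Proof. by rewrite /good all_map; apply/allP=> r _ /=; rewrite -ltn_predRL. Qed.

Lemma good_lift V : good n V -> exists rs : seq 'I_n.-1, V = map val rs.
Proof.
elim: V => [|r V IH] /=; first by exists [::].
case/andP=> rn /IH[rs ->]; have rn' : (r < n.-1)%N by rewrite ltn_predRL.
by exists (Ordinal rn' :: rs).
Qed.

Lemma perm_of_word W : good n W -> exists w : 'S_n, forall k : 'I_n, w k = wfun W k :> nat.
Proof.
move=> gW; have lt (k : 'I_n) : (wfun W k < n)%N by rewrite wfun_lt.
have inj : injective (fun k => Ordinal (lt k)).
  by move=> i j [] /wfun_inj/val_inj.
by exists (perm inj) => k; rewrite permE.
Qed.

Lemma wfun_eq W V : good n W -> good n V ->
  (forall k : 'I_n, wfun W k = wfun V k) -> wfun W =1 wfun V.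
Proof.
move=> gW gV h k; have [kn|nk] := ltnP k n; first exact: h (Ordinal kn).
by rewrite !(@wfun_oob n).
Qed.

Lemma reduced_exprW rs (w : 'S_n) : reduced_expr rs w -> reduced n (map val rs).
Proof.
case=> /expressesE wE wmin; split=> [|V gV VE]; first exact: good_map_val.
have [rs' V'E] := good_lift gV; rewrite V'E !size_map; apply: wmin.
by apply/expressesE=> k; rewrite wE -V'E VE.
Qed.

End PermutationWords.

Section Shapes.
Variables (l n : nat).
Hypothesis l_gt0 : (0 < l)%N.

Definition key (x : node l n) : nat := (x.1.-1 * l + x.2)%N.

Lemma key_mod (x : node l n) : (key x %% l)%N = x.2.
Proof. by rewrite /key modnMDl modn_small. Qed.

Lemma key_div (x : node l n) : (key x %/ l)%N = x.1.-1.
Proof. by rewrite /key divnMDl // divn_small ?addn0. Qed.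

Lemma key_lt (x z : node l n) : (0 < x.1)%N -> node_lt z x -> (key x < key z)%N.
Proof.
move=> x0 /orP[xz|/andP[/eqP zx xz]]; last by rewrite /key zx ltn_add2l.
apply: (@leq_trans (x.1.-1.+1 * l)); first by rewrite mulSn [X in (_ < X)%N]addnC ltn_add2l.
by apply: leq_trans (leq_addr _ _); rewrite leq_mul2r; apply/orP; right; lia.
Qed.

Lemma tab_inj (lam : Par1 l n) (t : Tab lam) : injective (val t).
Proof. by have /andP[/injectiveP] := valP t. Qed.

Lemma tab_diagram (lam : Par1 l n) (t : Tab lam) k : val t k \in diagram lam.
Proof. by have /andP[_ /eqP <-] := valP t; apply: imset_f. Qed.

Lemma tab_onto (lam : Par1 l n) (t : Tab lam) x :
  x \in diagram lam -> exists k, x = val t k.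
Proof. by have /andP[_ /eqP <-] := valP t; case/imsetP=> k _ ->; exists k. Qed.

Lemma card_tab (lam : Par1 l n) (t : Tab lam) (P : pred (node l n)) :
  #|[set k | P (val t k)]| = #|[set x in diagram lam | P x]|.
Proof.
rewrite -(card_imset _ (@tab_inj lam t)); congr #|pred_of_set _|.
apply/setP=> x; rewrite inE; apply/imsetP/andP => [[k]|[/(tab_onto t)[k ->] Pk]].
  by rewrite inE => Pk ->; split=> //; apply: tab_diagram.
by exists k => //; rewrite inE.
Qed.

Lemma card_column (lam : Par1 l n) m r : (r <= val lam m)%N ->
  #|[set x in diagram lam | (x.2 == m) && (x.1 <= r)%N]| = r.
Proof.
move=> rm; have rn : (r <= n)%N by apply: leq_trans rm _; rewrite -ltnS.
pose f (i : 'I_r) : node l n := (inord i.+1, m).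
have fE (i : 'I_r) : (f i).1 = i.+1 :> nat by rewrite inordK // ltnS; apply: leq_trans rn.
have f_inj : injective f by move=> i j ij; apply: val_inj; have := fE i; rewrite ij fE => -[].
rewrite -[RHS]card_ord -cardsT -(card_imset _ f_inj); congr #|pred_of_set _|.
apply/setP=> x; rewrite !inE; apply/andP/imsetP => [[/andP[x1 _] /andP[/eqP xm xr]]|[i _ ->]].
  have ir : (x.1.-1 < r)%N by rewrite prednK.
  exists (Ordinal ir) => //; case: x x1 xm xr ir => x1 x2 /= x10 -> _ ir.
  by congr (_, _); apply: val_inj; have := fE (Ordinal ir) => /= ->; rewrite prednK.
rewrite fE eqxx /=; split=> //; exact: leq_trans (ltn_ord i) rm.
Qed.

Definition column_word (lam : Par1 l n) (t : Tab lam) : n.-tuple 'I_l :=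
  [tuple (val t k).2 | k < n].

Lemma count_column_word (lam : Par1 l n) (t : Tab lam) m :
  count_mem m (column_word t) = val lam m.
Proof.
rewrite -[RHS](card_column (leqnn _)) -(card_tab t (fun x => (x.2 == m) && (x.1 <= val lam m)%N)).
rewrite /= -sum1_count big_map big_enum_cond sum1_card; apply: eq_card => k.
have := tab_diagram t k; rewrite !inE => /andP[_ h].
transitivity ((val t k).2 == m); first by [].
by case: eqP => // <-; rewrite h.
Qed.

(** In a standard tableau the entries above [k] in its column are the smaller
    ones of that column. *)
Lemma std_row (lam : Par1 l n) (t : Tab lam) k : is_standard t ->
  (val t k).1 = #|[set j | ((val t j).2 == (val t k).2) && (j <= k)%N]| :> nat.
Proof.
move=> /forallP st; have := tab_diagram t k; rewrite inE => /andP[_ h].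
rewrite -{1}(card_column h) -(card_tab t (fun x => (x.2 == (val t k).2) && (x.1 <= (val t k).1)%N)).
apply: eq_card => j; rewrite !inE; case: eqP => // jk /=.
have [lt|gt|eq] := ltngtP (val t j).1 (val t k).1.
- have /forallP/(_ k)/implyP := st j; rewrite jk eqxx lt => /(_ isT) jk'.
  by rewrite ltnW.
- have /forallP/(_ j)/implyP := st k; rewrite jk eqxx gt => /(_ isT) kj.
  by rewrite leqNgt kj.
- suff -> : j = k by rewrite leqnn.
  apply: (@tab_inj _ t); move: jk eq.
  by case: (val t j) => a b; case: (val t k) => c d /= -> /val_inj ->.
Qed.

(** The number of letters [m] is the height of column [m], and [std_row]
    counts the row of an entry; so the words determine the shape and the
    tableaux. *)
Lemma column_word_inj : injective (fun x : {lam : Par1 l n & StdPair lam} =>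
  (column_word (val (tagged x).1), column_word (val (tagged x).2))).
Proof.
move=> [lam [s t]] [lam' [s' t']] E.
have ss' : column_word (val s) = column_word (val s') := congr1 fst E.
have tt' : column_word (val t) = column_word (val t') := congr1 snd E.
have lamE : lam = lam'.
  apply: val_inj; apply/ffunP=> m; apply: val_inj.
  by have := count_column_word (val s) m; rewrite ss' count_column_word => /esym.
case: lam' / lamE s' t' ss' tt' {E} => s' t' ss' tt'.
have eq_std (u u' : Std lam) : column_word (val u) = column_word (val u') -> u = u'.
  move=> /(congr1 (fun w => tnth w)) uu'.
  have col k : (val (val u) k).2 = (val (val u') k).2.
    by have := congr1 (fun f => f k) uu'; rewrite !tnth_mktuple.
  apply: val_inj; apply: val_inj; apply/ffunP=> k.
  have row : (val (val u) k).1 = (val (val u') k).1.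
    apply: val_inj; rewrite /= (std_row k (valP u)) (std_row k (valP u')).
    by apply: eq_card => j; rewrite !inE !col.
  by move: (col k) row; case: (val (val u) k) => a b; case: (val (val u') k) => c d /= -> ->.
by rewrite (eq_std _ _ ss') (eq_std _ _ tt').
Qed.

Lemma perm_column_word (lam : Par1 l n) (s t : Tab lam) :
  perm_eq (column_word s) (column_word t).
Proof.
apply/allP=> m _; apply/eqP; have := count_column_word s m; have := count_column_word t m.
by move=> -> ->.
Qed.

(** The heights of the columns are the numbers of keys in the classes modulo
    [l], and closure under passing to the node above makes the keys of a class
    fill a column from the top. So [L] and the keys of the initial tableau are
    increasing lists with the same elements. *)
Lemma shape_of_rowlist L : rowlist l L -> size L = n ->
  exists lam : Par1 l n, forall k : 'I_n, key (val (initial lam) k) = nth 0%N L k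
    /\ (0 < (val (initial lam) k).1)%N.
Proof.
move=> Lrow Ln; have [/andP[sL closed]] := Lrow.
have uL : uniq L by apply: sorted_uniq sL; [apply: ltn_trans | move=> ?; apply: ltnn].
pose a : {ffun 'I_l -> 'I_n.+1} := [ffun m : 'I_l => inord (count (fun x => x %% l == m)%N L)].
have aE m : a m = count (fun x => x %% l == m)%N L :> nat.
  by rewrite ffunE inordK // ltnS -Ln count_size.
have a_par : is_par1 a.
  rewrite /is_par1 -[X in _ == X]Ln; apply/eqP.
  rewrite (eq_bigr (fun m : 'I_l => (\sum_(x <- L) (x %% l == m))%N)); last first.
    by move=> m _; rewrite aE -sum1_count big_mkcond.
  rewrite exchange_big /= -sum1_size; apply: eq_bigr => x _.
  rewrite (bigD1 (Ordinal (ltn_pmod x l_gt0))) //= eqxx big1 ?addn0 // => m mx.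
  by case: eqP => // xm; case/eqP: mx; apply: val_inj.
pose lam : Par1 l n := exist _ a a_par.
have below x i : x \in L -> (i <= x %/ l)%N -> (i * l + x %% l)%N \in L.
  move=> xL; move Eh : (x %/ l)%N => h; elim: h x xL Eh i => [|h IH] x xL Eh i ih.
    by rewrite leqn0 in ih; rewrite (eqP ih) -Eh -divn_eq.
  move: ih; rewrite leq_eqVlt => /orP[/eqP ->|]; first by rewrite -Eh -divn_eq.
  have lx : (l <= x)%N by rewrite leqNgt; apply/negP=> /divn_small; rewrite Eh.
  have xlL : (x - l)%N \in L.
    by have := allP closed x xL; rewrite ltnNge lx.
  have -> : (x %% l = (x - l) %% l)%N by rewrite -{1}(subnK lx) modnDr.
  rewrite ltnS; apply: (IH (x - l)%N xlL).
  by apply: succn_inj; rewrite -Eh -{2}(subnK lx) divnDr ?dvdnn // divnn l_gt0 addn1.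
have height x : x \in L -> ((x %/ l).+1 <= a (Ordinal (ltn_pmod x l_gt0)))%N.
  move=> xL; rewrite aE -size_filter -(size_iota 0 (x %/ l).+1).
  rewrite -(size_map (fun i => i * l + x %% l)%N).
  apply: uniq_leq_size.
    rewrite map_inj_uniq ?iota_uniq // => i j /addIn/eqP.
    by rewrite eqn_pmul2r // => /eqP.
  move=> z /mapP[i]; rewrite mem_iota add0n ltnS => /andP[_ ix] ->.
  by rewrite mem_filter below // andbT /= modnMDl modn_mod.
pose nd x : node l n := (inord (x %/ l).+1, Ordinal (ltn_pmod x l_gt0)).
have ndn x : x \in L -> ((x %/ l).+1 < n.+1)%N.
  by move=> /height h; apply: leq_ltn_trans h (ltn_ord _).
have key_nd x : x \in L -> key (nd x) = x.
  by move=> xL; rewrite /key /= inordK ?ndn //= -divn_eq.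
have nd_diag : [set nd (nth 0%N L k) | k : 'I_n] = diagram lam.
  apply/eqP; rewrite eqEcard card_diagram; apply/andP; split.
    apply/subsetP=> _ /imsetP[k _ ->]; rewrite inE /= inordK ?ndn ?mem_nth ?Ln //=.
    by apply: height; rewrite mem_nth ?Ln.
  rewrite card_imset ?card_ord // => i j /(congr1 key).
  rewrite !key_nd ?mem_nth ?Ln // => /eqP; rewrite nth_uniq ?Ln // => /eqP.
  exact: val_inj.
have pos x : x \in diagram lam -> (0 < x.1)%N by rewrite inE => /andP[].
exists lam => k; split; last exact/pos/tab_diagram.
pose keys := [seq key (val (initial lam) k) | k <- enum 'I_n].
have skeys : size keys = n by rewrite size_map size_enum_ord.
have keysE (i : 'I_n) : nth 0%N keys i = key (val (initial lam) i).
  by rewrite (nth_map i) ?size_enum_ord // nth_ord_enum.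
have keys_sorted : sorted ltn keys.
  rewrite (sorted_pairwise ltn_trans); apply/(pairwiseP 0%N) => i j.
  rewrite !inE skeys => ni nj ij.
  rewrite (keysE (Ordinal ni)) (keysE (Ordinal nj)).
  by apply: key_lt; [apply/pos/tab_diagram | apply: initialP].
suff -> : L = keys by rewrite keysE.
apply: (irr_sorted_eq ltn_trans) => //; first by move=> ?; apply: ltnn.
have uk : uniq keys by apply: sorted_uniq keys_sorted; [apply: ltn_trans | move=> ?; apply: ltnn].
suff sub : {subset keys <= L}.
  have [_ kL] : (size keys = size L) * (keys =i L).
    by apply: uniq_min_size uk sub _; rewrite Ln skeys.
  by move=> x; rewrite kL.
move=> _ /mapP[i _ ->]; have := tab_diagram (initial lam) i.
rewrite -nd_diag => /imsetP[j _ ->].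
by rewrite key_nd mem_nth ?Ln.
Qed.

End Shapes.

(** * The family of cellular elements *)

Section Family.
Variables (e l n : nat) (hkappa : 'I_l -> int) (rex : 'S_n -> seq 'I_n.-1).
Hypotheses (e_gt1 : (1 < e)%N) (l_gt1 : (1 < l)%N).
Hypothesis free : strongly_adjacency_free e n hkappa.
Hypothesis rex_reduced : forall w, reduced_expr (rex w) w.

Local Notation kappa := (kappa_of e hkappa).
Local Notation rk := (rkap e hkappa l_gt1).
Local Notation J := {lam : Par1 l n & StdPair lam}.

Definition tab_word (lam : Par1 l n) (t : Tab lam) : seq nat :=
  map val (rex (perm_of_tab t)).

Definition res_seq (lam : Par1 l n) : seq 'Z_e :=
  [seq res_initial kappa lam k | k : 'I_n].

(** The elements of the theorem for operators in any ring, so that the blob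
    algebra and the matrices can be compared on them. *)
Definition cell_family (A : pzRingType) (psi : nat -> A) (eA : seq 'Z_e -> A) (x : J) : A :=
  psiw psi (rev (tab_word (val (tagged x).1))) * eA (res_seq (tag x))
  * psiw psi (tab_word (val (tagged x).2)).

Definition chosen_word (L W : seq nat) : Prop :=
  exists2 w : 'S_n, W = map val (rex w) & std_word n l L W.

Lemma rex_wfun (w : 'S_n) (k : 'I_n) : w k = wfun (map val (rex w)) k :> nat.
Proof. by have [/expressesE wE _] := rex_reduced w; apply: wE. Qed.

Lemma chosen_word_exists L W : rowlist l L -> size L = n -> reduced n W ->
  std_word n l L W -> exists W', [/\ chosen_word L W', reduced n W' & wfun W' =1 wfun W].
Proof.
move=> Lrow Ln [gW mW] sW; have [w wE] := perm_of_word gW.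
have W'W : wfun (map val (rex w)) =1 wfun W.
  apply: wfun_eq; [exact: good_map_val | exact: gW |].
  by move=> k; rewrite -rex_wfun wE.
exists (map val (rex w)); split=> //; last exact: reduced_exprW (rex_reduced w).
by exists w => // i j ij jn; rewrite !W'W; apply: sW.
Qed.

Lemma tableau_of_word (lam : Par1 l n) L (w : 'S_n) : rowlist l L -> size L = n ->
    (forall k : 'I_n, key (val (initial lam) k) = nth 0%N L k) ->
    std_word n l L (map val (rex w)) ->
  exists t : Std lam, perm_of_tab (val t) = w.
Proof.
move=> Lrow Ln keyE sw; have l_gt0 := ltnW l_gt1.
pose f : {ffun 'I_n -> node l n} := [ffun k => val (initial lam) (w k)].
have fE k : f k = val (initial lam) (w k) by rewrite ffunE.
have f_tab : is_tableau lam f.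
  apply/andP; split.
    by apply/injectiveP=> i j; rewrite !fE => /tab_inj/perm_inj.
  apply/eqP/setP=> x; apply/imsetP/idP => [[k _ ->]|].
    by rewrite fE; apply: tab_diagram.
  by case/(tab_onto (initial lam))=> k ->; exists (w^-1%g k) => //; rewrite fE permKV.
pose t : Tab lam := exist _ f f_tab.
have t_std : is_standard t.
  apply/forallP=> i; apply/forallP=> j; apply/implyP=> /andP[].
  rewrite /= !fE => /eqP col row; rewrite ltnNge leq_eqVlt; apply/negP.
  case/orP=> [/eqP/val_inj ji|ji]; first by rewrite ji ltnn in row.
  have := sw j i ji (ltn_ord i); rewrite -!rex_wfun -!keyE !key_mod col => /(_ erefl).
  rewrite -(L_lt Lrow Ln) // -!keyE => /ltnW/(leq_div2r l).
  have := tab_diagram (initial lam) (w i); rewrite inE => /andP[+ _].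
  by rewrite !(key_div l_gt0); lia.
exists (exist _ t t_std); apply/permP=> k; apply: (@tab_inj _ _ _ (initial lam)).
by rewrite perm_of_tabP /= fE.
Qed.

Lemma cellular_family (A : pzRingType) (psi : nat -> A) (eA : seq 'Z_e -> A) a :
  cellular n l rk psi eA chosen_word a -> exists x, a = cell_family psi eA x.
Proof.
move=> [L [W [V [[Lrow Ln] [w WE sw] [w' VE sv] ->]]]]; have l_gt0 := ltnW l_gt1.
have [lam lamE] := shape_of_rowlist l_gt0 Lrow Ln.
have keyE k : key (val (initial lam) k) = nth 0%N L k by have [] := lamE k.
rewrite WE in sw; rewrite VE in sv.
have [s sE] := tableau_of_word Lrow Ln keyE sw.
have [t tE] := tableau_of_word Lrow Ln keyE sv.
exists (existT _ lam (s, t)); rewrite /cell_family /tab_word /= sE tE WE VE.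
congr (_ * eA _ * _); apply: (@eq_from_nth _ 0) => [|k].
  by rewrite /res_seq size_map [RHS]size_map size_enum_ord.
rewrite size_map Ln => kn; have [kE k0] := lamE (Ordinal kn).
rewrite (nth_map 0%N) ?Ln // (nth_map (Ordinal kn)) ?size_enum_ord // ffunE.
have -> : nth (Ordinal kn) (enum 'I_n) k = Ordinal kn.
  by apply: val_inj; rewrite /= nth_enum_ord.
rewrite /rkap /residue -[in LHS]kE (key_div l_gt0).
have -> : Ordinal (ltn_pmod (key (val (initial lam) (Ordinal kn))) (ltnW l_gt1))
          = (val (initial lam) (Ordinal kn)).2.
  by apply: val_inj; rewrite /= key_mod.
case: ((val (initial lam) (Ordinal kn)).1 : nat) k0 => // m _ /=.
by rewrite -natr1 opprD addrACA subrr addr0.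
Qed.

Lemma zspan_family (A : pzRingType) (Z : A -> Prop) (T : finType) (f : T -> A) a :
  central_scalars Z -> zspan Z (fun b => exists x, b = f x) a ->
  exists2 c : T -> A, (forall x, Z (c x)) & a = \sum_x c x * f x.
Proof.
move=> CS; have Z0 := cs0 CS; elim=> {a}.
- by exists (fun=> 0) => //; rewrite big1 // => x _; rewrite mul0r.
- move=> a a' _ [c Zc ->] _ [c' Zc' ->]; exists (fun x => c x + c' x).
    by move=> x; apply: (csD CS).
  by rewrite -big_split; apply: eq_bigr => x _; rewrite mulrDl.
- move=> z _ Zz [x ->]; exists (fun x' => if x' == x then z else 0).
    by move=> x'; case: ifP.
  by rewrite (bigD1 x) //= eqxx big1 ?addr0 // => x' /negbTE ->; rewrite mul0r.
Qed.

Lemma family_span (A : pzRingType) (Z : A -> Prop) X psi y (eA : seq 'Z_e -> A) a :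
  central_scalars Z -> blob_system n l rk Z X psi y eA ->
  gen_alg Z psi y eA a ->
  exists2 c : J -> A, (forall x, Z (c x)) & a = \sum_x c x * cell_family psi eA x.
Proof.
move=> CS BS ga; apply: zspan_family => //.
have := gen_alg_span (residue_fun_rkap e_gt1 l_gt1 free) CS BS chosen_word_exists ga.
by apply: (zspan_mono CS) => b /cellular_family bE; apply: (zspan_in CS).
Qed.

End Family.

(** * Deformation and linear independence in the blob algebra *)

Section ResidueSequences.
Variables (e n : nat).

Definition seq_of_ffun (i : resseq e n) : seq 'Z_e := [seq i k | k : 'I_n].

Lemma size_seq_of_ffun i : size (seq_of_ffun i) = n.
Proof. by rewrite /seq_of_ffun size_map size_enum_ord. Qed.

Lemma seq_of_ffunK i : ffun_of_seq n (seq_of_ffun i) = i.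
Proof. exact: ffun_of_mkseq. Qed.

Lemma ffun_of_seqK s : size s = n -> seq_of_ffun (ffun_of_seq n s) = s.
Proof.
move=> sn; apply: (@ffun_of_seq_inj e n) => //; first exact: size_seq_of_ffun.
exact: seq_of_ffunK.
Qed.

Lemma seq_of_ffun_inj : injective seq_of_ffun.
Proof. exact: can_inj seq_of_ffunK. Qed.

Lemma seq_of_ffun_split (i : resseq e n) (r : 'I_n.-1) : exists u w,
  [/\ seq_of_ffun i = u ++ i (lo r) :: i (hi r) :: w, size u = r
    & seq_of_ffun (sact r i) = u ++ i (hi r) :: i (lo r) :: w].
Proof.
have sn := size_seq_of_ffun i.
have [|u [a [b [w [sE ur]]]]] := @split_at _ (seq_of_ffun i) r.
  by rewrite sn; apply: hi_subproof.
have lo_a : i (lo r) = a.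
  by rewrite -(seq_of_ffunK i) sE ffunE /= nth_cat ur ltnn subnn.
have hi_b : i (hi r) = b.
  by rewrite -(seq_of_ffunK i) sE ffunE /= nth_cat ur ltnNge leqnSn /= subSnn.
rewrite lo_a hi_b; exists u, w; split=> //.
rewrite -{1}(seq_of_ffunK i) sE (@sact_ffun_of_seq e n) -?sE //.
by rewrite ffun_of_seqK //; move: sn; rewrite sE !size_cat.
Qed.

Lemma seq_of_ffun_head (i : resseq e n) (p : 'I_n) : p = 0%N :> nat ->
  exists w, seq_of_ffun i = i p :: w.
Proof.
move=> p0; case E: (seq_of_ffun i) => [|a w].
  by have := size_seq_of_ffun i; rewrite E /=; have := ltn_ord p; lia.
by exists w; rewrite -[in RHS](seq_of_ffunK i) ffunE p0 E.
Qed.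

Lemma seq_of_ffun_head2 (i : resseq e n) (p p' : 'I_n) :
  p = 0%N :> nat -> p' = 1%N :> nat -> exists w, seq_of_ffun i = i p :: i p' :: w.
Proof.
move=> p0 p1; case E: (seq_of_ffun i) => [|a [|b w]].
- by have := size_seq_of_ffun i; rewrite E /=; have := ltn_ord p; lia.
- by have := size_seq_of_ffun i; rewrite E /=; have := ltn_ord p'; lia.
by exists w; rewrite -[in RHS](seq_of_ffunK i) !ffunE p0 p1 E.
Qed.

End ResidueSequences.

Local Notation "x %:F" := (FracField.tofrac x) : ring_scope.

Section Deformation.
Variables (F : fieldType) (e l n : nat) (hkappa : 'I_l -> int).
Hypotheses (e_gt1 : (1 < e)%N) (l_gt1 : (1 < l)%N).
Hypothesis free : strongly_adjacency_free e n hkappa.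

Local Notation K := {fraction {poly F}}.
Local Notation kappa := (kappa_of e hkappa).
Local Notation rk := (rkap e hkappa l_gt1).
Local Notation N := #|{: n.-tuple 'I_l}|.

(** Distinct, as the matrix units require, and zero at [X = 0], where the
    relations of the blob algebra are recovered. *)
Definition xK (m : 'I_l) : K := ('X^(m.+1))%:F.
Definition XK (k : nat) : K := ('X^((k %% l).+1))%:F.

Lemma xK_inj : injective xK.
Proof.
move=> i j /eqP; rewrite tofrac_eq => /eqP/(congr1 (fun p : {poly F} => size p)).
by rewrite !size_polyXn => -[] /val_inj.
Qed.

Definition is_poly (c : K) : Prop := exists p : {poly F}, c = p%:F.

Local Notation psiK := (psiM n kappa xK).
Local Notation yK := (yM n xK).
Local Notation eK := (@eM K _ n l kappa).

Lemma two_neq0_res : 1 + 1 != 0 :> 'Z_e.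
Proof. exact: two_neq0_Z e_gt1 l_gt1 free. Qed.

Lemma blob_system_K (P : K -> Prop) : (forall k, P (XK k)) ->
  blob_system n l rk (@scalarM K n l P) (fun k => (XK k)%:M) psiK yK eK.
Proof.
move=> PX; apply: (blob_system_seminormal n two_neq0_res xK_inj) => //.
- by move=> k kl; rewrite rkap_small.
- by move=> k kl; rewrite /XK modn_small.
- by move=> k; rewrite /XK modnDr.
- exact: kappa_inj free.
- move=> a b; have [->|ab] := eqVneq b a; first by rewrite succ_neq.
  by have [] := kappa_sub free ab.
Qed.

Lemma is_poly1 : is_poly 1. Proof. by exists 1; rewrite tofrac1. Qed.
Lemma is_polyN1 : is_poly (-1). Proof. by exists (-1); rewrite tofracN tofrac1. Qed.
Lemma is_polyD a b : is_poly a -> is_poly b -> is_poly (a + b).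
Proof. by move=> [p ->] [q ->]; exists (p + q); rewrite tofracD. Qed.
Lemma is_polyM a b : is_poly a -> is_poly b -> is_poly (a * b).
Proof. by move=> [p ->] [q ->]; exists (p * q); rewrite tofracM. Qed.
Lemma is_poly_XK k : is_poly (XK k). Proof. by exists 'X^((k %% l).+1). Qed.

Local Notation ZP := (@scalarM K n l is_poly).

Lemma central_scalars_poly : central_scalars ZP.
Proof. exact: central_scalarM is_poly1 is_polyN1 is_polyD is_polyM. Qed.

Lemma blob_system_poly : blob_system n l rk ZP (fun k => (XK k)%:M) psiK yK eK.
Proof. exact: blob_system_K is_poly_XK. Qed.

Definition cst (a : F) : K := (a%:P)%:F.

(** Terms are evaluated, and not elements of the blob algebra: the matrices
    do not satisfy its relation for [y_1]. *)
Fixpoint ev (t : term F (blob_gen e n)) : 'M[K]_N :=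
  match t with
  | TGen (GPsi r) => psiK r
  | TGen (GY k) => yK k
  | TGen (GE i) => eK (seq_of_ffun i)
  | TZero => 0
  | TOne => 1
  | TAdd t u => ev t + ev u
  | TMul t u => ev t * ev u
  | TScale a t => cst a *: ev t
  end.

Local Notation gal := (gen_alg ZP psiK yK eK).

Lemma gal_scale p M : gal M -> gal (p%:F *: M).
Proof.
move=> gM; rewrite -mul_scalar_mx; apply: (gen_alg_M (a := (p%:F)%:M)) => //.
by apply: gen_alg_Z; exists p%:F => //; exists p.
Qed.

Lemma gal_ev t : gal (ev t).
Proof.
elim: t => //= [[r|k|i]//|||t ht u hu|t ht u hu|a t ht].
- by apply/gen_alg_Z/(cs0 central_scalars_poly).
- exact/gen_alg_Z/(cs1 central_scalars_poly).
- exact: gen_alg_D.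
- exact: gen_alg_M.
- exact: gal_scale.
Qed.

Lemma ev_sub t u : ev (TSub t u) = ev t - ev u.
Proof. by rewrite /= /cst polyCN tofracN polyC1 tofrac1 scaleN1r. Qed.

Lemma ev_scale1 a : ev (TScale a TOne) = (cst a)%:M.
Proof. by rewrite /= scalemx1. Qed.

Lemma evM t u : ev (TMul t u) = ev t * ev u. Proof. by []. Qed.

Lemma cst_kdelta (i : resseq e n) (r : 'I_n.-1) :
  (cst (kdelta F i r))%:M = (i (lo r) == i (hi r))%:R :> 'M[K]_N.
Proof.
rewrite /kdelta /cst; case: eqP => _; first by rewrite polyC1 tofrac1.
by rewrite polyC0 tofrac0 raddf0.
Qed.

Lemma cst_braid (a b c : 'Z_e) :
  cst (braid_coeff F a b c) *: (1 : 'M[K]_N) = braid_sign 'M[K]_N a b c.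
Proof.
rewrite /braid_coeff /braid_sign /cst; case: ifP => _.
  by rewrite polyCN tofracN polyC1 tofrac1 scaleN1r.
by case: ifP => _; rewrite ?polyC1 ?tofrac1 ?scale1r // polyC0 tofrac0 scale0r.
Qed.

(** The deformation affects only the relation for [y_1], whose left side is
    now a multiple of [X] by the choice of the parameters. *)
Lemma ev_rel t u : blob_rel kappa t u -> exists2 a, gal a & ev t - ev u = 'X%:F *: a.
Proof.
have BS := blob_system_poly; have KR := bs_klr BS.
have gal0 : gal 0 by apply/gen_alg_Z/(cs0 central_scalars_poly).
have exact_rel t' u' : ev t' = ev u' -> exists2 a, gal a & ev t' - ev u' = 'X%:F *: a.
  by move=> ->; exists 0; rewrite // subrr scaler0.
case=> {t u} [i|i j ij||i p p0 ki|i p p' p0 p1 ki pp'|i p p0 /existsP[m /eqP kp]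
  |r i|r i|r s|r s sl sh|r s rs|r i|r i|r i eq|r i ne1 ne2 ne3|r i up|r i down|r s i rs].
- apply: exact_rel; by rewrite /= (klr_e_mul KR) eqxx.
- apply: exact_rel; by rewrite /= (klr_e_mul KR) (inj_eq (@seq_of_ffun_inj _ _)) (negbTE ij).
- apply: exact_rel; rewrite (big_morph ev (op1 := +%R) (id1 := 0)) //= -(klr_e_sum KR).
  pose h (i : resseq e n) : n.-tuple 'Z_e := Tuple (introT eqP (size_seq_of_ffun i)).
  pose h' (s : n.-tuple 'Z_e) := ffun_of_seq n s.
  rewrite [RHS](reindex h) //; exists h' => [i _|s _]; first exact: seq_of_ffunK.
  by apply: val_inj; rewrite /= ffun_of_seqK ?size_tuple.
- apply: exact_rel; rewrite /=; have [w ->] := seq_of_ffun_head i p0; apply: (bs_cyc BS) => x xl.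
  apply: contraNneq ki => <-; apply/existsP; exists (Ordinal xl); apply/eqP.
  exact: rkap_small.
- apply: exact_rel; rewrite /=; have [w ->] := seq_of_ffun_head2 i p0 p1; rewrite pp'.
  have /existsP[m /eqP ->] := ki.
  have := bs_blob BS w (ltn_ord m); rewrite rkap_small.
  by congr (eK (kappa _ :: kappa _ + 1 :: w) = 0); apply: val_inj.
- have [w wE] := seq_of_ffun_head i p0.
  exists (('X^m)%:F *: eK (seq_of_ffun i)); first exact: gal_scale.
  rewrite /= subr0 wE kp p0.
  have := bs_y BS w (ltn_ord m); rewrite rkap_small.
  have -> : Ordinal (ltn_ord m) = m by apply: val_inj.
  by move=> ->; rewrite /XK modn_small // [LHS]mul_scalar_mx scalerA -tofracM -exprS.
- apply: exact_rel; exact: (klr_y_e KR).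
- apply: exact_rel; have [u [w [sE su sE']]] := seq_of_ffun_split i r.
  by rewrite /= sE sE' -su (klr_psi_e KR).
- apply: exact_rel; exact: (klr_yy KR).
- apply: exact_rel; by apply: (klr_psi_y KR); [move: sl | move: sh]; rewrite -val_eqE.
- apply: exact_rel; by case/orP: rs => rs; [|symmetry]; apply: (klr_psi_psi KR).
- apply: exact_rel; have [u [w [sE su _]]] := seq_of_ffun_split i r.
  have H := klr_psi_yS KR u (i (lo r)) (i (hi r)) w; rewrite -sE su in H.
  by rewrite evM [RHS]evM ev_sub ev_scale1 cst_kdelta; apply: H.
- apply: exact_rel; have [u [w [sE su _]]] := seq_of_ffun_split i r.
  have H := klr_yS_psi KR u (i (lo r)) (i (hi r)) w; rewrite -sE su in H.
  by rewrite evM [RHS]evM ev_sub ev_scale1 cst_kdelta; apply: H.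
- apply: exact_rel; have [u [w [sE su _]]] := seq_of_ffun_split i r.
  have H := klr_quad KR u (i (lo r)) (i (hi r)) w.
  by rewrite -sE su /quad eq eqxx mul0r in H.
- apply: exact_rel; have [u [w [sE su _]]] := seq_of_ffun_split i r.
  have H := klr_quad KR u (i (lo r)) (i (hi r)) w.
  rewrite -sE su quad_far ?mul1r // in H.
  by rewrite /far ne1 ne2; apply: contra_neq ne3 => ->; rewrite addrK.
- apply: exact_rel; have [u [w [sE su _]]] := seq_of_ffun_split i r.
  have H := klr_quad KR u (i (lo r)) (i (hi r)) w.
  rewrite -sE su /quad up succ_neq eqxx in H.
  by rewrite evM [RHS]evM ev_sub; apply: H.
- apply: exact_rel; have [u [w [sE su _]]] := seq_of_ffun_split i r.
  have H := klr_quad KR u (i (lo r)) (i (hi r)) w.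
  rewrite -sE su down (quad_pred _ two_neq0_res) in H.
  by rewrite evM [RHS]evM ev_sub; apply: H.
- apply: exact_rel; have [u [w [sE su _]]] := seq_of_ffun_split i r.
  case: w sE => [|c w] sE.
    by have := size_seq_of_ffun i; rewrite sE size_cat su /=; have := ltn_ord s; lia.
  have ic : i (hi s) = c.
    rewrite -(seq_of_ffunK i) sE ffunE /= rs nth_cat su ltnNge !leqW //=.
    by have -> : (r.+2 - r = 2)%N by lia.
  have H := klr_braid KR u (i (lo r)) (i (hi r)) c w; rewrite -sE su -ic -rs in H.
  by rewrite evM [RHS]evM /= cst_braid; apply: H.
Qed.

(** Divisibility by [X] inside the algebra over [F[X]], to which the spanning
    theorem applies with coefficients in [F[X]]. *)
Definition small (M : 'M[K]_N) : Prop := exists2 a, gal a & M = 'X%:F *: a.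

Lemma small0 : small 0.
Proof. by exists 0; [apply/gen_alg_Z/(cs0 central_scalars_poly) | rewrite scaler0]. Qed.

Lemma smallD M M' : small M -> small M' -> small (M + M').
Proof. by move=> [a ga ->] [b gb ->]; exists (a + b); [apply: gen_alg_D | rewrite scalerDr]. Qed.

Lemma smallL a M : gal a -> small M -> small (a * M).
Proof.
by move=> ga [b gb ->]; exists (a * b); [apply: gen_alg_M | rewrite -[LHS]scalemxAr].
Qed.

Lemma smallR a M : gal a -> small M -> small (M * a).
Proof.
by move=> ga [b gb ->]; exists (b * a); [apply: gen_alg_M | rewrite -[LHS]scalemxAl].
Qed.

Lemma smallZ c M : small M -> small (cst c *: M).
Proof.
move=> [a ga ->]; exists (cst c *: a); first exact: gal_scale.
by rewrite !scalerA mulrC.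
Qed.

Lemma smallN M : small M -> small (- M).
Proof.
move=> sM; have := smallZ (-1) sM.
by rewrite /cst polyCN tofracN polyC1 tofrac1 scaleN1r.
Qed.

Lemma cstE : (cst 1 = 1) * (cst (-1) = -1).
Proof. by rewrite /cst polyCN tofracN polyC1 tofrac1. Qed.

Lemma ev_cong t u : cong (blob_rel kappa) t u -> small (ev t - ev u).
Proof.
have eqs M M' : M = M' -> small (M - M') by move=> ->; rewrite subrr; apply: small0.
elim=> {t u}.
- exact: ev_rel.
- by move=> t; apply: eqs.
- by move=> t u _ /smallN; rewrite opprB.
- by move=> t u v _ tu _ uv; rewrite -(subrKA (ev u)); apply: smallD.
- by move=> t t' u u' _ tt' _ uu'; rewrite /= opprD addrACA; apply: smallD.
- move=> t t' u u' _ tt' _ uu' /=.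
  have -> : ev t * ev u - ev t' * ev u' = (ev t - ev t') * ev u + ev t' * (ev u - ev u').
    by rewrite mulrBl mulrBr subrKA.
  by apply: smallD; [apply: smallR | apply: smallL] => //; apply: gal_ev.
- by move=> a t t' _ tt'; rewrite /= -scalerBr; apply: smallZ.
- by move=> *; apply: eqs; rewrite /= addrA.
- by move=> *; apply: eqs; rewrite /= addrC.
- by move=> *; apply: eqs; rewrite /= add0r.
- by move=> *; apply: eqs; rewrite /= cstE scaleN1r addNr.
- by move=> *; apply: eqs; rewrite /= mulrA.
- by move=> *; apply: eqs; rewrite /= mul1r.
- by move=> *; apply: eqs; rewrite /= mulr1.
- by move=> *; apply: eqs; rewrite /= mulrDl.
- by move=> *; apply: eqs; rewrite /= mulrDr.
- by move=> *; apply: eqs; rewrite /= scalerA /cst polyCM tofracM.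
- by move=> *; apply: eqs; rewrite /= cstE scale1r.
- by move=> *; apply: eqs; rewrite /= scalerDr.
- by move=> *; apply: eqs; rewrite /= /cst polyCD tofracD scalerDl.
- by move=> *; apply: eqs; rewrite /=; apply: scalemxAl.
- by move=> *; apply: eqs; rewrite /=; apply: scalemxAr.
Qed.

Local Notation B := (blob F n kappa).

(** A relation and not a function, since the value depends on the term, but
    only up to small matrices. *)
Definition lifts (b : B) (M : 'M[K]_N) : Prop :=
  exists2 t, b = palg_class (blob_rel kappa) t & M = ev t.

Lemma lifts_small b M M' : lifts b M -> lifts b M' -> small (M - M').
Proof.
by move=> [t tE ->] [u uE ->]; apply: ev_cong; apply/palg_eqP; rewrite -tE uE.
Qed.

Lemma lifts0 : lifts 0 0. Proof. by exists TZero. Qed.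

Lemma liftsD b b' M M' : lifts b M -> lifts b' M' -> lifts (b + b') (M + M').
Proof. by move=> [t -> ->] [u -> ->]; exists (TAdd t u); rewrite ?palg_classD. Qed.

Lemma liftsM b b' M M' : lifts b M -> lifts b' M' -> lifts (b * b') (M * M').
Proof. by move=> [t -> ->] [u -> ->]; exists (TMul t u); rewrite ?palg_classM. Qed.

Lemma liftsZ c b M : lifts b M -> lifts (c *: b) (cst c *: M).
Proof. by move=> [t -> ->]; exists (TScale c t); rewrite ?palg_classZ. Qed.

Local Notation psiF := (@psiB F e l n kappa).
Local Notation eF := (@eB F e l n kappa).

Lemma lifts_psiw W : lifts (psiw psiF W) (psiw psiK W).
Proof.
elim: W => [|r W IH]; first by rewrite /psiw !big_nil; exists TOne.
rewrite /psiw !big_cons; apply: liftsM => //.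
rewrite /psiB; case: insubP => [i _ <-|nr]; first by exists (TGen (GPsi e i)).
exists TZero => //; apply: (klr_psi_oob (bs_klr blob_system_poly)).
by move: nr; rewrite -leqNgt; lia.
Qed.

Lemma lifts_e (i : resseq e n) : lifts (eF (seq_of_ffun i)) (eK (seq_of_ffun i)).
Proof. by exists (TGen (GE i)); rewrite // eB_ffun. Qed.

Lemma lifts_sum (T : finType) (c : T -> F) (f : T -> B) (g : T -> 'M[K]_N) :
  (forall x, lifts (f x) (g x)) ->
  lifts (\sum_x c x *: f x) (\sum_x cst (c x) *: g x).
Proof.
move=> fg; elim/big_ind2: _ => [|b M b' M'|x _]; first exact: lifts0.
- exact: liftsD.
- exact: liftsZ.
Qed.

Variable rex : 'S_n -> seq 'I_n.-1.
Hypothesis rex_reduced : forall w, reduced_expr (rex w) w.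

Local Notation J := {lam : Par1 l n & StdPair lam}.
Local Notation famK := (@cell_family e l n hkappa rex 'M[K]_N psiK eK).
Local Notation famF := (@cell_family e l n hkappa rex B psiF eF).

Lemma lifts_family x : lifts (famF x) (famK x).
Proof.
by apply: liftsM; [apply: liftsM|]; [apply: lifts_psiw | apply: lifts_e | apply: lifts_psiw].
Qed.

Lemma star_prod (s : seq 'I_n.-1) :
  blob_star (\prod_(r <- s) blob_psi F kappa r : B) = \prod_(r <- rev s) blob_psi F kappa r.
Proof.
elim: s => [|r s IH]; first by rewrite !big_nil blob_star1.
by rewrite big_cons blob_starM IH blob_star_gen rev_cons -cats1 big_cat big_seq1.
Qed.

Lemma psiw_map (s : seq 'I_n.-1) :
  psiw psiF (map val s) = \prod_(r <- s) blob_psi F kappa r.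
Proof. by rewrite /psiw big_map; apply: eq_bigr => r _; rewrite psiB_ord. Qed.

Lemma mst_familyE x : mst_family F kappa rex x = famF x.
Proof.
rewrite /mst_family /mst /psi_perm star_prod /cell_family /tab_word -map_rev !psiw_map.
by rewrite [eF _]eB_ffun.
Qed.

Lemma mst_spanning : spanning (mst_family F kappa rex).
Proof.
move=> b.
have BS := @blob_system_blob F e l n kappa rk (fun k kl => rkap_small e hkappa l_gt1 kl).
have CS := central_scalarB F n kappa.
have [c Zc ->] := family_span e_gt1 free rex_reduced CS BS (gen_alg_blob b).
have [d dE] : exists d : J -> F, forall x, c x = d x *: (1 : B).
  by exists (fun x => projT1 (cid (Zc x))) => x; apply: (projT2 (cid (Zc x))).
exists d; apply: eq_bigr => x _.
by rewrite dE mst_familyE -palg_scalerAl mul1r.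
Qed.

(** All matrix units between words of the same content lie in the span of the
    family, and [column_word] embeds the index set of the family into that of the
    units. *)
Lemma familyK_free (c : J -> K) : \sum_x c x *: famK x = 0 -> forall x, c x = 0.
Proof.
pose Q := {q : n.-tuple 'I_l * n.-tuple 'I_l | perm_eq q.1 q.2}.
pose row (q : Q) := enum_rank (val q).1; pose col (q : Q) := enum_rank (val q).2.
apply: (@free_of_span K N J Q famK row col).
- move=> [[a b] ab] [[a' b'] ab'] [] /enum_rank_inj/= aa /enum_rank_inj/= bb.
  by apply: val_inj; rewrite /= aa bb.
- pose f (x : J) : Q := exist _ (column_word (val (tagged x).1), column_word (val (tagged x).2))
    (perm_column_word _ _).
  by apply: (leq_card f) => x y /(congr1 val); apply: column_word_inj.
move=> [[u w] /= uw].
have -> : delta_mx (row (exist _ (u, w) uw)) (col (exist _ (u, w) uw)) = unit_mx K n u w.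
  by rewrite /unit_mx !cv_tuple trmx_delta mul_delta_mx.
have CT : central_scalars (@scalarM K n l (fun=> True)) by apply: central_scalarM.
have BT : blob_system n l rk (@scalarM K n l (fun=> True)) (fun k => (XK k)%:M) psiK yK eK.
  exact: blob_system_K.
have un : size u = n by rewrite size_tuple.
have gu := gen_alg_unit_perm kappa two_neq0_res xK_inj (p := [::]) uw un.
have [d Zd dE] := family_span e_gt1 free rex_reduced CT BT gu.
have [d' d'E] : exists d' : J -> K, forall x, d x = (d' x)%:M.
  exists (fun x => projT1 (cid2 (Zd x))) => x.
  by case: (cid2 (Zd x)).
exists d'; rewrite dE; apply: eq_bigr => x _.
by rewrite d'E [LHS]mul_scalar_mx.
Qed.

(** A relation in the blob algebra becomes one between free matrices, whose
    coefficients [c x - X p x] vanish; their values at [X = 0] are [c x]. *)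
Lemma mst_independent : linearly_independent (mst_family F kappa rex).
Proof.
move=> c c0; have := lifts_sum c lifts_family.
rewrite (eq_bigr (fun x => c x *: mst_family F kappa rex x)) => [|x _]; last first.
  by rewrite mst_familyE.
rewrite c0 => /lifts_small/(_ lifts0)[a ga]; rewrite subr0.
have [d Zd ->] := family_span e_gt1 free rex_reduced central_scalars_poly blob_system_poly ga.
have [p pE] : exists p : J -> {poly F}, forall x, d x = ((p x)%:F)%:M.
  have Zd' x : exists q : {poly F}, d x = (q%:F)%:M.
    by have [_ [q ->] ->] := Zd x; exists q.
  by exists (fun x => projT1 (cid (Zd' x))) => x; apply: (projT2 (cid (Zd' x))).
move=> /eqP; rewrite -subr_eq0 scaler_sumr -sumrB => /eqP E x.
have /familyK_free/(_ x)/eqP : \sum_x (((c x)%:P - 'X * p x)%:F) *: famK x = 0.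
  rewrite -[RHS]E; apply: eq_bigr => z _.
  by rewrite tofracB tofracM scalerBl pE [X in _ - 'X%:F *: X]mul_scalar_mx scalerA.
rewrite tofrac_eq0 => /eqP/(congr1 (fun q => q.[0])).
by rewrite hornerD hornerN hornerM hornerX !hornerC mul0r subr0.
Qed.

End Deformation.

Theorem theorem30 (F : fieldType) (e l n : nat)
    (e_gt1 : (1 < e)%N) (l_gt1 : (1 < l)%N) (n_gt1 : (1 < n)%N)
    (q : F) (q_neq1 : (q != 1)%R) (q_prim : (e.-primitive_root q)%R)
    (hkappa : 'I_l -> int) (hkappa_free : strongly_adjacency_free e n hkappa)
    (rex : 'S_n -> seq 'I_n.-1) (rex_reduced : forall w, reduced_expr (rex w) w) :
  linearly_independent (mst_family F (kappa_of e hkappa) rex) /\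
  is_basis (mst_family F (kappa_of e hkappa) rex).
Proof.
have ind := mst_independent (F := F) e_gt1 l_gt1 hkappa_free rex_reduced.
by split; [|split] => //; apply: mst_spanning.
Qed.
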